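(* Let $Q=(0,2\pi)\times\mathbb T^d$, let $G\subset Q$ be an admissible measurable product set, and let $c\in\mathbb R$. Then there exists a constant $C>0$, depending only on $d$, $c$ and $G$, such that $$\|\phi\|_{L^2(\mathbb T^d)}^2\le C\,\|\operatorname{Re}e^{it(\Delta+c)}\phi\|_{L^2(G)}^2+\|P_{(\mathcal K_c)_{\operatorname{Im}}}\phi\|_{L^2(\mathbb T^d)}^2\qquad\text{for all }\phi\in L^2(\mathbb T^d;\mathbb C).$$
   Context: $\mathbb T^d=\mathbb R^d/(2\pi\mathbb Z)^d$. $\mathcal K_c=\operatorname{span}_{\mathbb C}\{e^{in\cdot x}:n\in\mathbb Z^d,\ |n|^2=c\}$, $(\mathcal K_c)_{\operatorname{Im}}=\{i\operatorname{Im}\phi:\phi\in\mathcal K_c\}$, and $P_{(\mathcal K_c)_{\operatorname{Im}}}\phi=i\operatorname{Im}(\Pi_S\phi)$, where $\Pi_S$ is the Fourier projection onto the modes $e^{in\cdot x}$ with $n\in S=\{n\in\mathbb Z^d:|n|^2=c\}$. Admissible measurable product set: write $z=(z_0,z_1,\dots,z_d)=(t,x_1,\dots,x_d)$, $Q_0=(0,2\pi)$, $Q_\ell=\mathbb T$ for $\ell\ge1$, and for $\alpha\subset\{0,\dots,d\}$ put $z_\alpha=(z_\ell)_{\ell\in\alpha}$, $Q_\alpha=\prod_{\ell\in\alpha}Q_\ell$. A measurable set $G\subset Q$ is an admissible measurable product set if there are a partition $\{0,\dots,d\}=\alpha_1\sqcup\cdots\sqcup\alpha_m$ with $1\le\#\alpha_j\le2$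 for all $j$, and measurable sets $G_j\subset Q_{\alpha_j}$ of positive Lebesgue measure (in their coordinate spaces), such that $G=\prod_{j=1}^mG_j$, i.e. $G=\{z\in Q: z_{\alpha_j}\in G_j,\ j=1,\dots,m\}$. *)

(* Defs.v *)
From HB Require Import structures.
From mathcomp Require Import all_boot all_order all_algebra.
From mathcomp Require Import complex.
From mathcomp Require Import all_classical all_reals all_analysis.

Set Implicit Arguments.
Unset Strict Implicit.
Unset Printing Implicit Defensive.

Import Order.TTheory GRing.Theory Num.Theory.
Import numFieldNormedType.Exports.

Local Open Scope classical_set_scope.
Local Open Scope ring_scope.

Notation Rn R n := (n.-tuple (measurableTypeR R)).

Section lebesgue_Rn.
Context {R : realType}.
Local Open Scope ereal_scope.

Definition Rcons n (p : measurableTypeR R * Rn R n) : Rn R n.+1 :=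
  [the n.+1.-tuple _ of p.1 :: p.2].

Lemma measurable_Rcons n : measurable_fun setT (@Rcons n).
Proof. exact: measurable_cons. Qed.

Definition lebesgue_step n (m : {sigma_finite_measure set (Rn R n) -> \bar R}) :
    set (Rn R n.+1) -> \bar R :=
  pushforward (lebesgue_measure \x m) (@Rcons n).

Section step.
Variables (n : nat) (m : {sigma_finite_measure set (Rn R n) -> \bar R}).

Let lebesgue_step0 : lebesgue_step m set0 = 0.
Proof. by rewrite /lebesgue_step /pushforward preimage_set0 measure0. Qed.

Let lebesgue_step_ge0 A : 0 <= lebesgue_step m A.
Proof. by rewrite /lebesgue_step /pushforward. Qed.

Let lebesgue_step_sigma_additive : semi_sigma_additive (lebesgue_step m).
Proof.
have preim A : measurable A -> measurable (@Rcons n @^-1` A).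
  by move=> mA; rewrite -[X in measurable X]setTI; exact: measurable_Rcons.
move=> F mF tF mUF; rewrite /lebesgue_step /pushforward preimage_bigcup.
apply: measure_semi_sigma_additive.
- by move=> k; exact: preim.
- apply/trivIsetP => /= i j _ _ ij; rewrite -preimage_setI.
  by move/trivIsetP : tF => /(_ _ _ _ _ ij) ->//; rewrite preimage_set0.
- by rewrite -preimage_bigcup; exact: preim.
Qed.

HB.instance Definition _ := isMeasure.Build _ _ _ (lebesgue_step m)
  lebesgue_step0 lebesgue_step_ge0 lebesgue_step_sigma_additive.

Let lebesgue_step_sigma_finite : sigma_finite setT (lebesgue_step m).
Proof.
have /sigma_finiteP[F [TF ndF Foo]] := sigma_finiteT (@lebesgue_measure R).
have /sigma_finiteP[G [TG ndG Goo]] := sigma_finiteT m.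
pose hd := fun x : Rn R n.+1 => tnth x ord0.
pose tl := fun x : Rn R n.+1 => [tuple of behead x] : Rn R n.
exists (fun k => (hd @^-1` F k) `&` (tl @^-1` G k)).
  apply/seteqP; split => // x _.
  have [i _ Fi] : (\bigcup_k F k) (hd x) by rewrite -TF.
  have [j _ Gj] : (\bigcup_k G k) (tl x) by rewrite -TG.
  exists (maxn i j) => //; split => /=.
    by move: Fi; apply/subsetPset/ndF/leq_maxl.
  by move: Gj; apply/subsetPset/ndG/leq_maxr.
move=> k; have [mF Fk] := Foo k; have [mG Gk] := Goo k; split.
  apply: measurableI; rewrite -[X in measurable X]setTI.
    exact: (@measurable_tnth _ (measurableTypeR R) n.+1 ord0).
  exact: (@measurable_behead _ (measurableTypeR R) n).
rewrite /lebesgue_step /pushforward.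
rewrite (_ : _ @^-1` _ = F k `*` G k).
  by rewrite product_measure1E// lte_mul_pinfty// ge0_fin_numE.
apply/seteqP; split => -[a b] /=; rewrite /hd /tl /= (tnth_nth 0%R) /=;
  by rewrite (_ : [tuple of _] = b)//; apply: val_inj.
Qed.

HB.instance Definition _ := Measure_isSigmaFinite.Build _ _ _
  (lebesgue_step m) lebesgue_step_sigma_finite.

End step.

(* Lebesgue measure on the Borel subsets of R^n, as the iterated product
   lebesgue_measure \x (... \x (lebesgue_measure \x dirac)). *)
Fixpoint lebesgueRn (n : nat) : {sigma_finite_measure set (Rn R n) -> \bar R} :=
  if n is k.+1 then lebesgue_step (lebesgueRn k)
  else \d_([tuple] : Rn R 0).

(* The completion of [lebesgueRn n]: the restriction of the Lebesgue outer
   measure to its Caratheodory-measurable (i.e. Lebesgue-measurable) sets. *)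
Definition completed_lebesgueRn (n : nat) :
    {measure set (caratheodory_type (mu_ext (lebesgueRn n))) -> \bar R} :=
  @completed_measure_extension _ _ R (lebesgueRn n).

Definition lebesgue_measurable (n : nat) (A : set (Rn R n)) : Prop :=
  (mu_ext (lebesgueRn n)).-caratheodory A.

End lebesgue_Rn.

Arguments completed_lebesgueRn {R} n.

Section complex_functions.
Context {R : realType} d {T : measurableType d}.

Definition cmeasurable_fun (D : set T) (f : T -> R[i]) : Prop :=
  measurable_fun D (fun x => complex.Re (f x)) /\
  measurable_fun D (fun x => complex.Im (f x)).

Definition cintegral (mu : {measure set T -> \bar R}) (D : set T)
    (f : T -> R[i]) : R[i] :=
  ((\int[mu]_(x in D) complex.Re (f x)) +i*
   (\int[mu]_(x in D) complex.Im (f x)))%C.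

Definition sqL2norm (mu : {measure set T -> \bar R}) (D : set T)
    (f : T -> R[i]) : \bar R :=
  (\int[mu]_(x in D) ((Normc.normc (f x)) ^+ 2)%:E)%E.

End complex_functions.

Definition expi {R : realType} (a : R) : R[i] := (cos a +i* sin a)%C.

Section torus.
Context {R : realType} (d : nat).

(* Functions on the torus (R / 2 pi Z)^d are represented by functions on R^d of
   which only the values on the fundamental domain [0, 2 pi[^d matter. *)
Definition torus : set (Rn R d) :=
  [set x | forall l, tnth x l \in `[0, 2 * pi[].

(* Square-integrable Borel functions: representatives of the elements of
   L^2(T^d; C). *)
Definition L2torus (f : Rn R d -> R[i]) : Prop :=
  cmeasurable_fun torus f /\ (sqL2norm (lebesgueRn d) torus f < +oo)%E.

Definition dotp (n : d.-tuple int) (x : Rn R d) : R :=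
  \sum_(l < d) (tnth n l)%:~R * tnth x l.

Definition sqnorm (n : d.-tuple int) : R := \sum_(l < d) (tnth n l)%:~R ^+ 2.

Definition fourier_coef (f : Rn R d -> R[i]) (n : d.-tuple int) : R[i] :=
  ((2 * pi) ^- d)%:C%C *
  cintegral (lebesgueRn d) torus (fun x => f x * expi (- dotp n x)).

(* [g] is a representative of e^{it(Delta + c)} f, i.e. of the image of [f] by
   the Fourier multiplier with symbol e^{it(c - |n|^2)}. *)
Definition schrodinger (c t : R) (f g : Rn R d -> R[i]) : Prop :=
  L2torus g /\
  forall n, fourier_coef g n = expi (t * (c - sqnorm n)) * fourier_coef f n.

Definition frequencies (c : R) : set (d.-tuple int) := [set n | sqnorm n = c].

(* The index set is finite, so this is a genuine (finite) sum. *)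
Definition fourier_proj (c : R) (f : Rn R d -> R[i]) (x : Rn R d) : R[i] :=
  \sum_(n \in frequencies c) fourier_coef f n * expi (dotp n x).

Definition proj_Im (c : R) (f : Rn R d -> R[i]) (x : Rn R d) : R[i] :=
  (0 +i* complex.Im (fourier_proj c f x))%C.

(* Coordinate 0 is the time t, coordinates 1, ..., d are x_1, ..., x_d. *)
Definition coord_domain (l : 'I_d.+1) : set R :=
  if l == ord0 then `]0, 2 * pi[%classic else `[0, 2 * pi[%classic.

Definition spacetime : set (Rn R d.+1) :=
  [set z | forall l, coord_domain l (tnth z l)].

(* z_alpha = (z_l)_{l in alpha}, with the indices in increasing order. *)
Definition subcoord (alpha : {set 'I_d.+1}) (z : Rn R d.+1) : Rn R #|alpha| :=
  [tuple tnth z (enum_val k) | k < #|alpha|].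

Definition subdomain (alpha : {set 'I_d.+1}) : set (Rn R #|alpha|) :=
  [set w | forall k, coord_domain (enum_val k) (tnth w k)].

Definition admissible (G : set (Rn R d.+1)) : Prop :=
  exists (P : {set {set 'I_d.+1}})
         (Gs : forall alpha : {set 'I_d.+1}, set (Rn R #|alpha|)),
  [/\ finset.partition P [set: 'I_d.+1]%SET,
      (forall alpha, alpha \in P ->
        [/\ (1 <= #|alpha| <= 2)%N,
            Gs alpha `<=` @subdomain alpha,
            lebesgue_measurable (Gs alpha) &
            (0 < completed_lebesgueRn _ (Gs alpha))%E]) &
      G = [set z | spacetime z /\
                   forall alpha, alpha \in P -> Gs alpha (subcoord alpha z)]].

(* [u] is a Borel representative, on (0, 2 pi) x T^d, of
   (t, x) |-> (e^{it(Delta + c)} f)(x). Every f in L^2 has one, unique up to a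
   null set: along a subsequence the Fourier partial sums converge for every t
   and almost every x, since their tails have L^2 norms independent of t. *)
Definition schrodinger_flow (c : R) (f : Rn R d -> R[i])
    (u : Rn R d.+1 -> R[i]) : Prop :=
  cmeasurable_fun spacetime u /\
  forall t, t \in `]0, 2 * pi[ ->
    schrodinger c t f (fun x => u [tuple of t :: x]).

End torus.

Arguments torus {R} d.
Arguments spacetime {R} d.

(* Main.v *)
Require Import Defs.
From HB Require Import structures.
From mathcomp Require Import all_boot all_order all_algebra.
From mathcomp Require Import complex.
From mathcomp Require Import all_classical all_reals all_analysis.
From mathcomp Require Import measurable_realfun.
From mathcomp Require Import ring lra zify.

Set Implicit Arguments.
Unset Strict Implicit.
Unset Printing Implicit Defensive.

Import Order.TTheory GRing.Theory Num.Theory.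
Import numFieldNormedType.Exports.

(** The flow turns phi = sum a_n e^{in.x} into sum a_n e^{it(c-|n|^2)} e^{in.x},
    so twice the real part of the flow is a superposition of forward waves
    e^{it(c-|n|^2)} e^{in.x} and of backward waves e^{-it(c-|n|^2)} e^{in.x}
    with coefficients a_n and conj a_{-n}.  For |n|^2 = c the two waves
    coincide, and only a_n + conj a_{-n} is seen; the difference
    a_n - conj a_{-n} is what the projection term measures.  The estimate
    thus amounts to a lower bound, uniform over finite sums, for the energy of
    such superpositions on G (finite_observability); energy_lower,
    proj_Im_mass and observed_energy translate it back to the flow by
    Parseval's identity, each time slice having the same Fourier defect.

    First G is shrunk to a product of Borel sets over blocks of at most two
    coordinates (admissible_core).  Products of this kind are special because
    of small_weight: for a weight H of one small block, the quadratic form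
    that integrates H times the squared modulus of a superposition of waves of
    one sign is bounded by the mean-square norm of H.  The reason is
    arithmetical.  Two waves interact through H only if their space-time
    frequencies (|n|^2, n) agree off the block, and then a given Fourier
    coefficient of H serves at most two pairs of waves: fixing the difference
    of two such frequencies puts them on a line, and either on a circle (two
    space coordinates) or at a single point (fiber_count).  Hence the
    indicator of G may be replaced, as a quadratic form, by a trigonometric
    polynomial (trigapproxM).

    This makes waves of one sign interact only over bounded distances in
    (|n|^2, n), and gives two facts.  Small translations of G cost little
    (rot_close); comparing a superposition with its translate, which kills one
    chosen frequency, shows that a single frequency can be added to an
    observable family (add_frequency).  And observability of one-way waves
    follows by induction on the rank of the differences of the frequencies
    (observable_rkS): a tiling with a suitable offset cuts the family into
    bounded pieces at little cost, a piece whose interactions do not span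
    splits into families of smaller rank, and the remaining bad frequencies
    are almost orthogonal to a spanning set of short vectors, so that their
    number is bounded and they can be added one at a time.

    For two-way waves the interaction between a forward and a backward wave
    has time frequency |n|^2 + |m|^2, beyond the spectrum of the polynomial
    when both are large (high_frequency).  The finitely many remaining
    frequencies are added one at a time; a single pair of waves off the
    resonant sphere is observable because e^{2it(c-|n|^2)} is not constant on
    a set of positive measure (oscillation). *)

Local Open Scope classical_set_scope.
Local Open Scope ring_scope.

Notation Re := complex.Re.
Notation Im := complex.Im.

(** * Boxes and uniqueness of measures *)

Section boxes.
Context {R : realType}.

Definition box N (A : 'I_N -> set R) : set (Rn R N) :=
  [set x | forall i, A i (tnth x i)].

Lemma measurable_box N (A : 'I_N -> set R) :
  (forall i, measurable (A i : set (measurableTypeR R))) -> measurable (box A).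
Proof.
move=> mA.
have -> : box A = \big[setI/setT]_(i < N) ((fun x : Rn R N => tnth x i) @^-1` A i).
  apply/seteqP; split => x /=.
    by move=> Ax; elim/big_ind : _ => //= B C Bx Cx; split.
  move=> + i; rewrite (bigD1 i)//= => -[].
  by [].
apply: bigsetI_measurable => i _; rewrite -[X in measurable X]setTI.
exact: (@measurable_tnth _ (measurableTypeR R) N i).
Qed.

Lemma lebesgueRn_box N (A : 'I_N -> set R) :
  (forall i, measurable (A i : set (measurableTypeR R))) ->
  lebesgueRn N (box A) = (\prod_(i < N) lebesgue_measure (A i))%E.
Proof.
elim: N A => [|N IH] A mA.
  rewrite big_ord0 /= diracE (_ : _ \in _) ?inE//=.
  by move=> [].
rewrite big_ord_recl -IH//=.
rewrite /lebesgue_step /pushforward -product_measure1E//; last first.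
  by apply: measurable_box => i; exact: mA.
congr (_ _); apply/seteqP; split => -[a b] /=.
  move=> h; split; first by have := h ord0.
  by move=> i; have := h (lift ord0 i); rewrite /= tnthS.
move=> [Aa Ab] i; case: (unliftP ord0 i) => [j ->|->//].
by rewrite tnthS; exact: Ab.
Qed.

Definition cube N (a : R) : set (Rn R N) := box (fun=> `[- a, a]%classic).

Definition boxes N : set (set (Rn R N)) :=
  [set box A | A in [set A | forall i, measurable (A i : set (measurableTypeR R))]].

Lemma measurable_boxes N : @measurable _ (Rn R N) = <<s @boxes N >>.
Proof.
apply/seteqP; split.
  apply: smallest_sub; first exact: smallest_sigma_algebra.
  move=> A; rewrite -bigcup_seq => -[i _] [B mB <-]; apply: sub_sigma_algebra.
  exists (fun j => if j == i then B else setT); first by move=> j /=; case: ifP.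
  rewrite setTI; apply/seteqP; split => x /=; first by move=> /(_ i); rewrite eqxx.
  by move=> Bx j; case: eqP => [->|].
apply: smallest_sub; first exact: sigma_algebra_measurable.
by move=> _ [A mA <-]; exact: measurable_box.
Qed.

(** The boxes form a generating pi-system, and the cubes exhaust the space by
    boxes of finite measure. *)
Lemma box_measure_unique N (m1 m2 : {measure set (Rn R N) -> \bar R}) :
  (forall A : 'I_N -> set R, (forall i, measurable (A i : set (measurableTypeR R))) ->
     m1 (box A) = m2 (box A)) ->
  (forall a : R, (m1 (@cube N a) < +oo)%E) ->
  forall A, measurable A -> m1 A = m2 A.
Proof.
move=> m12 fin A mA.
apply: (measure_unique (@boxes N) (fun k => @cube N k%:R)) => //.
- exact: measurable_boxes.
- move=> _ _ [B mB <-] [C mC <-]; exists (fun i => B i `&` C i).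
    by move=> i; exact: measurableI.
  apply/seteqP; split => x /=.
    by move=> h; split=> i; have [] := h i.
  by move=> [h1 h2] i; split.
- by move=> k; exists (fun=> `[- k%:R, k%:R]%classic) => // i /=; exact: measurable_itv.
- apply/seteqP; split => // x _.
  have [k kP] : exists k : nat, forall i, `|tnth x i| <= k%:R.
    have /choice[f fP] : forall i, exists k : nat, `|tnth x i| <= k%:R.
      move=> i; exists (Num.truncn `|tnth x i|).+1; apply/ltW.
      exact: truncnS_gt.
    exists (\max_i f i) => i; apply: (le_trans (fP i)).
    by rewrite ler_nat; exact: leq_bigmax.
  by exists k => // i /=; rewrite in_itv/= -ler_norml kP.
- by move=> _ [B mB <-]; exact: m12.
Qed.

Lemma lebesgueRn_box_fin N (a : R) :
  (lebesgueRn N (@cube N a) < +oo)%E.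
Proof.
rewrite /cube lebesgueRn_box; last by move=> i; exact: measurable_itv.
set c := lebesgue_measure _; have cfin : c \is a fin_num.
  by rewrite /c lebesgue_measure_itv/=; case: ifP.
rewrite big_const_ord; elim: N => [|N IH] /=; first by rewrite ltry.
rewrite -(fineK cfin) lte_mul_pinfty//; first by rewrite fineK// measure_ge0.
by rewrite fineK.
Qed.

End boxes.

(** * Rotations of the torus *)

Section rotation.
Context {R : realType}.
Notation mu := (@lebesgue_measure R).

Lemma measurable_add (h : R) :
  measurable_fun setT (fun x : measurableTypeR R => x + h : measurableTypeR R).
Proof. by apply: measurable_funD => //; exact: measurable_cst. Qed.

Lemma lebesgue_measure_translation (h : R) (A : set (measurableTypeR R)) :
  measurable A -> mu ((fun x => x + h) @^-1` A) = mu A.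
Proof.
move=> mA; apply/esym.
apply: (@lebesgue_measure_unique R (pushforward mu (fun x : measurableTypeR R => x + h : measurableTypeR R))) => //=.
  exact: measurable_add.
move=> mf _ [[a b]] _ <-.
rewrite /pushforward (_ : _ @^-1` _ = `]a - h, b - h]%classic); last first.
  by apply/seteqP; split => x /=; rewrite !in_itv/= ltrBlDr lerBrDr.
by rewrite !lebesgue_measure_itv/= !lte_fin ltrD2r -!EFinB; congr (if _ then (_%:E) else _); ring.
Qed.

Definition circle : set R := `[0, 2 * pi[%classic.

(** Rotation of the circle read on the fundamental domain; the points outside
    stay fixed, which makes it preserve the measure of the whole line. *)
Definition rot1 (h x : R) : R :=
  if (0 <= x) && (x < 2 * pi) then (if x + h < 2 * pi then x + h else x + h - 2 * pi)
  else x.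

Lemma twopi_gt0 : 0 < 2 * pi :> R.
Proof. by rewrite mulr_gt0// pi_gt0. Qed.

Lemma rot1_circle (h x : R) : 0 <= h < 2 * pi -> circle x -> circle (rot1 h x).
Proof.
rewrite /circle /= !in_itv/= /rot1 => /andP[h0 h2] /andP[x0 x2].
rewrite x0 x2 /=; case: ltP => [xh|xh]; apply/andP; split; lra.
Qed.

Lemma measurable_rot1 h :
  measurable_fun setT (rot1 h : measurableTypeR R -> measurableTypeR R).
Proof.
apply: measurable_fun_ifT.
- apply: measurable_and => //=; first exact: measurable_fun_ler.
  exact: measurable_fun_ltr.
- apply: measurable_fun_ifT.
  + apply: measurable_fun_ltr => //; exact: measurable_add.
  + exact: measurable_add.
  + exact: (measurableT_comp (measurable_add (- (2 * pi))) (measurable_add h)).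
- exact: measurable_id.
Qed.

(** A rotation is a translation on each of the two arcs into which it cuts the
    circle. *)
Lemma lebesgue_measure_rot1 h (A : set (measurableTypeR R)) :
  0 <= h < 2 * pi -> measurable A -> mu (rot1 h @^-1` A) = mu A.
Proof.
move=> /andP[h0 h2] mA.
pose S0 := A `\` circle; pose S1 := A `&` `[h, 2 * pi[%classic.
pose S2 := A `&` `[0, h[%classic.
have mS0 : measurable (S0 : set (measurableTypeR R)).
  by apply: measurableD => //; exact: measurable_itv.
have mS1 : measurable (S1 : set (measurableTypeR R)).
  by apply: measurableI => //; exact: measurable_itv.
have mS2 : measurable (S2 : set (measurableTypeR R)).
  by apply: measurableI => //; exact: measurable_itv.
have mT k (S : set (measurableTypeR R)) : measurable S ->
    measurable ((fun x => x + k) @^-1` S : set (measurableTypeR R)).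
  by move=> mS; rewrite -[X in measurable X]setTI; exact: measurable_add.
have -> : A = S0 `|` (S1 `|` S2).
  apply/seteqP; split => x /=; rewrite /S0 /S1 /S2 /circle /= !in_itv/=.
    move=> Ax; case: (boolP ((0 <= x) && (x < 2 * pi))) => [/andP[x0 x2]|nx]; last first.
      by left; split => //; exact/negP.
    by right; case: (leP h x) => xh; [left; split => //; rewrite xh|right; split => //; rewrite x0].
  tauto.
have -> : rot1 h @^-1` (S0 `|` (S1 `|` S2)) =
    S0 `|` ((fun x => x + h) @^-1` S1 `|` (fun x => x + (h - 2 * pi)) @^-1` S2).
  apply/seteqP; split => x /=; rewrite /S0 /S1 /S2 /circle /= !in_itv/= /rot1.
    case: (leP 0 x) => x0; case: (ltP x (2 * pi)) => x2 /=.
    - case: (ltP (x + h) (2 * pi)) => x3 [[_]|[[? /andP[? ?]]|[? /andP[? ?]]]].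
      + by case; apply/andP; split; lra.
      + by right; left; split => //; apply/andP; split; lra.
      + exfalso; lra.
      + by case; apply/andP; split; lra.
      + exfalso; lra.
      + by right; right; rewrite addrA; split => //; apply/andP; split; lra.
    - by move=> [[? _]|[[? /andP[? ?]]|[? /andP[? ?]]]]; [left; split|exfalso; lra|exfalso; lra].
    - by move=> [[? _]|[[? /andP[? ?]]|[? /andP[? ?]]]]; [left; split|exfalso; lra|exfalso; lra].
    - by move=> [[? _]|[[? /andP[? ?]]|[? /andP[? ?]]]]; [left; split|exfalso; lra|exfalso; lra].
  case=> [[Ax nx]|[[Ax /andP[x1 x2]]|[Ax /andP[x1 x2]]]].
  - by left; move/negP/negbTE : (nx) => nx'; rewrite nx'.
  - have -> : 0 <= x by lra.
    have -> /= : x < 2 * pi by lra.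
    rewrite x2; right; left; split => //; apply/andP; split; lra.
  - have -> : 0 <= x by lra.
    have -> /= : x < 2 * pi by lra.
    have -> : (x + h < 2 * pi) = false by apply/negP => ?; lra.
    by right; right; rewrite -addrA; split => //; apply/andP; split; lra.
have d1 : S1 `&` S2 = set0.
  apply/seteqP; split => x //=; rewrite /S1 /S2 /circle /= !in_itv/=.
  by move=> [[_ /andP[? ?]] [_ /andP[? ?]]]; lra.
have d2 : S0 `&` (S1 `|` S2) = set0.
  apply/seteqP; split => x //=; rewrite /S0 /S1 /S2 /circle /= !in_itv/=.
  by move=> [[_ h1] [[_ /andP[? ?]]|[_ /andP[? ?]]]]; apply: h1; apply/andP; split; lra.
have d3 : (fun x => x + h) @^-1` S1 `&` (fun x => x + (h - 2 * pi)) @^-1` S2 = set0.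
  apply/seteqP; split => x //=; rewrite /S1 /S2 /circle /= !in_itv/=.
  by move=> [[_ /andP[? ?]] [_ /andP[? ?]]]; lra.
have d4 : S0 `&` ((fun x => x + h) @^-1` S1 `|` (fun x => x + (h - 2 * pi)) @^-1` S2) = set0.
  apply/seteqP; split => x //=; rewrite /S0 /S1 /S2 /circle /= !in_itv/=.
  by move=> [[_ h1] [[_ /andP[? ?]]|[_ /andP[? ?]]]]; apply: h1; apply/andP; split; lra.
have mT1 := mT h _ mS1; have mT2 := mT (h - 2 * pi) _ mS2.
rewrite !measureU//; try exact: measurableU.
by congr (_ + (_ + _))%E; exact: lebesgue_measure_translation.
Qed.

Definition rot N (l : 'I_N) h (x : Rn R N) : Rn R N :=
  [tuple if i == l then rot1 h (tnth x i) else tnth x i | i < N].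

Lemma measurable_rot N (l : 'I_N) h : measurable_fun setT (rot l h).
Proof.
apply/measurable_fun_tnthP => i.
rewrite (_ : _ \o _ = fun x : Rn R N => if i == l then rot1 h (tnth x i) else tnth x i); last first.
  by apply/funext => x /=; rewrite tnth_mktuple.
case: (i == l); last exact: measurable_tnth.
exact: (measurableT_comp (measurable_rot1 h) (@measurable_tnth _ (measurableTypeR R) N i)).
Qed.

Lemma lebesgueRn_rot N (l : 'I_N) h (A : set (Rn R N)) :
  0 <= h < 2 * pi -> measurable A -> lebesgueRn N (rot l h @^-1` A) = lebesgueRn N A.
Proof.
move=> hh mA; apply/esym.
have rotbox (B : 'I_N -> set R) :
    rot l h @^-1` (box B) = box (fun i => if i == l then rot1 h @^-1` (B i) else B i).
  apply/seteqP; split => x /= Bx i; have := Bx i; rewrite /rot/= tnth_mktuple; by case: ifP.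
apply: (@box_measure_unique _ _ _ (pushforward (lebesgueRn N) (rot l h))) => //=.
- exact: measurable_rot.
- move=> _ B mB; rewrite /pushforward rotbox !lebesgueRn_box//; last first.
    move=> i; case: ifP => // _; rewrite -[X in measurable X]setTI.
    exact: measurable_rot1.
  apply: eq_bigr => i _; case: ifP => // _.
  by rewrite lebesgue_measure_rot1.
- by move=> a; exact: lebesgueRn_box_fin.
Qed.

Lemma torusE N : torus N = box (fun=> circle) :> set (Rn R N).
Proof. by []. Qed.

Lemma measurable_torus N : measurable (torus N : set (Rn R N)).
Proof. by rewrite torusE; apply: measurable_box => i; exact: measurable_itv. Qed.

Lemma lebesgueRn_torus N : lebesgueRn N (torus N : set (Rn R N)) = ((2 * pi) ^+ N)%:E.
Proof.
rewrite torusE lebesgueRn_box; last by move=> i; exact: measurable_itv.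
under eq_bigr do rewrite lebesgue_measure_itv/= lte_fin twopi_gt0 -EFinB subr0.
by rewrite prodEFin prodr_const card_ord.
Qed.

Lemma rot_torus N (l : 'I_N) h (x : Rn R N) :
  0 <= h < 2 * pi -> torus N x -> torus N (rot l h x).
Proof.
move=> hh Tx i; rewrite /rot tnth_mktuple; case: ifP => _; last exact: Tx.
by apply: rot1_circle => //; exact: Tx.
Qed.

Lemma rot_torusE N (l : 'I_N) h : 0 <= h < 2 * pi -> rot l h @^-1` torus N = torus N :> set (Rn R N).
Proof.
move=> hh; apply/seteqP; split => x; last exact: rot_torus.
move=> Tx i; have := Tx i; rewrite /rot tnth_mktuple; case: ifP => // _.
rewrite /rot1 in_itv/=; case: ifP => // _; rewrite in_itv/=.
Qed.
End rotation.

(** * Real integrals over the torus *)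

Section torus_integral.
Context {R : realType} (N : nat).
Notation mu := (@lebesgueRn R N).
Notation T := (@torus R N).

Definition ib (F : Rn R N -> R) : Prop := mu.-integrable T (EFin \o F).
Definition tint (F : Rn R N -> R) : R := \int[mu]_(x in T) F x.
Local Notation E := tint.
Definition bdd (F : Rn R N -> R) : Prop :=
  measurable_fun T F /\ exists M : R, forall x, T x -> `|F x| <= M.

Implicit Types (F G : Rn R N -> R) (k : R).

Let mT : measurable T. Proof. exact: measurable_torus. Qed.

Lemma lebesgueRn_torus_fin : (mu T < +oo)%E.
Proof. by rewrite lebesgueRn_torus ltry. Qed.

Lemma ib_meas F : ib F -> measurable_fun T F.
Proof. by move=> /integrableP[/measurable_EFinP]. Qed.

Lemma bdd_ib F : bdd F -> ib F.
Proof.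
move=> [mF [M FM]]; apply: measurable_bounded_integrable => //.
  exact: lebesgueRn_torus_fin.
exists M; split; first exact: num_real.
move=> y My x Tx; exact: (le_trans (FM _ Tx) (ltW My)).
Qed.

Lemma ibD F G : ib F -> ib G -> ib (fun x => F x + G x).
Proof. by move=> iF iG; exact: (integrableD mT iF iG). Qed.

Lemma ibZ k F : ib F -> ib (fun x => k * F x).
Proof. by move=> iF; exact: (integrableZl mT k iF). Qed.

Lemma ibN F : ib F -> ib (fun x => - F x).
Proof. by move=> iF; have := ibZ (-1) iF; under [X in ib X -> _]funext do rewrite mulN1r. Qed.

Lemma ibB F G : ib F -> ib G -> ib (fun x => F x - G x).
Proof. by move=> iF iG; apply: ibD => //; exact: ibN. Qed.

Lemma ib0 : ib (fun=> 0).
Proof. exact: integrable0. Qed.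

Lemma ib_sum I (s : seq I) (P : pred I) (F : I -> Rn R N -> R) :
  (forall i, ib (F i)) -> ib (fun x => \sum_(i <- s | P i) F i x).
Proof.
move=> iF; elim: s => [|i s IH].
  by under [X in ib X]funext do rewrite big_nil; exact: ib0.
under [X in ib X]funext do rewrite big_cons.
by case: (P i) => //; exact: ibD.
Qed.

Lemma ib_le F G : measurable_fun T F -> (forall x, T x -> `|F x| <= G x) -> ib G -> ib F.
Proof.
move=> mF FG iG; apply: (le_integrable mT _ _ iG); first exact/measurable_EFinP.
by move=> x Tx /=; rewrite lee_fin (le_trans (FG _ Tx))// ler_norm.
Qed.

Lemma ib_norm F : ib F -> ib (fun x => `|F x|).
Proof. by move=> /(integrable_abse). Qed.

Lemma eq_ib F G : (forall x, T x -> F x = G x) -> ib F -> ib G.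
Proof.
by move=> FG; apply: eq_integrable => // x /set_mem Tx /=; rewrite FG.
Qed.

Lemma ibM F G : bdd F -> ib G -> ib (fun x => F x * G x).
Proof.
move=> [mF [M FM]] iG.
apply: (@ib_le _ (fun x => `|M| * `|G x|)).
- by apply: measurable_funM => //; exact: ib_meas.
- by move=> x Tx; rewrite normrM ler_wpM2r// (le_trans (FM _ Tx))// ler_norm.
- by apply: ibZ; exact: ib_norm.
Qed.

Lemma bdd_cst k : bdd (fun=> k).
Proof. by split; [exact: measurable_cst|exists `|k|]. Qed.

Lemma bddD F G : bdd F -> bdd G -> bdd (fun x => F x + G x).
Proof.
move=> [mF [M FM]] [mG [K GK]]; split; first exact: measurable_funD.
exists (M + K) => x Tx; apply: (le_trans (ler_normD _ _)).
by apply: lerD; [exact: FM|exact: GK].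
Qed.

Lemma bddM F G : bdd F -> bdd G -> bdd (fun x => F x * G x).
Proof.
move=> [mF [M FM]] [mG [K GK]]; split; first exact: measurable_funM.
exists (M * K) => x Tx; rewrite normrM.
by apply: ler_pM => //; [exact: FM|exact: GK].
Qed.

Lemma bddN F : bdd F -> bdd (fun x => - F x).
Proof.
move=> [mF [M FM]]; split; first exact: measurable_funN.
by exists M => x Tx; rewrite normrN; exact: FM.
Qed.

Lemma bddB F G : bdd F -> bdd G -> bdd (fun x => F x - G x).
Proof. by move=> bF bG; apply: bddD => //; exact: bddN. Qed.

Lemma bddX F (k : nat) : bdd F -> bdd (fun x => F x ^+ k).
Proof.
move=> bF; elim: k => [|k IH].
  by under [X in bdd X]funext do rewrite expr0; exact: bdd_cst.
by under [X in bdd X]funext do rewrite exprS; exact: bddM.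
Qed.

Lemma bdd_sum I (s : seq I) (P : pred I) (F : I -> Rn R N -> R) :
  (forall i, bdd (F i)) -> bdd (fun x => \sum_(i <- s | P i) F i x).
Proof.
move=> iF; elim: s => [|i s IH].
  by under [X in bdd X]funext do rewrite big_nil; exact: bdd_cst.
under [X in bdd X]funext do rewrite big_cons.
by case: (P i) => //; exact: bddD.
Qed.

Lemma bdd_indic (A : set (Rn R N)) : measurable A -> bdd (\1_A : _ -> R).
Proof.
move=> mA; split; first exact: measurable_indic.
by exists 1 => x _; rewrite indicE; case: (_ \in _); rewrite ?normr1 ?normr0.
Qed.

Lemma bdd_comp (f : R -> R) F (M : R) : measurable_fun setT F ->
  measurable_fun setT (f : measurableTypeR R -> measurableTypeR R) ->
  (forall y, `|f y| <= M) -> bdd (fun x => f (F x)).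
Proof.
move=> mF mf fM; split; last by exists M => x _; exact: fM.
by apply: (measurable_funS measurableT) => //; exact: measurableT_comp.
Qed.

Lemma eqE_ F G : (forall x, T x -> F x = G x) -> E F = E G.
Proof. by move=> FG; apply: eq_Rintegral => x /set_mem; exact: FG. Qed.

Lemma ED F G : ib F -> ib G -> E (fun x => F x + G x) = E F + E G.
Proof. by move=> iF iG; exact: (RintegralD mT iF iG). Qed.

Lemma EZ k F : ib F -> E (fun x => k * F x) = k * E F.
Proof. by move=> iF; exact: (RintegralZl k mT iF). Qed.

Lemma EB F G : ib F -> ib G -> E (fun x => F x - G x) = E F - E G.
Proof. by move=> iF iG; exact: (RintegralB mT iF iG). Qed.

Lemma E0 : E (fun=> 0) = 0.
Proof. by rewrite /E Rintegral_cst// mul0r. Qed.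

Lemma Ecst k : E (fun=> k) = k * (2 * pi) ^+ N.
Proof.
rewrite /E Rintegral_cst//; congr (_ * _).
by rewrite -[RHS]/(fine ((2 * pi) ^+ N)%:E); congr fine; exact: lebesgueRn_torus.
Qed.

Lemma Esum I (s : seq I) (P : pred I) (F : I -> Rn R N -> R) :
  (forall i, ib (F i)) ->
  E (fun x => \sum_(i <- s | P i) F i x) = \sum_(i <- s | P i) E (F i).
Proof.
move=> iF; elim: s => [|i s IH].
  by rewrite big_nil -[RHS]E0; apply: eqE_ => x _; rewrite big_nil.
rewrite big_cons; case: ifPn => Pi.
  rewrite -IH -ED//; last exact: ib_sum.
  by apply: eqE_ => x _; rewrite big_cons Pi.
by rewrite -IH; apply: eqE_ => x _; rewrite big_cons (negbTE Pi).
Qed.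

Lemma Ele F G : ib F -> ib G -> (forall x, T x -> F x <= G x) -> E F <= E G.
Proof. by move=> iF iG FG; exact: (le_Rintegral mT iF iG). Qed.

Lemma Ege0 F : (forall x, T x -> 0 <= F x) -> 0 <= E F.
Proof. exact: Rintegral_ge0. Qed.

Lemma E_rot (l : 'I_N) h F : 0 <= h < 2 * pi -> ib F ->
  ib (fun x => F (rot l h x)) /\ E (fun x => F (rot l h x)) = E F.
Proof.
move=> hh iF.
pose F' := F \_ T.
have mF' : measurable_fun setT (EFin \o F').
  apply/measurable_EFinP; rewrite /F'.
  apply/(measurable_restrictT F mT); exact: ib_meas.
have F'E x : T x -> F' x = F x.
  by move=> Tx; rewrite /F' /patch mem_set.
have mr := @measurable_rot R N l h.
have muE A : measurable A -> pushforward mu (rot l h) A = mu A.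
  by move=> mA; exact: lebesgueRn_rot.
have iF' : mu.-integrable T (EFin \o F').
  by apply: eq_integrable iF => // x /set_mem Tx /=; rewrite F'E.
have iP : mu.-integrable (rot l h @^-1` T) ((EFin \o F') \o rot l h).
  rewrite rot_torusE//; apply/integrableP; split.
    apply: (measurable_funS measurableT) => //.
    exact: (measurableT_comp mF' mr).
  have /integrableP[_] := iF'; apply: le_lt_trans.
  have mabs : measurable_fun setT (abse \o (EFin \o F')).
    exact: measurableT_comp.
  have := @ge0_integral_pushforward _ _ _ _ R _ mr mu T (abse \o (EFin \o F')) mT
    (measurable_funS measurableT (@subsetT _ _) mabs).
  rewrite rot_torusE//= => <- //.
  rewrite le_eqVlt; apply/orP; left; apply/eqP.
  by apply: eq_measure_integral => A mA _; exact: muE.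
have iR : ib (fun x => F (rot l h x)).
  apply: (@eq_ib (fun x => F' (rot l h x))).
    by move=> x Tx; rewrite F'E//; exact: rot_torus.
  by move: iP; rewrite rot_torusE.
split=> //.
rewrite /E /Rintegral.
transitivity (fine (\int[mu]_(x in T) (EFin (F' (rot l h x))))).
  by congr fine; apply: eq_integral => x /set_mem Tx; rewrite F'E//; exact: rot_torus.
have := @integral_pushforward _ _ _ _ R _ mr mu T _ mF' iP mT.
rewrite rot_torusE//= => <-; congr fine.
rewrite (eq_measure_integral mu)//=; last by move=> A mA _; exact: muE.
by apply: eq_integral => x /set_mem Tx; rewrite F'E.
Qed.

End torus_integral.

(** * Complex functions on the torus *)

Section complex_basics.
Context {R : realType}.
Implicit Types (z w : R[i]) (a b : R).

Definition sq z : R := Re z ^+ 2 + Im z ^+ 2.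
Definition nr z : R := Normc.normc z.

Lemma ReD z w : Re (z + w) = Re z + Re w. Proof. by case: z w => [a b] []. Qed.
Lemma ImD z w : Im (z + w) = Im z + Im w. Proof. by case: z w => [a b] []. Qed.
Lemma ReN z : Re (- z) = - Re z. Proof. by case: z. Qed.
Lemma ImN z : Im (- z) = - Im z. Proof. by case: z. Qed.
Lemma ReM z w : Re (z * w) = Re z * Re w - Im z * Im w.
Proof. by case: z w => [a b] []. Qed.
Lemma ImM z w : Im (z * w) = Re z * Im w + Im z * Re w.
Proof. by case: z w => [a b] [c d] /=; rewrite mulrC [b * _]mulrC. Qed.
Lemma ReJ z : Re z^*%C = Re z. Proof. by case: z. Qed.
Lemma ImJ z : Im z^*%C = - Im z. Proof. by case: z. Qed.
Lemma Re_sum I (s : seq I) (P : pred I) (F : I -> R[i]) :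
  Re (\sum_(i <- s | P i) F i) = \sum_(i <- s | P i) Re (F i).
Proof. by apply: (big_morph _ ReD). Qed.
Lemma Im_sum I (s : seq I) (P : pred I) (F : I -> R[i]) :
  Im (\sum_(i <- s | P i) F i) = \sum_(i <- s | P i) Im (F i).
Proof. by apply: (big_morph _ ImD). Qed.
Lemma ceq z w : Re z = Re w -> Im z = Im w -> z = w.
Proof. by case: z w => [a b] [c d] /= -> ->. Qed.
Lemma conjcD z w : (z + w)^*%C = z^*%C + w^*%C.
Proof. by apply: ceq; rewrite ?(ReD, ReJ, ImD, ImJ)// opprD. Qed.
Lemma conjcM z w : (z * w)^*%C = z^*%C * w^*%C.
Proof. by apply: ceq; rewrite ?(ReM, ImM, ReJ, ImJ) ?mulrNN// mulNr mulrN opprD. Qed.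
Lemma conjcN z : (- z)^*%C = - z^*%C.
Proof. by apply: ceq; rewrite ?(ReN, ImN, ReJ, ImJ). Qed.
Lemma conjc_sum I (s : seq I) (P : pred I) (F : I -> R[i]) :
  (\sum_(i <- s | P i) F i)^*%C = \sum_(i <- s | P i) (F i)^*%C.
Proof. by apply: (big_morph _ conjcD); rewrite conjc0. Qed.

Lemma sq_ge0 z : 0 <= sq z.
Proof. by rewrite addr_ge0// sqr_ge0. Qed.
Lemma nr_ge0 z : 0 <= nr z.
Proof. by case: z => a b; exact: sqrtr_ge0. Qed.
Lemma sqE z : sq z = nr z ^+ 2.
Proof. by rewrite /nr /sq; case: z => a b /=; rewrite sqr_sqrtr// addr_ge0// sqr_ge0. Qed.
Lemma nrE z : nr z = Num.sqrt (sq z).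
Proof. by case: z. Qed.
Lemma sqM z w : sq (z * w) = sq z * sq w.
Proof. by rewrite /sq ReM ImM; ring. Qed.
Lemma nrM z w : nr (z * w) = nr z * nr w.
Proof. exact: Normc.normcM. Qed.
Lemma nrN z : nr (- z) = nr z.
Proof. by rewrite !nrE /sq ReN ImN !sqrrN. Qed.
Lemma nrJ z : nr z^*%C = nr z.
Proof. by rewrite !nrE /sq ReJ ImJ sqrrN. Qed.
Lemma sqJ z : sq z^*%C = sq z.
Proof. by rewrite /sq ReJ ImJ sqrrN. Qed.
Lemma sqN z : sq (- z) = sq z.
Proof. by rewrite /sq ReN ImN !sqrrN. Qed.
Lemma nr_Re z : `|Re z| <= nr z.
Proof. by rewrite -sqrtr_sqr nrE ler_sqrt// ?sq_ge0// lerDl sqr_ge0. Qed.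
Lemma nr0 : nr 0 = 0. Proof. by rewrite nrE /sq /= expr0n /= addr0 sqrtr0. Qed.
Lemma nr_triangle z w : nr (z + w) <= nr z + nr w.
Proof. exact: le_normcD. Qed.
Lemma sq0 : sq 0 = 0. Proof. by rewrite sqE nr0 expr0n. Qed.
Lemma sq_eq0 z : sq z = 0 -> z = 0.
Proof.
rewrite /sq => /eqP; rewrite paddr_eq0 ?sqr_ge0// !sqrf_eq0 => /andP[/eqP a /eqP b].
exact: ceq.
Qed.
Lemma sqD_le z w : sq (z + w) <= 2 * sq z + 2 * sq w.
Proof.
rewrite /sq ReD ImD; have h1 := sqr_ge0 (Re z - Re w); have h2 := sqr_ge0 (Im z - Im w); nra.
Qed.
Lemma sqB_le z w : sq (z - w) <= 2 * sq z + 2 * sq w.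
Proof. by rewrite -(sqN w); exact: sqD_le. Qed.
Lemma sqDE z w : sq (z + w) = sq z + sq w + 2 * Re (z * w^*%C).
Proof. rewrite /sq ReM ReJ ImJ ReD ImD; ring. Qed.
Lemma sqBE z w : sq (z - w) = sq z + sq w - 2 * Re (z * w^*%C).
Proof. by rewrite sqDE conjcN mulrN ReN sqN mulrN. Qed.
Lemma ReC a : Re a%:C%C = a. Proof. by []. Qed.
Lemma ImC a : Im a%:C%C = 0. Proof. by []. Qed.
Lemma sqC a : sq a%:C%C = a ^+ 2.
Proof. by rewrite /sq /= expr0n/= addr0. Qed.
Lemma nrC a : nr a%:C%C = `|a|.
Proof. by rewrite nrE sqC sqrtr_sqr. Qed.
Lemma sq_self z : Re (z * z^*%C) = sq z.
Proof. by rewrite ReM ReJ ImJ /sq; ring. Qed.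

Lemma mulJE z : z * z^*%C = (sq z)%:C%C.
Proof. by apply: ceq; rewrite ?ReM ?ImM ReJ ImJ /sq /=; ring. Qed.

Lemma expi0 : expi 0 = 1 :> R[i].
Proof. by rewrite /expi cos0 sin0. Qed.
Lemma expiD a b : expi (a + b) = expi a * expi b.
Proof. by apply: ceq; rewrite ?ReM ?ImM /= ?cosD ?sinD// addrC. Qed.
Lemma expiN a : expi (- a) = (expi a)^*%C.
Proof. by rewrite /expi cosN sinN. Qed.
Lemma sq_expi a : sq (expi a) = 1.
Proof. exact: cos2Dsin2. Qed.
Lemma nr_expi a : nr (expi a) = 1.
Proof. by rewrite nrE sq_expi sqrtr1. Qed.
Lemma expiNK a : expi a * expi (- a) = 1.
Proof. by rewrite -expiD subrr expi0. Qed.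
Lemma expi2pi : expi (2 * pi) = 1 :> R[i].
Proof. by rewrite /expi mulr_natl cos2pi sin2pi. Qed.
Lemma expi_nat2pi (n : nat) : expi (n%:R * (2 * pi)) = 1 :> R[i].
Proof.
elim: n => [|n IH]; first by rewrite mul0r expi0.
by rewrite -natr1 mulrDl mul1r expiD IH expi2pi mulr1.
Qed.
Lemma expi_int2pi (m : int) : expi (m%:~R * (2 * pi)) = 1 :> R[i].
Proof.
case: m => n; first exact: expi_nat2pi.
by rewrite NegzE mulrNz mulNr expiN expi_nat2pi conjc1.
Qed.
Lemma expipi : expi pi = -1 :> R[i].
Proof. by rewrite /expi cospi sinpi; apply: ceq => /=; rewrite ?oppr0. Qed.
Lemma sq_expiB a b : sq (expi a - expi b) = 2 - 2 * cos (a - b).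
Proof.
by rewrite sqBE !sq_expi -expiN -expiD [Re _]/=; ring.
Qed.
End complex_basics.

Section complex_integral.
Context {R : realType} (N : nat).
Notation mu := (@lebesgueRn R N).
Notation T := (@torus R N).
Implicit Types (F G : Rn R N -> R[i]) (k : R[i]).
Notation E := (@tint R N).

Definition cib F := ib (fun x => Re (F x)) /\ ib (fun x => Im (F x)).
Definition cbdd F := bdd (fun x => Re (F x)) /\ bdd (fun x => Im (F x)).
Definition Ec F : R[i] := (E (fun x => Re (F x)) +i* E (fun x => Im (F x)))%C.

Lemma cbdd_cib F : cbdd F -> cib F.
Proof. by move=> [? ?]; split; exact: bdd_ib. Qed.

Lemma eq_cib F G : (forall x, T x -> F x = G x) -> cib F -> cib G.
Proof. by move=> FG [a b]; split; [apply: eq_ib a|apply: eq_ib b] => x Tx; rewrite FG. Qed.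

Lemma eq_Ec F G : (forall x, T x -> F x = G x) -> Ec F = Ec G.
Proof. by move=> FG; apply: ceq => /=; apply: eqE_ => x Tx; rewrite FG. Qed.

Lemma cibD F G : cib F -> cib G -> cib (fun x => F x + G x).
Proof.
move=> [a b] [c d]; split.
  by under [X in ib X]funext do rewrite ReD; exact: ibD.
by under [X in ib X]funext do rewrite ImD; exact: ibD.
Qed.

Lemma cibN F : cib F -> cib (fun x => - F x).
Proof.
move=> [a b]; split.
  by under [X in ib X]funext do rewrite ReN; exact: ibN.
by under [X in ib X]funext do rewrite ImN; exact: ibN.
Qed.

Lemma cbdd_cst k : cbdd (fun=> k).
Proof. by split; exact: bdd_cst. Qed.

Lemma cbddD F G : cbdd F -> cbdd G -> cbdd (fun x => F x + G x).
Proof.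
move=> [a b] [c d]; split.
  by under [X in bdd X]funext do rewrite ReD; exact: bddD.
by under [X in bdd X]funext do rewrite ImD; exact: bddD.
Qed.

Lemma cbddN F : cbdd F -> cbdd (fun x => - F x).
Proof.
move=> [a b]; split.
  by under [X in bdd X]funext do rewrite ReN; exact: bddN.
by under [X in bdd X]funext do rewrite ImN; exact: bddN.
Qed.

Lemma cbddB F G : cbdd F -> cbdd G -> cbdd (fun x => F x - G x).
Proof. by move=> iF iG; apply: cbddD => //; exact: cbddN. Qed.

Lemma cbddM F G : cbdd F -> cbdd G -> cbdd (fun x => F x * G x).
Proof.
move=> [a b] [c d]; split.
  by under [X in bdd X]funext do rewrite ReM; apply: bddB; exact: bddM.
by under [X in bdd X]funext do rewrite ImM; apply: bddD; exact: bddM.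
Qed.

Lemma cibM F G : cbdd F -> cib G -> cib (fun x => F x * G x).
Proof.
move=> [a b] [c d]; split.
  by under [X in ib X]funext do rewrite ReM; apply: ibB; exact: ibM.
by under [X in ib X]funext do rewrite ImM; apply: ibD; exact: ibM.
Qed.

Lemma cbddJ F : cbdd F -> cbdd (fun x => (F x)^*%C).
Proof.
move=> [a b]; split; first by under [X in bdd X]funext do rewrite ReJ.
by under [X in bdd X]funext do rewrite ImJ; exact: bddN.
Qed.

Lemma cbddC (f : Rn R N -> R) : bdd f -> cbdd (fun x => (f x)%:C%C).
Proof. by move=> bf; split => //; exact: bdd_cst. Qed.

Lemma cib_sum I (s : seq I) (P : pred I) (F : I -> Rn R N -> R[i]) :
  (forall i, cib (F i)) -> cib (fun x => \sum_(i <- s | P i) F i x).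
Proof.
move=> iF; split.
  by under [X in ib X]funext do rewrite Re_sum; apply: ib_sum => i; have [] := iF i.
by under [X in ib X]funext do rewrite Im_sum; apply: ib_sum => i; have [] := iF i.
Qed.

Lemma cbdd_sum I (s : seq I) (P : pred I) (F : I -> Rn R N -> R[i]) :
  (forall i, cbdd (F i)) -> cbdd (fun x => \sum_(i <- s | P i) F i x).
Proof.
move=> iF; split.
  by under [X in bdd X]funext do rewrite Re_sum; apply: bdd_sum => i; have [] := iF i.
by under [X in bdd X]funext do rewrite Im_sum; apply: bdd_sum => i; have [] := iF i.
Qed.

Lemma bdd_sq F : cbdd F -> bdd (fun x => sq (F x)).
Proof. by move=> [a b]; apply: bddD; exact: bddX. Qed.

Lemma bdd_nr F : cbdd F -> bdd (fun x => nr (F x)).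
Proof.
move=> bF; have [mS [M SM]] := bdd_sq bF; split.
  under [X in measurable_fun _ X]funext do rewrite nrE.
  apply: (@measurable_comp _ _ _ _ _ _ setT) => //.
  apply: continuous_measurable_fun; exact: sqrt_continuous.
exists (1 + M) => x Tx; have := SM x Tx.
rewrite !ger0_norm ?nr_ge0 ?sq_ge0// sqE => h.
have := nr_ge0 (F x); nra.
Qed.

Lemma EcD F G : cib F -> cib G -> Ec (fun x => F x + G x) = Ec F + Ec G.
Proof.
move=> [a b] [c d]; apply: ceq; rewrite ?ReD ?ImD /= -ED//; apply: eqE_ => x _.
  by rewrite ReD.
by rewrite ImD.
Qed.

Lemma EcZ k F : cib F -> Ec (fun x => k * F x) = k * Ec F.
Proof.
move=> [a b]; apply: ceq; rewrite ?ReM ?ImM /= -!EZ// -?ED -?EB; try exact: ibZ.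
  by apply: eqE_ => x _; rewrite ReM.
by apply: eqE_ => x _; rewrite ImM.
Qed.

Lemma EcN F : cib F -> Ec (fun x => - F x) = - Ec F.
Proof.
by move=> iF; rewrite -mulN1r -EcZ//; apply: eq_Ec => x _; rewrite mulN1r.
Qed.

Lemma Ec0 : Ec (fun=> 0) = 0.
Proof. by apply: ceq; rewrite /= E0. Qed.

Lemma Ecsum I (s : seq I) (P : pred I) (F : I -> Rn R N -> R[i]) :
  (forall i, cib (F i)) ->
  Ec (fun x => \sum_(i <- s | P i) F i x) = \sum_(i <- s | P i) Ec (F i).
Proof.
move=> iF; apply: ceq; rewrite ?Re_sum ?Im_sum /=.
  rewrite -Esum; first by apply: eqE_ => x _; rewrite Re_sum.
  by move=> i; have [] := iF i.
rewrite -Esum; first by apply: eqE_ => x _; rewrite Im_sum.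
by move=> i; have [] := iF i.
Qed.

Lemma Ec_rot (l : 'I_N) h F : 0 <= h < 2 * pi -> cib F ->
  Ec (fun x => F (rot l h x)) = Ec F.
Proof.
move=> hh [a b]; apply: ceq => /=.
  by have [_ ->] := E_rot l hh a.
by have [_ ->] := E_rot l hh b.
Qed.

Lemma ib_nr F : cib F -> measurable_fun T (fun x => nr (F x)) /\ ib (fun x => nr (F x)).
Proof.
move=> [a b].
have mS : measurable_fun T (fun x => sq (F x)).
  by apply: measurable_funD; apply: measurable_funX; exact: ib_meas.
have mN : measurable_fun T (fun x => nr (F x)).
  under [X in measurable_fun _ X]funext do rewrite nrE.
  apply: (@measurable_comp _ _ _ _ _ _ setT) => //.
  apply: continuous_measurable_fun; exact: sqrt_continuous.
split=> //; apply: (@ib_le _ _ _ (fun x => `|Re (F x)| + `|Im (F x)|)) => //.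
  move=> x _; rewrite ger0_norm ?nr_ge0//.
  rewrite -(@ler_pXn2r _ 2)// ?nnegrE ?nr_ge0 ?addr_ge0//.
  rewrite -sqE /sq -[Re (F x) ^+ 2]real_normK ?num_real// -[Im (F x) ^+ 2]real_normK ?num_real//.
  have := normr_ge0 (Re (F x)); have := normr_ge0 (Im (F x)); nra.
by apply: ibD; exact: ib_norm.
Qed.

Lemma nr_Ec F : cib F -> nr (Ec F) <= E (fun x => nr (F x)).
Proof.
move=> iF; have [mN iN] := ib_nr iF.
have [->|z0] := eqVneq (nr (Ec F)) 0; first by apply: Ege0 => x _; exact: nr_ge0.
(* rotate the integral onto the positive axis *)
pose k := (Ec F)^*%C * ((nr (Ec F))^-1)%:C%C.
have nk : nr k = 1 by rewrite nrM nrJ nrC ger0_norm ?invr_ge0 ?nr_ge0// divff.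
have kE : nr (Ec F) = Re (Ec (fun x => k * F x)).
  by rewrite EcZ// /k mulrAC [_^*%C * _]mulrC mulJE ReM !ReC ImC mulr0 subr0 sqE expr2 mulfK.
rewrite kE /=; apply: Ele => //.
  by have [] := cibM (cbdd_cst k) iF.
move=> x _; apply: (le_trans (ler_norm _)).
by apply: (le_trans (nr_Re _)); rewrite nrM nk mul1r.
Qed.

End complex_integral.

(** * Exponentials and Fourier coefficients *)

Section tuples.
Context {N : nat}.
Implicit Types n m k : N.-tuple int.
Definition tadd n m : N.-tuple int := [tuple tnth n i + tnth m i | i < N].
Definition tsub n m : N.-tuple int := [tuple tnth n i - tnth m i | i < N].
Definition tzero : N.-tuple int := [tuple 0 | i < N].

Lemma tsub_eq0 n m : (tsub n m == tzero) = (n == m).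
Proof.
apply/eqP/eqP => [h|->]; apply: eq_from_tnth => i.
  have := congr1 (fun t => tnth t i) h; rewrite !tnth_mktuple => /eqP.
  by rewrite subr_eq0 => /eqP.
by rewrite !tnth_mktuple subrr.
Qed.

End tuples.

Section exponentials.
Context {R : realType} (N : nat).
Notation mu := (@lebesgueRn R N).
Notation T := (@torus R N).
Notation E := (@tint R N).
Notation Ec := (@Ec R N).
Implicit Types n m k : N.-tuple int.
Implicit Types F G : Rn R N -> R[i].

Definition ewave n (x : Rn R N) : R[i] := expi (dotp n x).

Lemma measurable_dotp n : measurable_fun setT (dotp n : Rn R N -> R).
Proof.
apply: measurable_sum => l.
apply: measurable_funM; first exact: measurable_cst.
exact: (@measurable_tnth _ (measurableTypeR R) N l).
Qed.

Lemma cbdd_expi (f : Rn R N -> R) : measurable_fun setT f -> cbdd (fun x => expi (f x)).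
Proof.
move=> mf; split => /=.
  apply: (@bdd_comp R N cos f 1) => //.
    by apply: continuous_measurable_fun; exact: continuous_cos.
  by move=> y; rewrite ler_norml cos_geN1 cos_le1.
apply: (@bdd_comp R N sin f 1) => //.
  by apply: continuous_measurable_fun; exact: continuous_sin.
by move=> y; rewrite ler_norml sin_geN1 sin_le1.
Qed.

Lemma cbdd_ewave n : cbdd (ewave n).
Proof. by apply: cbdd_expi; exact: measurable_dotp. Qed.

Lemma dotpD n m (x : Rn R N) : dotp (tadd n m) x = dotp n x + dotp m x.
Proof.
rewrite /dotp -big_split/=; apply: eq_bigr => i _.
by rewrite tnth_mktuple intrD mulrDl.
Qed.

Lemma dotpB n m (x : Rn R N) : dotp (tsub n m) x = dotp n x - dotp m x.
Proof.
rewrite /dotp -sumrB; apply: eq_bigr => i _.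
by rewrite tnth_mktuple rmorphB/= mulrBl.
Qed.

Lemma ewave_sub n m x : ewave (tsub n m) x = ewave n x * (ewave m x)^*%C.
Proof. by rewrite /ewave dotpB expiD expiN. Qed.

Lemma ewave_add n m x : ewave (tadd n m) x = ewave n x * ewave m x.
Proof. by rewrite /ewave dotpD expiD. Qed.

Lemma ewave0 x : ewave tzero x = 1.
Proof.
rewrite /ewave /dotp big1 ?expi0// => i _; by rewrite tnth_mktuple mul0r.
Qed.

Lemma sq_ewave n x : sq (ewave n x) = 1. Proof. exact: sq_expi. Qed.
Lemma nr_ewave n x : nr (ewave n x) = 1. Proof. exact: nr_expi. Qed.

(** The frequencies are integers, so that the jump by 2 pi inside a rotation
    is invisible to the exponential. *)
Lemma ewave_rot n (l : 'I_N) h x : T x ->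
  ewave n (rot l h x) = expi ((tnth n l)%:~R * h) * ewave n x.
Proof.
move=> Tx.
have dE : dotp n x = (tnth n l)%:~R * tnth x l + \sum_(i < N | i != l) (tnth n i)%:~R * tnth x i.
  by rewrite /dotp (bigD1 l).
rewrite /ewave dE /dotp (bigD1 l)//= [in LHS]tnth_mktuple eqxx.
rewrite [X in expi (_ + X)](eq_bigr (fun i => (tnth n i)%:~R * tnth x i)); last first.
  by move=> i /negbTE il; rewrite tnth_mktuple il.
have := Tx l; rewrite in_itv/= /rot1 => /andP[-> ->]/=.
rewrite !expiD mulrA; congr (_ * _).
case: (_ < 2 * pi); first by rewrite mulrDr expiD mulrC.
by rewrite mulrBr expiD mulrDr expiD expiN expi_int2pi conjc1 mulr1 mulrC.
Qed.

(** Independence of the coordinate l, stated as invariance under its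
    rotations: this is the form that combines with the invariance of the
    integral. *)
Definition indep (l : 'I_N) (F : Rn R N -> R[i]) :=
  forall h x, 0 <= h < 2 * pi -> T x -> F (rot l h x) = F x.

(** Rotating the coordinate l by half a period of the exponential preserves F
    and the integral, but changes the sign of the exponential. *)
Lemma Ec_indep (l : 'I_N) F n : cib F -> indep l F -> tnth n l != 0 ->
  Ec (fun x => F x * ewave n x) = 0.
Proof.
move=> iF dF nl.
have n0 : (1 : R) <= `|(tnth n l)%:~R|.
  by rewrite -intr_norm -[1]/(1%:~R) ler_int; case: (tnth n l) nl => [[|k]|k].
(* half a period of the exponential in the coordinate l *)
pose h : R := pi / `|(tnth n l)%:~R|.
have pi0 := @pi_gt0 R.
have hh : 0 <= h < 2 * pi.
  rewrite divr_ge0// ?ltW//= ltr_pdivrMr; last by lra.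
  nra.
have iG : cib (fun x => F x * ewave n x).
  have := cibM (cbdd_ewave n) iF; apply: eq_cib => x _; exact: mulrC.
have := Ec_rot l hh iG.
have -> : Ec (fun x => F (rot l h x) * ewave n (rot l h x)) =
    Ec (fun x => -1 * (F x * ewave n x)).
  apply: eq_Ec => x Tx; rewrite dF// ewave_rot//.
  have -> : expi ((tnth n l)%:~R * h) = -1 :> R[i].
    rewrite /h mulrCA; have [np|np] := leP 0 (tnth n l).
      by rewrite ger0_norm ?ler0z// divff ?intr_eq0// mulr1 expipi.
    rewrite ltr0_norm ?ltrz0// invrN mulrN divff ?intr_eq0// mulrN1 /expi cosN sinN cospi sinpi.
    by apply: ceq => /=; rewrite ?oppr0.
  by rewrite mulrCA.
rewrite EcZ// mulN1r => /eqP; rewrite eq_sym -subr_eq0 opprK -mulr2n.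
by rewrite mulrn_eq0/= => /eqP.
Qed.

Definition vol : R := (2 * pi) ^+ N.
Lemma vol_gt0 : 0 < vol. Proof. by rewrite exprn_gt0// twopi_gt0. Qed.

Lemma Ec_ewave n : Ec (ewave n) = if n == tzero then vol%:C%C else 0.
Proof.
case: ifPn => [/eqP ->|n0].
  have -> : Ec (ewave tzero) = Ec (fun=> 1) by apply: eq_Ec => x _; exact: ewave0.
  by apply: ceq; rewrite /= ?E0// Ecst mul1r.
have [l nl] : exists l, tnth n l != 0.
  apply/existsP; apply: contraNT n0; rewrite negb_exists => /forallP h.
  by apply/eqP/eq_from_tnth => i; rewrite tnth_mktuple; have /negPn/eqP := h i.
have <- : Ec (fun x => 1 * ewave n x) = Ec (ewave n) by apply: eq_Ec => x _; rewrite mul1r.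
by apply: (Ec_indep (l := l)) => //; apply/cbdd_cib; exact: cbdd_cst.
Qed.

Definition trig (s : seq (N.-tuple int)) (c : N.-tuple int -> R[i]) (x : Rn R N) : R[i] :=
  \sum_(n <- s) c n * ewave n x.

Lemma cbdd_trig s c : cbdd (trig s c).
Proof. by apply: cbdd_sum => n; apply: cbddM; [exact: cbdd_cst|exact: cbdd_ewave]. Qed.

(** The factor vol^-1 is left to hat: without it, expansions of quadratic
    forms carry no constants. *)
Definition fc (F : Rn R N -> R[i]) n : R[i] := Ec (fun x => F x * (ewave n x)^*%C).

Lemma cib_fc F n : cib F -> cib (fun x => F x * (ewave n x)^*%C).
Proof.
move=> iF; have := cibM (cbddJ (cbdd_ewave n)) iF; apply: eq_cib => x _; exact: mulrC.
Qed.

Lemma trig_dot F s c : cib F ->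
  Ec (fun x => F x * (trig s c x)^*%C) = \sum_(n <- s) (c n)^*%C * fc F n.
Proof.
move=> iF.
rewrite (eq_bigr (fun n => Ec (fun x => (c n)^*%C * (F x * (ewave n x)^*%C)))); last first.
  by move=> n _; rewrite EcZ//; exact: cib_fc.
rewrite -Ecsum; last first.
  by move=> n; apply: cibM; [exact: cbdd_cst|exact: cib_fc].
apply: eq_Ec => x _; rewrite /trig conjc_sum mulr_sumr; apply: eq_bigr => n _.
by rewrite conjcM mulrCA.
Qed.

Lemma fc_trig s c n : uniq s -> n \in s -> fc (trig s c) n = c n * vol%:C%C.
Proof.
move=> us ns; rewrite /fc.
have -> : Ec (fun x => trig s c x * (ewave n x)^*%C) =
    Ec (fun x => \sum_(m <- s) c m * ewave (tsub m n) x).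
  by apply: eq_Ec => x _; rewrite /trig mulr_suml; apply: eq_bigr => m _; rewrite ewave_sub mulrA.
rewrite Ecsum; last by move=> m; apply: cibM; [exact: cbdd_cst|exact/cbdd_cib/cbdd_ewave].
rewrite (bigD1_seq n)//= [X in _ + X]big1 ?addr0 => [|m mn].
  by rewrite EcZ ?Ec_ewave ?tsub_eq0 ?eqxx//; exact/cbdd_cib/cbdd_ewave.
by rewrite EcZ ?Ec_ewave ?tsub_eq0 ?(negbTE mn) ?mulr0//; exact/cbdd_cib/cbdd_ewave.
Qed.

Lemma E_sq_trig s c : uniq s -> E (fun x => sq (trig s c x)) = vol * \sum_(n <- s) sq (c n).
Proof.
move=> us.
have -> : E (fun x => sq (trig s c x)) = Re (Ec (fun x => trig s c x * (trig s c x)^*%C)).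
  by apply: eqE_ => x _; rewrite sq_self.
rewrite trig_dot; last exact/cbdd_cib/cbdd_trig.
rewrite mulr_sumr Re_sum; apply: eq_big_seq => n ns.
by rewrite fc_trig// mulrA [_^*%C * _]mulrC mulJE ReM ImC ReC mul0r subr0 mulrC.
Qed.

(** Completing the square in the coefficients; Bessel's inequality and the
    optimality of the Fourier sum are both read off this identity. *)
Lemma trig_distance F s c : cib F -> ib (fun x => sq (F x)) -> uniq s ->
  E (fun x => sq (F x - trig s c x)) =
  E (fun x => sq (F x)) - vol^-1 * (\sum_(n <- s) sq (fc F n))
  + vol * \sum_(n <- s) sq (c n - fc F n * (vol^-1)%:C%C).
Proof.
move=> iF sF us.
have v0 : vol != 0 by rewrite gt_eqF// vol_gt0.
have iFt : ib (fun x => Re (F x * (trig s c x)^*%C)).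
  have [h _] := cibM (cbddJ (cbdd_trig s c)) iF.
  by move: h; apply: eq_ib => x _; rewrite mulrC.
have -> : E (fun x => sq (F x - trig s c x)) =
    E (fun x => sq (F x)) + E (fun x => sq (trig s c x)) - 2 * Re (Ec (fun x => F x * (trig s c x)^*%C)).
  rewrite -EZ// -ED// -?EB//.
  - by apply: eqE_ => x _; rewrite sqBE.
  - by apply: ibD => //; exact/bdd_ib/bdd_sq/cbdd_trig.
  - exact: ibZ.
  - exact/bdd_ib/bdd_sq/cbdd_trig.
rewrite E_sq_trig// trig_dot// Re_sum -!addrA; congr (_ + _).
rewrite !mulr_sumr -!sumrN -!big_split/=; apply: eq_bigr => n _.
by rewrite /sq !(ReD, ImD, ReN, ImN, ReM, ImM, ReJ, ImJ, ReC, ImC); field.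
Qed.

Lemma bessel F s : cib F -> ib (fun x => sq (F x)) -> uniq s ->
  \sum_(n <- s) sq (fc F n) <= vol * E (fun x => sq (F x)).
Proof.
move=> iF sF us; pose c n := fc F n * (vol^-1)%:C%C.
have := trig_distance c iF sF us.
rewrite [X in _ + vol * X]big1 ?mulr0 ?addr0; last by move=> n _; rewrite subrr sq0.
have : 0 <= E (fun x => sq (F x - trig s c x)) by apply: Ege0 => x _; exact: sq_ge0.
move=> + h; rewrite h subr_ge0 mulrC ler_pdivrMr ?vol_gt0//.
by rewrite mulrC.
Qed.

Lemma best_approx F s s' c : cib F -> ib (fun x => sq (F x)) -> uniq s -> uniq s' ->
  {subset s <= s'} ->
  E (fun x => sq (F x - trig s' (fun n => fc F n * (vol^-1)%:C%C) x)) <=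
  E (fun x => sq (F x - trig s c x)).
Proof.
move=> iF sF us us' ss'.
rewrite !trig_distance// [X in _ + vol * X <= _]big1 ?mulr0 ?addr0; last first.
  by move=> n _; rewrite subrr sq0.
rewrite -addrA lerD2l -[leLHS]addr0; apply: lerD; last first.
  apply: mulr_ge0; [exact: ltW vol_gt0|by apply: sumr_ge0 => n _; exact: sq_ge0].
rewrite lerN2; apply: ler_wpM2l; first by rewrite invr_ge0 ltW// vol_gt0.
rewrite [leRHS](perm_big (s ++ [seq n <- s' | n \notin s]))/=.
  by rewrite big_cat/= lerDl; apply: sumr_ge0 => n _; exact: sq_ge0.
apply: uniq_perm => //.
  rewrite cat_uniq us filter_uniq// andbT/=; apply/hasPn => n.
  by rewrite mem_filter => /andP[].
move=> n; rewrite mem_cat mem_filter; case: (boolP (n \in s)) => //= /ss' ->; by [].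
Qed.

End exponentials.
Arguments vol {R} N.

(** * Mean-square approximation by trigonometric polynomials *)

Section dct.
Context {R : realType} (N : nat).
Notation mu := (@lebesgueRn R N).
Notation T := (@torus R N).
Notation E := (@tint R N).

(** Dominated convergence, reduced to what approximation arguments use: one
    good index. *)
Lemma E_dct (f : nat -> Rn R N -> R) (g : Rn R N -> R) :
  (forall n, measurable_fun T (f n)) -> ib g ->
  (forall n x, T x -> `|f n x| <= g x) ->
  (forall x, T x -> f n x @[n --> \oo] --> (0 : R)) ->
  forall e : R, 0 < e -> exists n, E (f n) <= e.
Proof.
move=> mf ig fg f0 e e0.
have mT : measurable T by exact: measurable_torus.
have [|||||_ _] := @dominated_convergence _ _ R mu T mT (fun n x => (f n x)%:E)
  (fun=> 0%E) (EFin \o g).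
- by move=> n; exact/measurable_EFinP.
- exact: measurable_cst.
- by apply: aeW => x Tx; apply: cvg_EFin; [exact: nearW|exact: f0].
- exact: ig.
- by apply: aeW => x n Tx; rewrite /= lee_fin; exact: fg.
rewrite integral0 => /fine_cvgP[_ /cvgrPdist_le/(_ _ e0)[n _ /(_ n)]] /= h.
exists n; have := h (leqnn _); rewrite sub0r normrN; apply: le_trans.
exact: ler_norm.
Qed.
End dct.

Lemma e4_gt0 (R : realType) (e : R) : 0 < e -> 0 < e / 4.
Proof. by move=> ?; lra. Qed.

Section density.
Context {R : realType} (N : nat).
Notation mu := (@lebesgueRn R N).
Notation T := (@torus R N).
Notation E := (@tint R N).
Notation Ec := (@Ec R N).

Definition trigpoly (p : Rn R N -> R[i]) := exists s c, uniq s /\ p = trig s c.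

Lemma trigpoly_cons p a n : trigpoly p -> trigpoly (fun x => a * ewave n x + p x).
Proof.
move=> [s [c [us ->]]]; have [ns|ns] := boolP (n \in s).
  exists s, (fun m => if m == n then a + c m else c m); split=> //.
  apply/funext => x; rewrite /trig !(bigD1_seq n ns us)/= eqxx addrA -mulrDl.
  by congr (_ + _); apply: eq_bigr => m /negbTE ->.
exists (n :: s), (fun m => if m == n then a else c m); split; first by rewrite /= ns.
apply/funext => x; rewrite /trig big_cons eqxx; congr (_ + _).
by apply: eq_big_seq => m ms; case: eqP ms ns => // -> ->.
Qed.

Lemma trigpoly_sum I (r : seq I) (a : I -> R[i]) n : trigpoly (fun x => \sum_(i <- r) a i * ewave (n i) x).
Proof.
elim: r => [|i r IH].
  exists [::], (fun=> 0); split => //; apply/funext => x; by rewrite /trig !big_nil.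
under [X in trigpoly X]funext do rewrite big_cons; exact: trigpoly_cons.
Qed.

Lemma trigpolyD p q : trigpoly p -> trigpoly q -> trigpoly (fun x => p x + q x).
Proof.
move=> [s [c [us ->]]] tq; rewrite /trig; elim: s {us} => [|n s IH].
  by under [X in trigpoly X]funext do rewrite big_nil add0r.
by under [X in trigpoly X]funext do rewrite big_cons -addrA; exact: trigpoly_cons.
Qed.

Lemma trigpolyM p q : trigpoly p -> trigpoly q -> trigpoly (fun x => p x * q x).
Proof.
move=> [s [c [us ->]]] [s' [c' [us' ->]]].
under [X in trigpoly X]funext do rewrite /trig mulr_suml.
elim: s {us} => [|n s IH].
  under [X in trigpoly X]funext do rewrite big_nil.
  by have := trigpoly_sum [::] (fun=> 0) id; under [X in trigpoly X -> _]funext do rewrite big_nil.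
under [X in trigpoly X]funext do rewrite big_cons.
apply: trigpolyD => //.
have := trigpoly_sum s' (fun m => c n * c' m) (fun m => tadd n m).
under [X in trigpoly X -> _]funext => x.
  under eq_bigr => m _ do rewrite ewave_add mulrACA.
  rewrite -mulr_sumr; over.
by [].
Qed.

Lemma trigpoly_ewave a n : trigpoly (fun x => a * ewave n x).
Proof.
have := trigpoly_sum [:: n] (fun=> a) id.
by under [X in trigpoly X -> _]funext do rewrite big_seq1.
Qed.

Lemma trigpoly_cst a : trigpoly (fun=> a).
Proof.
have := trigpoly_ewave a (tzero (N := N)).
by under [X in trigpoly X -> _]funext do rewrite ewave0 mulr1.
Qed.

Lemma trigpolyX p k : trigpoly p -> trigpoly (fun x => p x ^+ k).
Proof.
move=> tp; elim: k => [|k IH]; first by under [X in trigpoly X]funext do rewrite expr0; exact: trigpoly_cst.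
by under [X in trigpoly X]funext do rewrite exprS; exact: trigpolyM.
Qed.

Lemma cbdd_trigpoly p : trigpoly p -> cbdd p.
Proof. by move=> [s [c [_ ->]]]; exact: cbdd_trig. Qed.

Lemma cbdd_bound F : cbdd F -> exists2 M : R, 0 < M & forall x, T x -> sq (F x) <= M.
Proof.
move=> /bdd_sq[_ [M MF]]; exists (`|M| + 1); first by rewrite ltr_pwDr.
move=> x Tx; apply: (le_trans (ler_norm _)); apply: (le_trans (MF x Tx)).
by rewrite ler_wpDr// ler_norm.
Qed.

Definition approx (F : Rn R N -> R[i]) :=
  forall e : R, 0 < e -> exists2 p, trigpoly p & E (fun x => sq (F x - p x)) <= e.

Definition l2 (F : Rn R N -> R[i]) := cib F /\ ib (fun x => sq (F x)).

Lemma cbdd_l2 F : cbdd F -> l2 F.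
Proof. by move=> bF; split; [exact: cbdd_cib|exact/bdd_ib/bdd_sq]. Qed.

Lemma l2_meas F : l2 F -> measurable_fun T (fun x => Re (F x)) /\ measurable_fun T (fun x => Im (F x)).
Proof. by move=> [[a b] _]; split; exact: ib_meas. Qed.

Lemma l2P F : measurable_fun T (fun x => Re (F x)) -> measurable_fun T (fun x => Im (F x)) ->
  ib (fun x => sq (F x)) -> l2 F.
Proof.
move=> mR mI sF; split=> //.
have iG : ib (fun x => 1 + sq (F x)) by apply: ibD => //; exact/bdd_ib/bdd_cst.
split; apply: ib_le iG => // x _; rewrite /sq.
  rewrite -[X in _ <= _ + (X + _)]real_normK ?num_real//.
  have := sqr_ge0 (Im (F x)); have := normr_ge0 (Re (F x)); nra.
rewrite -[X in _ <= _ + (_ + X)]real_normK ?num_real//.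
have := sqr_ge0 (Re (F x)); have := normr_ge0 (Im (F x)); nra.
Qed.

Lemma l2D F G : l2 F -> l2 G -> l2 (fun x => F x + G x).
Proof.
move=> lF lG; have [[aF bF] sF] := lF; have [[aG bG] sG] := lG.
have [mR mI] : measurable_fun T (fun x => Re (F x + G x)) /\
    measurable_fun T (fun x => Im (F x + G x)).
  have [[h1 h2] _] : cib (fun x => F x + G x) /\ True by split => //; exact: cibD.
  by split; exact: ib_meas.
apply: l2P => //.
apply: (@ib_le _ _ _ (fun x => 2 * sq (F x) + 2 * sq (G x))).
- by apply: measurable_funD; exact: measurable_funX.
- by move=> x _; rewrite ger0_norm ?sq_ge0//; exact: sqD_le.
- by apply: ibD; exact: ibZ.
Qed.

Lemma l2M F G : cbdd F -> l2 G -> l2 (fun x => F x * G x).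
Proof.
move=> bF [iG sG]; split; first exact: cibM.
under [X in ib X]funext do rewrite sqM; apply: ibM => //; exact: bdd_sq.
Qed.

Lemma l2N F : l2 F -> l2 (fun x => - F x).
Proof.
move=> lF; have := l2M (@cbdd_cst R N (-1)) lF.
by under [X in l2 X -> _]funext do rewrite mulN1r.
Qed.

Lemma l2B F G : l2 F -> l2 G -> l2 (fun x => F x - G x).
Proof. by move=> lF lG; apply: l2D => //; exact: l2N. Qed.

Lemma E_sqD F G : l2 F -> l2 G ->
  E (fun x => sq (F x + G x)) <= 2 * E (fun x => sq (F x)) + 2 * E (fun x => sq (G x)).
Proof.
move=> lF lG; have [_ sF] := lF; have [_ sG] := lG.
have [_ sFG] := l2D lF lG.
rewrite -!EZ// -ED//; try exact: ibZ.
by apply: Ele => //; [apply: ibD; exact: ibZ|move=> x _; exact: sqD_le].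
Qed.

Lemma approxD F G : l2 F -> l2 G -> approx F -> approx G -> approx (fun x => F x + G x).
Proof.
move=> lF lG aF aG e e0; have [p tp Fp] := aF (e / 4) (e4_gt0 e0).
have [q tq Gq] := aG (e / 4) (e4_gt0 e0).
exists (fun x => p x + q x); first exact: trigpolyD.
have lFp := l2B lF (cbdd_l2 (cbdd_trigpoly tp)); have lGq := l2B lG (cbdd_l2 (cbdd_trigpoly tq)).
have := E_sqD lFp lGq.
rewrite (@eqE_ _ _ (fun x => sq (F x - p x + (G x - q x))) (fun x => sq (F x + G x - (p x + q x)))); last first.
  by move=> x _; congr sq; ring.
by move=> h; apply: (le_trans h); lra.
Qed.

Lemma approx_lim F : l2 F ->
  (forall e : R, 0 < e -> exists G, [/\ l2 G, approx G & E (fun x => sq (F x - G x)) <= e]) ->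
  approx F.
Proof.
move=> lF h e e0; have [G [lG aG FG]] := h (e / 4) (e4_gt0 e0).
have [p tp Gp] := aG (e / 4) (e4_gt0 e0).
exists p => //.
have := E_sqD (l2B lF lG) (l2B lG (cbdd_l2 (cbdd_trigpoly tp))).
rewrite (@eqE_ _ _ (fun x => sq (F x - G x + (G x - p x))) (fun x => sq (F x - p x))); last first.
  by move=> x _; congr sq; ring.
by move=> h'; apply: (le_trans h'); lra.
Qed.

Lemma approxZ a F : l2 F -> approx F -> approx (fun x => a * F x).
Proof.
move=> lF aF e e0.
have k0 : 0 < sq a + 1 by rewrite ltr_wpDl ?sq_ge0.
have [p tp Fp] := aF (e / (sq a + 1)) (divr_gt0 e0 k0).
exists (fun x => a * p x); first by apply: trigpolyM => //; exact: trigpoly_cst.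
have [_ sFp] := l2B lF (cbdd_l2 (cbdd_trigpoly tp)).
rewrite (@eqE_ _ _ _ (fun x => sq a * sq (F x - p x))); last first.
  by move=> x _; rewrite -mulrBr sqM.
rewrite EZ//; move: Fp; rewrite ler_pdivlMr// => Fp.
have h0 : 0 <= E (fun x => sq (F x - p x)) by apply: Ege0 => x _; exact: sq_ge0.
by apply: le_trans Fp; rewrite mulrC ler_wpM2l// lerDl.
Qed.

Lemma approx_sum I (r : seq I) (F : I -> Rn R N -> R[i]) :
  (forall i, l2 (F i) /\ approx (F i)) -> l2 (fun x => \sum_(i <- r) F i x) /\ approx (fun x => \sum_(i <- r) F i x).
Proof.
move=> h; elim: r => [|i r [l1 a1]].
  split.
    by under [X in l2 X]funext do rewrite big_nil; exact/cbdd_l2/cbdd_cst.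
  move=> e e0; exists (fun=> 0); first exact: trigpoly_cst.
  rewrite (@eqE_ _ _ _ (fun=> 0)) ?E0 ?ltW// => x _.
  by rewrite big_nil subrr sq0.
have [l2i ai] := h i.
split; first by under [X in l2 X]funext do rewrite big_cons; exact: l2D.
by under [X in approx X]funext do rewrite big_cons; exact: approxD.
Qed.

Definition ind (A : set (Rn R N)) (x : Rn R N) : R[i] := (\1_A x)%:C%C.

Lemma cbdd_ind A : measurable A -> cbdd (ind A).
Proof. by move=> mA; apply: cbddC; exact: bdd_indic. Qed.

(** These sets turn out to form a sigma-algebra that contains the half-spaces.
    *)
Definition approx_set A := measurable A /\ approx (ind A).

Lemma approx_setC A : approx_set A -> approx_set (~` A).
Proof.
move=> [mA aA]; split; first exact: measurableC.
have -> : ind (~` A) = (fun x => 1 + (-1) * ind A x).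
  apply/funext => x; rewrite /ind !indicE in_setC.
  by case: (x \in A); rewrite /= ?mulr1 ?mulr0 ?addr0 ?subrr// mulN1r; apply: ceq => /=; rewrite ?addrN ?subr0 ?oppr0 ?addr0.
apply: approxD; first exact/cbdd_l2/cbdd_cst.
- by apply: l2M; [exact: cbdd_cst|exact/cbdd_l2/cbdd_ind].
- move=> e e0; exists (fun=> 1); first exact: trigpoly_cst.
  by rewrite (@eqE_ _ _ _ (fun=> 0)) ?E0 ?ltW// => x _; rewrite subrr sq0.
- by apply: approxZ => //; exact/cbdd_l2/cbdd_ind.
Qed.

Lemma sq_ind_le A x : sq (ind A x) <= 1.
Proof. by rewrite sqC indicE; case: (_ \in _); rewrite ?expr1n ?expr0n. Qed.

(** A product of approximations works if the second polynomial is chosen after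
    a bound of the first is known. *)
Lemma approx_setI A B : approx_set A -> approx_set B -> approx_set (A `&` B).
Proof.
move=> [mA aA] [mB aB]; split; first exact: measurableI.
move=> e e0; have [p tp Ap] := aA (e / 4) (e4_gt0 e0).
have [M M0 pM] := cbdd_bound (cbdd_trigpoly tp).
have [q tq Bq] := aB (e / 4 / M) (divr_gt0 (e4_gt0 e0) M0).
exists (fun x => p x * q x); first exact: trigpolyM.
have lA : l2 (fun x => ind A x - p x) by apply: l2B; apply: cbdd_l2; [exact: cbdd_ind|exact: cbdd_trigpoly].
have lB : l2 (fun x => ind B x - q x) by apply: l2B; apply: cbdd_l2; [exact: cbdd_ind|exact: cbdd_trigpoly].
have lA' := l2M (cbdd_ind mB) lA; have lB' := l2M (cbdd_trigpoly tp) lB.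
have [_ sA] := lA; have [_ sB] := lB; have [_ sA'] := lA'; have [_ sB'] := lB'.
rewrite (@eqE_ _ _ _ (fun x => sq (ind B x * (ind A x - p x) + p x * (ind B x - q x)))); last first.
  move=> x _; congr sq; rewrite /ind indicI /= rmorphM/=; ring.
apply: (le_trans (E_sqD lA' lB')).
have h1 : E (fun x => sq (ind B x * (ind A x - p x))) <= e / 4.
  apply: le_trans Ap; apply: Ele => // x _.
  by rewrite sqM ler_piMl ?sq_ge0 ?sq_ind_le.
have h2 : E (fun x => sq (p x * (ind B x - q x))) <= e / 4.
  apply: (@le_trans _ _ (M * E (fun x => sq (ind B x - q x)))).
    rewrite -EZ//; apply: Ele => //; first exact: ibZ.
    by move=> x Tx; rewrite sqM ler_wpM2r ?sq_ge0 ?pM.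
  by rewrite mulrC -ler_pdivlMr.
by lra.
Qed.

Lemma approx_setU A B : approx_set A -> approx_set B -> approx_set (A `|` B).
Proof. by move=> gA gB; rewrite -(setCK (A `|` B)) setCU; apply/approx_setC/approx_setI; exact: approx_setC. Qed.

Lemma approx_set0 : approx_set set0.
Proof.
split=> // e e0; exists (fun=> 0); first exact: trigpoly_cst.
rewrite (@eqE_ _ _ _ (fun=> 0)) ?E0 ?ltW// => x _.
by rewrite /ind indic0 subrr sq0.
Qed.

(** Finite unions increase to the union, and dominated convergence makes the
    convergence of their indicators mean-square. *)
Lemma approx_set_bigcup (A : nat -> set (Rn R N)) : (forall n, approx_set (A n)) -> approx_set (\bigcup_n A n).
Proof.
move=> gA; have mU : measurable (\bigcup_n A n).
  by apply: bigcupT_measurable => n; have [] := gA n.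
split=> //.
pose B n := \big[setU/set0]_(i < n) A i.
have gB n : approx_set (B n).
  by rewrite /B; elim/big_ind : _ => //; [exact: approx_set0|exact: approx_setU].
apply: approx_lim; first exact/cbdd_l2/cbdd_ind.
move=> e e0.
have [n hn] : exists n, E (fun x => sq (ind (\bigcup_n A n) x - ind (B n) x)) <= e.
  apply: (@E_dct R N (fun n x => sq (ind (\bigcup_n A n) x - ind (B n) x)) (fun=> 4)) => //.
  - move=> n; have [mB _] := gB n.
    by have [] := bdd_sq (cbddB (cbdd_ind mU) (cbdd_ind mB)).
  - exact/bdd_ib/bdd_cst.
  - move=> n x _; rewrite ger0_norm ?sq_ge0//; apply: (le_trans (sqB_le _ _)).
    have := sq_ind_le (\bigcup_n A n) x; have := sq_ind_le (B n) x; lra.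
  - move=> x _; apply/cvgrPdist_le => d d0.
    have [[k _ Akx]|nU] := pselect ((\bigcup_n A n) x).
      near=> n; have kn : (k < n)%N by near: n; exact: nbhs_infty_gt.
      have Bx : B n x.
        by rewrite /B -bigcup_mkord; exists k.
      rewrite /ind !indicE !mem_set//; last by exists k.
      by rewrite subrr sq0 subrr normr0 ltW.
    apply: nearW => n.
    rewrite /ind !indicE !memNset// ?subrr ?sq0 ?subrr ?normr0 ?ltW//.
    by rewrite /B -bigcup_mkord => -[k _ Akx]; apply: nU; exists k.
have [mB aB] := gB n.
by exists (ind (B n)); split => //; exact/cbdd_l2/cbdd_ind.
Unshelve. all: by end_near.
Qed.

End density.

(** * Approximability of indicators *)

Section step.
Context {R : realType}.

(** Polynomials that separate y < 1/2 from y >= 1/2 on [0, 1]: the product n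
    2^n y^n tends to zero in the first case and to infinity in the second. *)
Definition step n (y : R) : R := (1 - y ^+ n) ^+ (n * 2 ^ n).

Lemma step_01 n (y : R) : 0 <= y <= 1 -> 0 <= step n y <= 1.
Proof.
move=> /andP[y0 y1]; have h0 : 0 <= y ^+ n by exact: exprn_ge0.
have h1 : y ^+ n <= 1 by exact: exprn_ile1.
by rewrite /step exprn_ge0 ?subr_ge0//= exprn_ile1// ?subr_ge0// gerBl.
Qed.

Lemma bernoulli_ge (u : R) (m : nat) : 0 <= u -> 1 + m%:R * u <= (1 + u) ^+ m.
Proof.
move=> u0; elim: m => [|m IH]; first by rewrite mul0r addr0 expr0.
rewrite exprS; apply: (@le_trans _ _ ((1 + u) * (1 + m%:R * u))).
  rewrite -natr1; have : 0 <= m%:R * (u * u) by rewrite mulr_ge0// mulr_ge0.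
  lra.
by rewrite ler_wpM2l// addr_ge0.
Qed.

Lemma bernoulli_le (u : R) (m : nat) : 0 <= u <= 1 -> 1 - m%:R * u <= (1 - u) ^+ m.
Proof.
move=> /andP[u0 u1]; elim: m => [|m IH]; first by rewrite mul0r subr0 expr0.
rewrite exprS; apply: (@le_trans _ _ ((1 - u) * (1 - m%:R * u))).
  rewrite -natr1; have : 0 <= m%:R * (u * u) by rewrite mulr_ge0// mulr_ge0.
  lra.
by rewrite ler_wpM2l// subr_ge0.
Qed.

Lemma bernoulli_inv (u : R) (m : nat) : 0 <= u <= 1 -> (1 - u) ^+ m * (1 + m%:R * u) <= 1.
Proof.
move=> /andP[u0 u1].
apply: (@le_trans _ _ ((1 - u) ^+ m * (1 + u) ^+ m)).
  by rewrite ler_wpM2l ?bernoulli_ge// exprn_ge0// subr_ge0.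
rewrite -exprMn exprn_ile1//; first by rewrite mulr_ge0 ?subr_ge0// addr_ge0.
nra.
Qed.

Lemma cvg_step (y : R) : 0 <= y <= 1 ->
  step n y @[n --> \oo] --> (((y < 1 / 2)%R)%:R : R).
Proof.
move=> /andP[y0 y1]; apply/cvgrPdist_le => e e0.
case: ltP => hy /=.
  (* n (2 y) ^ n is at most a constant over n, by Bernoulli twice *)
  pose w : R := Num.sqrt (2 * y).
  have w0 : 0 <= w by exact: sqrtr_ge0.
  have w2 : w ^+ 2 = 2 * y by rewrite sqr_sqrtr// mulr_ge0.
  have w1 : w < 1.
    by rewrite -(@ltr_pXn2r _ 2)// ?nnegrE// expr1n w2; lra.
  pose u := 1 - w.
  have u01 : 0 <= u <= 1 by rewrite /u; apply/andP; split; lra.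
  have u0 : 0 < u by rewrite /u; lra.
  have wn n : w ^+ n * (n%:R * u) <= 1.
    have := bernoulli_inv n u01; rewrite /u opprB addrC subrK => h.
    apply: le_trans h; rewrite ler_wpM2l ?exprn_ge0// /u; lra.
  near=> n.
  have n0 : (0 < n)%N by near: n; exact: nbhs_infty_gt.
  have n0r : 0 < n%:R :> R by rewrite ltr0n.
  have key : n%:R * (2 * y) ^+ n <= e.
    rewrite -w2 -exprM mulnC exprM expr2.
    have h1 := wn n; have wn0 : 0 <= w ^+ n by exact: exprn_ge0.
    have ub : w ^+ n <= (n%:R * u)^-1 by rewrite -[leRHS]mul1r ler_pdivlMr// mulr_gt0.
    apply: (@le_trans _ _ ((n%:R * u)^-1 * u^-1)).
      have -> : n%:R * (w ^+ n * w ^+ n) = w ^+ n * (w ^+ n * (n%:R * u)) * u^-1.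
        by field; rewrite gt_eqF.
      apply: ler_wpM2r; first by rewrite invr_ge0 ltW.
      by apply: le_trans ub; exact: ler_piMr.
    rewrite -invfM -[leLHS]mul1r ler_pdivrMr; last by rewrite !mulr_gt0.
    have hn : (e * u * u)^-1 <= n%:R.
      near: n; exact: nbhs_infty_ger.
    rewrite -[leLHS](@mulVf _ (e * u * u)); last by rewrite gt_eqF// !mulr_gt0.
    apply: (@le_trans _ _ (n%:R * (e * u * u))); last lra.
    by rewrite ler_wpM2r// !mulr_ge0// ltW.
  have sn : 0 <= step n y <= 1 by apply: step_01; rewrite y0.
  have yn : 0 <= y ^+ n <= 1 by rewrite exprn_ge0//= exprn_ile1.
  have := bernoulli_le (n * 2 ^ n) yn; rewrite -/(step n y).
  have -> : (n * 2 ^ n)%:R * y ^+ n = n%:R * (2 * y) ^+ n.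
    by rewrite natrM natrX exprMn mulrA.
  move=> h; rewrite ger0_norm; lra.
near=> n.
have n0 : (0 < n)%N by near: n; exact: nbhs_infty_gt.
have sn : 0 <= step n y <= 1 by apply: step_01; rewrite y0.
have yn : 0 <= y ^+ n <= 1 by rewrite exprn_ge0//= exprn_ile1.
have := bernoulli_inv (n * 2 ^ n) yn; rewrite -/(step n y).
have -> : (n * 2 ^ n)%:R * y ^+ n = n%:R * (2 * y) ^+ n.
  by rewrite natrM natrX exprMn mulrA.
have h1 : 1 <= (2 * y) ^+ n by rewrite exprn_ege1//; lra.
have hn : e^-1 <= n%:R by near: n; exact: nbhs_infty_ger.
move=> h; rewrite sub0r normrN ger0_norm; last by case/andP: sn.
have hn0 : 0 <= n%:R :> R by [].
have : step n y * e^-1 <= 1.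
  apply: le_trans h; apply: ler_wpM2l; first by case/andP: sn.
  by apply: (le_trans hn); nra.
by rewrite ler_pdivrMr// mul1r.
Unshelve. all: by end_near.
Qed.
End step.

(** This presents the half-spaces of the torus as sublevel sets of
    trigonometric polynomials. *)
Lemma cos_half_lt {R : realType} (a b : R) : 0 <= b -> b < 2 * pi ->
  0 <= a < 2 * pi -> (cos (a - b / 2) < cos (b / 2)) = (b < a).
Proof.
move=> b0 b2 /andP[x0 x2]; have pi0 := @pi_gt0 R.
have cosm (u v : R) : 0 <= u -> u <= pi -> 0 <= v -> v <= pi -> (cos u < cos v) = (v < u).
  by move=> *; rewrite ltr_cos// in_itv/=; apply/andP; split.
have [ab|ab] := leP a (b / 2).
  by rewrite -cosN opprB cosm; lra.
have [apd|apd] := leP (a - b / 2) pi.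
  by rewrite cosm; lra.
have -> : cos (a - b / 2) = cos (2 * pi - (a - b / 2)).
  by rewrite [RHS]cosB [2 * pi]mulr_natl cos2pi sin2pi mul1r mul0r addr0.
by rewrite cosm; lra.
Qed.

Section density.
Context {R : realType} (N : nat).
Notation mu := (@lebesgueRn R N).
Notation T := (@torus R N).
Notation E := (@tint R N).
Notation Ec := (@Ec R N).
Notation approx_set := (@approx_set R N).

Lemma eq_approx (F G : Rn R N -> R[i]) : (forall x, T x -> F x = G x) -> approx F -> approx G.
Proof.
move=> FG aF e e0; have [p tp Fp] := aF e e0; exists p => //.
by apply: le_trans Fp; rewrite le_eqVlt; apply/orP; left; apply/eqP/eqE_ => x Tx; rewrite FG.
Qed.

Lemma trigpoly_approx (p : Rn R N -> R[i]) : trigpoly p -> approx p.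
Proof.
move=> tp e e0; exists p => //.
by rewrite (@eqE_ _ _ _ (fun=> 0)) ?E0 ?ltW// => x _; rewrite subrr sq0.
Qed.

Lemma trigpoly_cos (l : 'I_N) (b : R) : trigpoly (fun x => (cos (tnth x l - b))%:C%C).
Proof.
pose n : N.-tuple int := [tuple (if i == l then 1 else 0) | i < N].
pose m : N.-tuple int := [tuple (if i == l then -1 else 0) | i < N].
have dn (x : Rn R N) : dotp n x = tnth x l.
  rewrite /dotp (bigD1 l)//= big1 ?addr0; first by rewrite tnth_mktuple eqxx mul1r.
  by move=> i /negbTE il; rewrite tnth_mktuple il mul0r.
have dm (x : Rn R N) : dotp m x = - tnth x l.
  rewrite /dotp (bigD1 l)//= big1 ?addr0; first by rewrite tnth_mktuple eqxx mulN1r.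
  by move=> i /negbTE il; rewrite tnth_mktuple il mul0r.
have := trigpolyD (trigpoly_ewave ((1/2)%:C%C * expi (- b)) n) (trigpoly_ewave ((1/2)%:C%C * expi b) m).
congr trigpoly; apply/funext => x; rewrite /ewave dn dm -!mulrA -!expiD.
have e1 : cos (b - tnth x l) = cos (tnth x l - b) by rewrite -cosN opprB.
have e2 : sin (b - tnth x l) = - sin (tnth x l - b) by rewrite -sinN opprB.
by apply: ceq; rewrite ?(ReD, ImD, ReM, ImM) /= !mul0r [- b + _]addrC ?e1 ?e2; lra.
Qed.

(** Composing step with an affine function of cos (x_l - b/2) gives
    trigonometric polynomials that converge boundedly to the indicator. *)
Lemma approx_set_halfspace (l : 'I_N) (b : R) : approx_set [set x | b < tnth x l].
Proof.
have mA : measurable ([set x : Rn R N | b < tnth x l]).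
  have := @measurable_tnth _ (measurableTypeR R) N l measurableT `]b, +oo[%classic.
  rewrite setTI (_ : _ @^-1` _ = [set x : Rn R N | b < tnth x l]); last first.
    by apply/seteqP; split => x /=; rewrite in_itv/= andbT.
  by apply; exact: measurable_itv.
split=> //; have pi0 := @pi_gt0 R.
have [b0|b0] := ltP b 0.
  apply: (@eq_approx (fun=> 1)); last by apply: trigpoly_approx; exact: trigpoly_cst.
  move=> x /(_ l); rewrite in_itv/= => /andP[x0 _].
  by rewrite /ind indicE mem_set//=; exact: lt_le_trans b0 x0.
have [b2|b2] := leP (2 * pi) b.
  apply: (@eq_approx (fun=> 0)); last by apply: trigpoly_approx; exact: trigpoly_cst.
  move=> x /(_ l); rewrite in_itv/= => /andP[_ x2].
  by rewrite /ind indicE memNset//=; apply/negP; rewrite -leNgt ltW// (lt_le_trans x2).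
(* on the circle, x > b is equivalent to cos (x - b/2) < cos (b/2) *)
(* the factor 1/4 keeps y in [0, 1] *)
pose y (x : Rn R N) : R := 1 / 2 + (cos (tnth x l - b / 2) - cos (b / 2)) / 4.
have y01 x : 0 <= y x <= 1.
  rewrite /y; have := cos_geN1 (tnth x l - b / 2); have := cos_le1 (tnth x l - b / 2).
  have := cos_geN1 (b / 2); have := cos_le1 (b / 2) => *; apply/andP; split; lra.
have tstep n : trigpoly (fun x => (step n (y x))%:C%C).
  have -> : (fun x => (step n (y x))%:C%C) = (fun x => (1 + (-1) *
     ((1 / 2 - cos (b / 2) / 4)%:C%C + (1 / 4)%:C%C * (cos (tnth x l - b / 2))%:C%C) ^+ n) ^+ (n * 2 ^ n) : R[i]).
    apply/funext => x; rewrite -rmorphM/= -rmorphD/= (_ : 1 / 2 - cos (b / 2) / 4 + 1 / 4 * cos (tnth x l - b / 2) = y x); last by rewrite /y; lra.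
    by rewrite mulN1r /step rmorphXn/= rmorphB/= rmorphXn/= rmorph1.
  apply: trigpolyX; apply: trigpolyD; first exact: trigpoly_cst.
  apply: trigpolyM; first exact: trigpoly_cst.
  apply: trigpolyX; apply: trigpolyD; first exact: trigpoly_cst.
  by apply: trigpolyM; [exact: trigpoly_cst|exact: trigpoly_cos].
have yE x : T x -> (y x < 1 / 2) = (b < tnth x l).
  move=> /(_ l); rewrite in_itv/= => /andP[x0 x2].
  have -> : (y x < 1 / 2) = (cos (tnth x l - b / 2) < cos (b / 2)).
    by rewrite /y; apply/idP/idP => ?; lra.
  by apply: cos_half_lt => //; apply/andP.
apply: approx_lim; first exact/cbdd_l2/cbdd_ind.
move=> e e0.
have [n hn] : exists n, E (fun x => sq (ind [set x | b < tnth x l] x - (step n (y x))%:C%C)) <= e.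
  apply: (@E_dct R N (fun n x => sq (ind [set x | b < tnth x l] x - (step n (y x))%:C%C)) (fun=> 4)) => //.
  - by move=> n; have [] := bdd_sq (cbddB (cbdd_ind mA) (cbdd_trigpoly (tstep n))).
  - exact/bdd_ib/bdd_cst.
  - move=> n x _; rewrite ger0_norm ?sq_ge0//; apply: (le_trans (sqB_le _ _)).
    have := sq_ind_le [set x | b < tnth x l] x; rewrite (sqC (step _ _)).
    have /andP[? ?] := step_01 n (y01 x); nra.
  - move=> x Tx.
    have -> : (fun n => sq (ind [set x | b < tnth x l] x - (step n (y x))%:C%C)) =
        (fun n => ((y x < 1 / 2)%R%:R - step n (y x)) ^+ 2).
      apply/funext => n; rewrite /ind -rmorphB/= sqC indicE; congr ((_ - _) ^+ 2).
      by rewrite yE//; case: (boolP (b < _)) => h; [rewrite mem_set|rewrite memNset//; apply/negP].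
    have h : (fun n => (y x < 1 / 2)%R%:R - step n (y x)) @ \oo --> (0 : R).
      rewrite -[X in _ --> X](subrr ((y x < 1 / 2)%R%:R : R)).
      by apply: cvgB; [exact: cvg_cst|exact: cvg_step].
    under eq_fun do rewrite expr2.
    by have := @cvgM _ _ _ _ _ _ _ _ h h; rewrite mulr0; apply.
exists (fun x => (step n (y x))%:C%C); split => //.
- exact/cbdd_l2/cbdd_trigpoly.
- exact: trigpoly_approx.
Qed.

Lemma approx_set_measurable (B : set (Rn R N)) : measurable B -> approx_set B.
Proof.
have sg : sigma_algebra setT (approx_set : set (set (Rn R N))).
  split; first exact: approx_set0.
  - by move=> A gA; rewrite setTD; exact: approx_setC.
  - exact: approx_set_bigcup.
move=> mB; have : (<<s \big[setU/set0]_(i < N)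
    preimage_set_system setT ((fun x : Rn R N => tnth x i)) (@measurable _ (measurableTypeR R)) >>) B.
  exact: mB.
apply: smallest_sub => // {mB}B; rewrite -bigcup_seq => -[i _] [C mC <-].
rewrite setTI.
have sg' : sigma_algebra setT [set C : set R | approx_set ((fun x : Rn R N => tnth x i) @^-1` C)].
  split => /=; first by rewrite preimage_set0; exact: approx_set0.
  - by move=> D gD; rewrite setTD preimage_setC; exact: approx_setC.
  - by move=> D gD; rewrite preimage_bigcup; exact: approx_set_bigcup.
have : (@RGenOInfty.G R).-sigma.-measurable C by rewrite -RGenOInfty.measurableE.
apply: (@smallest_sub _ _ _ [set C : set R | approx_set ((fun x : Rn R N => tnth x i) @^-1` C)]) => //.
move=> _ [b ->] /=.
rewrite (_ : _ @^-1` _ = [set x : Rn R N | b < tnth x i]); first exact: approx_set_halfspace.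
by apply/seteqP; split => x /=; rewrite in_itv/= andbT.
Qed.

End density.

(** * Completeness and Parseval's identity *)

Section l2_density.
Context {R : realType} (N : nat).
Notation mu := (@lebesgueRn R N).
Notation T := (@torus R N).
Notation E := (@tint R N).
Notation Ec := (@Ec R N).
Import HBNNSimple.

Lemma approx_simple (h : {nnsfun Rn R N >-> R}) : approx (fun x => (h x)%:C%C).
Proof.
have hy (y : R) : l2 (fun x => y%:C%C * ind (h @^-1` [set y]) x) /\
    approx (fun x => y%:C%C * ind (h @^-1` [set y]) x).
  have mh : measurable (h @^-1` [set y]) by exact: measurable_funPTI.
  split; first by apply: l2M; [exact: cbdd_cst|exact/cbdd_l2/cbdd_ind].
  by apply: approxZ; [exact/cbdd_l2/cbdd_ind|have [] := approx_set_measurable mh].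
have [_ ah] := approx_sum (finmap.enum_fset (fset_set (range h))) hy.
apply: eq_approx ah => x _ /=.
by rewrite [in RHS]fimfunE fsbig_finite//= rmorph_sum/=; apply: eq_bigr => y _; rewrite /ind rmorphM.
Qed.

Lemma approx_nneg (f : Rn R N -> R) : (forall x, T x -> 0 <= f x) -> measurable_fun T f ->
  ib (fun x => f x ^+ 2) -> l2 (fun x => (f x)%:C%C) /\ approx (fun x => (f x)%:C%C).
Proof.
move=> f0 mf sf.
have mT : measurable T by exact: measurable_torus.
have lf : l2 (fun x => (f x)%:C%C).
  apply: l2P => //=.
  by under [X in ib X]funext do rewrite sqC.
split=> //; apply: approx_lim => // e e0.
have mf' : measurable_fun T (EFin \o f) by exact/measurable_EFinP.
pose g := nnsfun_approx mT mf'.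
have gf n x : T x -> 0 <= g n x <= f x.
  move=> Tx; rewrite fun_ge0/= /g nnsfun_approxE -lee_fin.
  by apply: le_approx => // y Ty; rewrite lee_fin f0.
have lg n : l2 (fun x => (g n x)%:C%C).
  have mg : measurable_fun T (g n) by apply: measurable_funTS; exact: measurable_funP.
  apply: l2P => //=.
  under [X in ib X]funext do rewrite sqC.
  apply: ib_le sf; first exact: measurable_funX.
  move=> x Tx; have /andP[g0 g1] := gf n x Tx.
  by rewrite ger0_norm ?sqr_ge0// ler_pXn2r// nnegrE f0.
have [n hn] : exists n, E (fun x => sq ((f x)%:C%C - (g n x)%:C%C)) <= e.
  apply: (@E_dct R N (fun n x => sq ((f x)%:C%C - (g n x)%:C%C)) (fun x => f x ^+ 2)) => //.
  - by move=> n; have [_ /ib_meas] := l2B lf (lg n).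
  - move=> n x Tx; rewrite ger0_norm ?sq_ge0// -rmorphB/= sqC.
    have /andP[g0 g1] := gf n x Tx.
    by rewrite ler_pXn2r// ?nnegrE ?subr_ge0 ?f0// gerBl.
  - move=> x Tx.
    have h : (fun n => f x - g n x) @ \oo --> (0 : R).
      rewrite -[X in _ --> X](subrr (f x)); apply: cvgB; first exact: cvg_cst.
      have f0' y : T y -> (0 <= (EFin \o f) y)%E by move=> Ty; rewrite lee_fin f0.
      by have /fine_cvg := cvg_nnsfun_approx mT mf' f0' Tx.
    under eq_fun do rewrite -rmorphB/= sqC expr2.
    by have := @cvgM _ _ _ _ _ _ _ _ h h; rewrite mulr0; apply.
exists (fun x => (g n x)%:C%C); split => //; exact: approx_simple.
Qed.

Lemma l2_approx (F : Rn R N -> R[i]) : l2 F -> approx F.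
Proof.
move=> lF; have [_ sF] := lF; have [mR mI] := l2_meas lF.
have key (f : Rn R N -> R) : measurable_fun T f -> ib (fun x => f x ^+ 2) ->
    l2 (fun x => (f x)%:C%C) /\ approx (fun x => (f x)%:C%C).
  move=> mf sf.
  have sp : ib (fun x => f^\+ x ^+ 2).
    apply: ib_le sf; first by apply: measurable_funX; exact: measurable_funrpos.
    move=> x _; rewrite ger0_norm ?sqr_ge0// /funrpos; case: (leP 0 (f x)) => h.
      by [].
    by rewrite expr0n/= sqr_ge0.
  have sn : ib (fun x => f^\- x ^+ 2).
    apply: ib_le sf; first by apply: measurable_funX; exact: measurable_funrneg.
    move=> x _; rewrite ger0_norm ?sqr_ge0// /funrneg; case: (leP 0 (- f x)) => h.
      by rewrite sqrrN.
    by rewrite expr0n/= sqr_ge0.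
  have [lp ap] := approx_nneg (fun x _ => funrpos_ge0 f x) (measurable_funrpos mf) sp.
  have [ln an] := approx_nneg (fun x _ => funrneg_ge0 f x) (measurable_funrneg mf) sn.
  have ln' := l2M (@cbdd_cst R N (-1)) ln.
  have an' := approxZ (-1) ln an.
  have fE x : (f^\+ x)%:C%C + -1 * (f^\- x)%:C%C = (f x)%:C%C :> R[i].
    by rewrite mulN1r -rmorphB/=; congr (_%:C%C); exact: (congr1 (fun g => g x) (funrposBneg f)).
  have := l2D lp ln'; have := approxD lp ln' ap an'.
  by under [X in approx X -> _]funext do rewrite fE; under [X in _ -> l2 X -> _]funext do rewrite fE.
have [|l1 a1] := key _ mR.
  apply: ib_le sF; first exact: measurable_funX.
  by move=> x _; rewrite ger0_norm ?sqr_ge0// lerDl sqr_ge0.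
have [|l2' a2] := key _ mI.
  apply: ib_le sF; first exact: measurable_funX.
  by move=> x _; rewrite ger0_norm ?sqr_ge0// lerDr sqr_ge0.
have := approxD l1 (l2M (@cbdd_cst R N (0 +i* 1)%C) l2') a1 (approxZ (0 +i* 1)%C l2' a2).
apply: eq_approx => x _; by apply: ceq; rewrite ?(ReD, ImD, ReM, ImM) /=; ring.
Qed.

Definition hat (F : Rn R N -> R[i]) n : R[i] := fc F n * ((@vol R N)^-1)%:C%C.

(** A trigonometric polynomial close to F is beaten by the Fourier sum over
    every larger set of frequencies. *)
Lemma parseval (F : Rn R N -> R[i]) : l2 F -> forall e : R, 0 < e ->
  exists2 s0 : seq (N.-tuple int), uniq s0 &
  forall s, uniq s -> {subset s0 <= s} -> E (fun x => sq (F x - trig s (hat F) x)) <= e.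
Proof.
move=> lF e e0; have [_ [s [c [us ->]]] h] := l2_approx lF e0; exists s => // s' us' ss'.
have [iF sF] := lF.
exact: (le_trans (best_approx c iF sF us us' ss')).
Qed.

Lemma parseval_sum (F : Rn R N -> R[i]) s : l2 F -> uniq s ->
  E (fun x => sq (F x - trig s (hat F) x)) =
  E (fun x => sq (F x)) - vol N * \sum_(n <- s) sq (hat F n).
Proof.
move=> [iF sF] us; rewrite trig_distance//.
rewrite [X in _ + vol N * X]big1 ?mulr0 ?addr0; last by move=> n _; rewrite subrr sq0.
congr (_ - _); rewrite !mulr_sumr; apply: eq_bigr => n _.
have v0 : vol N != 0 :> R by rewrite gt_eqF// vol_gt0.
by rewrite /hat sqM sqC; field.
Qed.

End l2_density.
Arguments hat {R N}.

(** * Counting and regrouping *)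

Section counting.

Lemma size_le2 (T : eqType) (s : seq T) : uniq s ->
  (forall x y z, x \in s -> y \in s -> z \in s -> [|| x == y, y == z | x == z]) -> (size s <= 2)%N.
Proof.
case: s => [|a [|b [|e s]]]//= /and4P[ha hb _ _] h.
have := h a b e; rewrite !inE !eqxx !orbT => /(_ isT isT isT).
move: ha hb; rewrite !inE !negb_or => /and3P[/negbTE -> /negbTE -> _] /andP[/negbTE -> _].
by [].
Qed.

Lemma sum_fibers (R : realDomainType) (S T : eqType) (P : seq S) (f : S -> T) (g : T -> R) (k : nat) :
  (forall t, 0 <= g t) -> (forall t, (size [seq p <- P | f p == t] <= k)%N) ->
  \sum_(p <- P) g (f p) <= k%:R * \sum_(t <- undup (map f P)) g t.
Proof.
move=> g0 hk; rewrite -(big_map f xpredT) -big_undup_iterop_count mulr_sumr.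
apply: ler_sum => t _.
have -> : iterop (count_mem t [seq f p | p <- P]) +%R (g t) 0 = g t *+ count_mem t [seq f p | p <- P] by [].
rewrite -[leLHS]mulr_natl; apply: ler_wpM2r => //; rewrite ler_nat count_map -size_filter.
exact: hk.
Qed.

Lemma sum_keys (R : realDomainType) (S K : eqType) (X : seq S) (key : S -> K) (F : S -> R) :
  \sum_(n <- X) F n = \sum_(k <- undup (map key X)) \sum_(n <- X | key n == k) F n.
Proof.
rewrite (exchange_big_dep xpredT)//; apply: eq_big_seq => n nX.
rewrite -big_filter (_ : [seq _ <- _ | _] = [:: key n]) ?big_seq1//.
apply: perm_small_eq => //; apply: uniq_perm; rewrite ?filter_uniq ?undup_uniq// => k.
rewrite mem_filter mem_undup mem_seq1 (eq_sym k); case: (eqVneq (key n) k) => [<-|_]; last by rewrite andbF.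
by rewrite map_f.
Qed.

(** The three points lie on the line orthogonal to (p, q) fixed by the common
    difference, and on one circle about the origin. *)
Lemma line_circle (p q x y x' y' x'' y'' : int) : (p != 0) || (q != 0) ->
  p * (2 * x + p) + q * (2 * y + q) = 0 ->
  p * (2 * x' + p) + q * (2 * y' + q) = 0 ->
  p * (2 * x'' + p) + q * (2 * y'' + q) = 0 ->
  x ^+ 2 + y ^+ 2 = x' ^+ 2 + y' ^+ 2 -> x ^+ 2 + y ^+ 2 = x'' ^+ 2 + y'' ^+ 2 ->
  [\/ (x = x' /\ y = y'), (x' = x'' /\ y' = y'') | (x = x'' /\ y = y'')].
Proof.
move=> pq e e' e'' c' c''.
(* differences from the first point are orthogonal to (p, q) *)
pose a := x' - x; pose b := y' - y; pose a' := x'' - x; pose b' := y'' - y.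
have o : p * a + q * b = 0 by rewrite /a /b; lra.
have o' : p * a' + q * b' = 0 by rewrite /a' /b'; lra.
have k : 2 * (x * a + y * b) + a ^+ 2 + b ^+ 2 = 0 by rewrite /a /b; lra.
have k' : 2 * (x * a' + y * b') + a' ^+ 2 + b' ^+ 2 = 0 by rewrite /a' /b'; lra.
have cr : a * b' = a' * b.
  apply/eqP; rewrite -subr_eq0; apply/eqP.
  have h1 : p * (a * b' - a' * b) = 0.
    have -> : p * (a * b' - a' * b) = b' * (p * a + q * b) - b * (p * a' + q * b') by ring.
    by rewrite o o' !mulr0 subrr.
  have h2 : q * (a * b' - a' * b) = 0.
    have -> : q * (a * b' - a' * b) = a * (p * a' + q * b') - a' * (p * a + q * b) by ring.
    by rewrite o o' !mulr0 subrr.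
  by move/eqP: h1; move/eqP: h2; rewrite !mulf_eq0; case/orP: pq => /negbTE -> /=; [move=> _ /eqP|move=> /eqP].
have [ab0|ab] := eqVneq (a ^+ 2 + b ^+ 2) 0.
  constructor 1; move/eqP: ab0; rewrite paddr_eq0 ?sqr_ge0// !sqrf_eq0 /a /b !subr_eq0.
  by move=> /andP[/eqP -> /eqP ->].
have [ab'0|ab'] := eqVneq (a' ^+ 2 + b' ^+ 2) 0.
  constructor 3; move/eqP: ab'0; rewrite paddr_eq0 ?sqr_ge0// !sqrf_eq0 /a' /b' !subr_eq0.
  by move=> /andP[/eqP -> /eqP ->].
have n2 : a' * (a ^+ 2 + b ^+ 2) = a * (a' ^+ 2 + b' ^+ 2).
  have h : 2 * y * (a * b' - a' * b) + a * (a' ^+ 2 + b' ^+ 2) - a' * (a ^+ 2 + b ^+ 2) =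
    a * (2 * (x * a' + y * b') + a' ^+ 2 + b' ^+ 2) - a' * (2 * (x * a + y * b) + a ^+ 2 + b ^+ 2) by ring.
  by move: h; rewrite k k' cr subrr !mulr0 add0r subrr => /eqP; rewrite subr_eq0 => /eqP ->.
have n3 : b' * (a ^+ 2 + b ^+ 2) = b * (a' ^+ 2 + b' ^+ 2).
  have h : 2 * x * (a' * b - a * b') + b * (a' ^+ 2 + b' ^+ 2) - b' * (a ^+ 2 + b ^+ 2) =
    b * (2 * (x * a' + y * b') + a' ^+ 2 + b' ^+ 2) - b' * (2 * (x * a + y * b) + a ^+ 2 + b ^+ 2) by ring.
  by move: h; rewrite k k' cr subrr !mulr0 add0r subrr => /eqP; rewrite subr_eq0 => /eqP ->.
(* (a', b') = t (a, b) with t^2 = t *)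
have n4 : (a' ^+ 2 + b' ^+ 2) * (a ^+ 2 + b ^+ 2) ^+ 2 = (a ^+ 2 + b ^+ 2) * (a' ^+ 2 + b' ^+ 2) ^+ 2.
  have -> : (a' ^+ 2 + b' ^+ 2) * (a ^+ 2 + b ^+ 2) ^+ 2 =
    (a' * (a ^+ 2 + b ^+ 2)) ^+ 2 + (b' * (a ^+ 2 + b ^+ 2)) ^+ 2 by ring.
  rewrite n2 n3; ring.
have n5 : a ^+ 2 + b ^+ 2 = a' ^+ 2 + b' ^+ 2.
  apply: (mulfI (mulf_neq0 ab ab')); rewrite -[RHS]mulrA -[X in _ = _ * X]expr2 -n4; ring.
constructor 2; split.
  have : a' = a by apply: (mulIf ab); rewrite n2 n5.
  rewrite /a' /a; lra.
have : b' = b by apply: (mulIf ab); rewrite n3 n5.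
rewrite /b' /b; lra.
Qed.

End counting.

(** * Space-time frequencies and small blocks *)

Section space_time_frequencies.
Context {d : nat}.
Implicit Types (n m : d.-tuple int) (s : bool).

Definition isqn n : int := \sum_(l < d) tnth n l ^+ 2.

(** The sign s = true belongs to the forward flow, whose time frequency is -
    |n|^2 up to the common phase. *)
Definition lam s n : d.+1.-tuple int :=
  [tuple of (if s then - isqn n else isqn n) :: n].

Lemma lam0 s n : tnth (lam s n) ord0 = if s then - isqn n else isqn n.
Proof. by []. Qed.

Lemma lamS s n l : tnth (lam s n) (lift ord0 l) = tnth n l.
Proof. by rewrite tnthS. Qed.

Lemma lam_inj s : injective (lam s).
Proof.
move=> n m h; apply: eq_from_tnth => l.
by rewrite -(lamS s) h lamS.
Qed.

(** What counting needs of a block: its frequencies have at most one free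
    space coordinate, or two of them while |n|^2 is fixed. *)
Definition small_block (alpha : {set 'I_d.+1}) :=
  (exists a, forall l, lift ord0 l \in alpha -> l = a) \/
  (ord0 \notin alpha /\ exists a b, a != b /\ forall l, lift ord0 l \in alpha -> l = a \/ l = b).

Lemma card_small_block (alpha : {set 'I_d.+1}) : (0 < d)%N -> (#|alpha| <= 2)%N -> small_block alpha.
Proof.
move=> d0 a2.
pose A : {set 'I_d} := [set l : 'I_d | lift ord0 l \in alpha]%SET.
have AE l : (lift ord0 l \in alpha) = (l \in A) by rewrite inE.
have cA : (#|A| + (ord0 \in alpha) <= #|alpha|)%N.
  rewrite (cardsD1 ord0 alpha) addnC leq_add2l.
  rewrite -(card_imset _ (@lift_inj d.+1 ord0)); apply: subset_leq_card.
  by apply/fintype.subsetP => _ /imsetP[l lA ->]; rewrite finset.in_setD1 AE lA eq_sym neq_lift.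
have [A0|[a aA]] := set_0Vmem A.
  by left; exists (Ordinal d0) => l; rewrite AE A0 inE.
have [A1|[b]] := set_0Vmem (A :\ a)%SET.
  left; exists a => l; rewrite AE => lA.
  by apply/eqP; move/finset.setP/(_ l): A1; rewrite finset.in_setD1 finset.in_set0 lA andbT => /negbT; rewrite negbK.
rewrite finset.in_setD1 => /andP[ba bA].
have cA2 : (2 <= #|A|)%N.
  have := @subset_leq_card _ [set a; b]%SET A; rewrite cards2 eq_sym ba; apply.
  by apply/fintype.subsetP => l; rewrite finset.in_set2 => /orP[/eqP ->|/eqP ->].
right; split.
  apply/negP => h; move: cA; rewrite h addn1 => h1; have := leq_trans h1 a2; by rewrite ltnS leqNgt cA2.
exists a, b; split; first by rewrite eq_sym.
move=> l; rewrite AE => lA.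
have cAe : #|A| = 2.
  apply/eqP; rewrite eqn_leq cA2 andbT; apply: leq_trans a2.
  by apply: leq_trans cA; exact: leq_addr.
have [->|la] := eqVneq l a; first by left.
have [->|lb] := eqVneq l b; first by right.
have : (3 <= #|A|)%N.
  have sub : [set l; a; b]%SET \subset A.
    by apply/fintype.subsetP => k; rewrite !finset.in_setU !finset.in_set1 => /orP[/orP[|]|] /eqP ->.
  have := subset_leq_card sub; by rewrite -finset.setUA cardsU1 finset.in_set2 (negbTE la) (negbTE lb) cards2 eq_sym ba.
by rewrite cAe.
Qed.

(** Frequency of a wave off the block alpha: a weight that depends on alpha
    alone couples only waves with equal keys. *)
Definition key s (alpha : {set 'I_d.+1}) n : d.+1.-tuple int :=
  [tuple if l \in alpha then 0 else tnth (lam s n) l | l < d.+1].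

Lemma keyP s alpha n m : key s alpha n = key s alpha m ->
  forall l, l \notin alpha -> tnth (lam s n) l = tnth (lam s m) l.
Proof.
by move=> h l la; have := congr1 (fun t => tnth t l) h; rewrite !tnth_mktuple (negbTE la).
Qed.

Lemma key_space s alpha n m : key s alpha n = key s alpha m ->
  forall l, lift ord0 l \notin alpha -> tnth n l = tnth m l.
Proof. by move=> /keyP h l /h; rewrite !lamS. Qed.

Lemma key_time s alpha n m : key s alpha n = key s alpha m -> ord0 \notin alpha -> isqn n = isqn m.
Proof.
move=> /keyP h /h; rewrite !lam0; case: s {h} => // /eqP.
by rewrite eqr_opp => /eqP.
Qed.

Lemma lam_diff s n m n' m' : tsub (lam s n) (lam s m) = tsub (lam s n') (lam s m') ->
  isqn n - isqn m = isqn n' - isqn m' /\ forall l, tnth n l - tnth m l = tnth n' l - tnth m' l.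
Proof.
move=> h; split.
  have := congr1 (fun t => tnth t ord0) h; rewrite !tnth_mktuple !lam0.
  by case: s {h}; lra.
by move=> l; have := congr1 (fun t => tnth t (lift ord0 l)) h; rewrite !tnth_mktuple !lamS.
Qed.

Lemma isqn_diff1 n m a : (forall l, l != a -> tnth n l = tnth m l) ->
  isqn n - isqn m = tnth n a ^+ 2 - tnth m a ^+ 2.
Proof.
move=> h; rewrite /isqn -sumrB (bigD1 a)//= big1 ?addr0// => l /h ->.
by rewrite subrr.
Qed.

Lemma isqn_diff2 n m a b : a != b -> (forall l, l != a -> l != b -> tnth n l = tnth m l) ->
  isqn n - isqn m = tnth n a ^+ 2 - tnth m a ^+ 2 + (tnth n b ^+ 2 - tnth m b ^+ 2).
Proof.
move=> ab h; rewrite /isqn -sumrB (bigD1 a)//= (bigD1 b)/=; last by rewrite eq_sym.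
rewrite big1 ?addr0// => l /andP[la lb]; by rewrite h// subrr.
Qed.

(** Among frequencies with one key, a given difference fixes a line; if two
    space coordinates are free then time is not, and |n|^2 fixes a circle; if
    only one is free, the difference of the squares determines the pair. *)
Lemma fiber_count s alpha (P : seq (d.-tuple int * d.-tuple int)) K kappa :
  small_block alpha -> uniq P ->
  (forall p, p \in P -> [/\ p.1 != p.2, key s alpha p.1 = K & key s alpha p.2 = K]) ->
  (size [seq p <- P | tsub (lam s p.1) (lam s p.2) == kappa] <= 2)%N.
Proof.
move=> sa uP hP; apply: size_le2; first by rewrite filter_uniq.
move=> [n m] [n' m'] [n'' m'']; rewrite !mem_filter /=.
move=> /andP[/eqP k0 /hP[/= nm Kn Km]] /andP[/eqP k1 /hP[/= nm' Kn' Km']] /andP[/eqP k2 /hP[/= nm'' Kn'' Km'']].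
have e1 := lam_diff (etrans k0 (esym k1)); have e2 := lam_diff (etrans k0 (esym k2)).
have recover n1 m1 n2 m2 : (forall l, tnth n1 l - tnth m1 l = tnth n2 l - tnth m2 l) -> m1 = m2 ->
    (n1, m1) == (n2, m2).
  move=> h mm; rewrite mm in h *; rewrite xpair_eqE eqxx andbT; apply/eqP/eq_from_tnth => l.
  by have /addIr := h l.
case: sa => [[a ha]|[h0 [a [b [ab hb]]]]].
  have off n1 n2 : key s alpha n1 = K -> key s alpha n2 = K -> forall l, l != a -> tnth n1 l = tnth n2 l.
    move=> h1 h2 l la; apply: (key_space (etrans h1 (esym h2))).
    by apply/negP => /ha /eqP; rewrite (negbTE la).
  have [e1a e1b] := e1.
  have D0 : tnth n a - tnth m a != 0.
    rewrite subr_eq0; apply: contra nm => /eqP na; apply/eqP/eq_from_tnth => l.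
    by have [->//|la] := eqVneq l a; exact: off.
  rewrite (isqn_diff1 (off _ _ Kn Km)) (isqn_diff1 (off _ _ Kn' Km')) !subr_sqr -(e1b a) in e1a.
  have s1 := mulfI D0 e1a; have s2 := e1b a.
  have ma : tnth m a = tnth m' a by lra.
  rewrite (recover _ _ _ _ e1b)//; apply: eq_from_tnth => l.
  by have [->//|la] := eqVneq l a; exact: off.
have off n1 n2 : key s alpha n1 = K -> key s alpha n2 = K -> forall l, l != a -> l != b -> tnth n1 l = tnth n2 l.
  move=> h1 h2 l la lb; apply: (key_space (etrans h1 (esym h2))).
  by apply/negP => /hb[] /eqP; rewrite ?(negbTE la) ?(negbTE lb).
have sqe n1 n2 : key s alpha n1 = K -> key s alpha n2 = K ->
    tnth n1 a ^+ 2 - tnth n2 a ^+ 2 + (tnth n1 b ^+ 2 - tnth n2 b ^+ 2) = 0.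
  move=> h1 h2; rewrite -(isqn_diff2 ab (off _ _ h1 h2)).
  by rewrite (key_time (etrans h1 (esym h2)) h0) subrr.
have same n1 n2 : key s alpha n1 = K -> key s alpha n2 = K -> tnth n1 a = tnth n2 a -> tnth n1 b = tnth n2 b -> n1 = n2.
  move=> h1 h2 ea eb; apply: eq_from_tnth => l.
  by have [->//|la] := eqVneq l a; have [->//|lb] := eqVneq l b; exact: off.
have [_ e1b] := e1; have [_ e2b] := e2.
pose p := tnth n a - tnth m a; pose q := tnth n b - tnth m b.
have D0 : (p != 0) || (q != 0).
  rewrite -negb_and; apply: contra nm => /andP[]; rewrite /p /q !subr_eq0 => /eqP pa /eqP pb.
  by apply/eqP/same.
have line n1 m1 : key s alpha n1 = K -> key s alpha m1 = K ->
    p = tnth n1 a - tnth m1 a -> q = tnth n1 b - tnth m1 b ->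
    p * (2 * tnth m1 a + p) + q * (2 * tnth m1 b + q) = 0.
  by move=> h1 h2 -> ->; rewrite -(sqe _ _ h1 h2); ring.
have c1 := sqe _ _ Km Km'; have c2 := sqe _ _ Km Km''.
case: (line_circle D0 (line _ _ Kn Km erefl erefl) (line _ _ Kn' Km' (e1b a) (e1b b))
  (line _ _ Kn'' Km'' (e2b a) (e2b b))).
- lra.
- lra.
- by move=> [ea eb]; rewrite (recover _ _ _ _ e1b)//; exact: same.
- move=> [ea eb]; rewrite (recover n' m' n'' m'') ?orbT//; last exact: same.
  by move=> l; rewrite -e1b -e2b.
- by move=> [ea eb]; rewrite (recover _ _ _ _ e2b) ?orbT//; exact: same.
Qed.

End space_time_frequencies.

(** * Weights that depend on a small block *)

(** Cauchy-Schwarz for the double sum, in the form x y <= t x^2 / 2 + y^2 / (2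
    t) with t = h / sum a^2. *)
Lemma class_bound (R : realFieldType) (S : eqType) (Y : seq S) (a : S -> R) (b : S -> S -> R) (h : R) :
  0 < h -> (forall n, 0 <= a n) ->
  \sum_(n <- Y) \sum_(m <- Y | n != m) b n m ^+ 2 <= 2 * h ^+ 2 ->
  \sum_(n <- Y) \sum_(m <- Y | n != m) a n * a m * b n m <= 2 * h * \sum_(n <- Y) a n ^+ 2.
Proof.
move=> h0 a0 hb; set A := \sum_(n <- Y) a n ^+ 2.
have A0 : 0 <= A by apply: sumr_ge0 => n _; exact: sqr_ge0.
have [Az|An] := eqVneq A 0.
  have az n : n \in Y -> a n = 0.
    move=> nY; move: Az; rewrite /A => /eqP; rewrite psumr_eq0; last by move=> ? _; exact: sqr_ge0.
    by move=> /allP/(_ _ nY)/=; rewrite sqrf_eq0 => /eqP.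
  rewrite Az mulr0 big_seq big1// => n nY; rewrite big1// => m _.
  by rewrite az// !mul0r.
have Ap : 0 < A by rewrite lt_neqAle eq_sym An.
pose t := h / A; have t0 : 0 < t by rewrite divr_gt0.
apply: (@le_trans _ _ (\sum_(n <- Y) \sum_(m <- Y | n != m)
    (t / 2 * (a n ^+ 2 * a m ^+ 2) + (2 * t)^-1 * b n m ^+ 2))).
  apply: ler_sum => n _; apply: ler_sum => m _.
  rewrite -subr_ge0.
  have -> : t / 2 * (a n ^+ 2 * a m ^+ 2) + (2 * t)^-1 * b n m ^+ 2 - a n * a m * b n m =
     (2 * t)^-1 * (t * (a n * a m) - b n m) ^+ 2 by field; rewrite gt_eqF.
  by rewrite mulr_ge0 ?sqr_ge0// invr_ge0 mulr_ge0 ?ltW.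
under eq_bigr do rewrite big_split/= -!mulr_sumr.
rewrite big_split/= -!mulr_sumr.
have h1 : \sum_(n <- Y) a n ^+ 2 * \sum_(m <- Y | n != m) a m ^+ 2 <= A * A.
  rewrite {1}/A mulr_suml; apply: ler_sum => n _; apply: ler_wpM2l; first exact: sqr_ge0.
  rewrite /A [leRHS](bigID (fun m => n != m))/= lerDl; apply: sumr_ge0 => m _; exact: sqr_ge0.
have e1 : t / 2 * \sum_(n <- Y) a n ^+ 2 * \sum_(m <- Y | n != m) a m ^+ 2 <= h * A / 2.
  have -> : h * A / 2 = t / 2 * (A * A) by rewrite /t; field.
  by rewrite ler_wpM2l// divr_ge0// ltW.
have e2 : (2 * t)^-1 * \sum_(n <- Y) \sum_(m <- Y | n != m) b n m ^+ 2 <= h * A.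
  have -> : h * A = (2 * t)^-1 * (2 * h ^+ 2) by rewrite /t; field; rewrite An gt_eqF.
  by rewrite ler_wpM2l// invr_ge0 mulr_ge0// ltW.
have : 0 <= h * A by rewrite mulr_ge0// ltW.
lra.
Qed.

Section small_weights.
Context {R : realType} (d : nat).
Notation N := d.+1.
Notation T := (@torus R N).
Notation E := (@tint R N).
Notation Ec := (@Ec R N).
Implicit Types (n m : d.-tuple int) (s : bool) (X : seq (d.-tuple int)) (f : d.-tuple int -> R[i]).

(** Packet of waves of sign s, without the common phase exp (+- i c t). *)
Definition packet s X f (z : Rn R N) : R[i] := \sum_(n <- X) f n * ewave (lam s n) z.

Lemma cbdd_packet s X f : cbdd (packet s X f).
Proof. by apply: cbdd_sum => n; apply: cbddM; [exact: cbdd_cst|exact: cbdd_ewave]. Qed.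

Lemma form_expand s X f (H : Rn R N -> R[i]) : cbdd H ->
  Ec (fun z => H z * (sq (packet s X f z))%:C%C) =
  \sum_(n <- X) \sum_(m <- X) (f n)^*%C * f m * fc H (tsub (lam s n) (lam s m)).
Proof.
move=> bH.
have b1 n m : cbdd (fun z => H z * (ewave (tsub (lam s n) (lam s m)) z)^*%C).
  by apply: cbddM => //; apply/cbddJ/cbdd_ewave.
transitivity (Ec (fun z => \sum_(n <- X) \sum_(m <- X) (f n)^*%C * f m * (H z * (ewave (tsub (lam s n) (lam s m)) z)^*%C))).
  apply: eq_Ec => z _; rewrite -mulJE mulrC [_ * _^*%C]mulrC {1}/packet conjc_sum !mulr_suml.
  apply: eq_bigr => n _; rewrite /packet mulr_sumr mulr_suml; apply: eq_bigr => m _.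
  by rewrite ewave_sub !conjcM conjcK; ring.
rewrite Ecsum; last by move=> n; apply/cbdd_cib/cbdd_sum => m; apply: cbddM => //; exact: cbdd_cst.
apply: eq_bigr => n _; rewrite Ecsum; last by move=> m; apply/cbdd_cib/cbddM => //; exact: cbdd_cst.
by apply: eq_bigr => m _; rewrite EcZ//; exact: cbdd_cib.
Qed.

Lemma fc_conj_sub (H : Rn R N -> R[i]) (k1 k2 : N.-tuple int) (l : 'I_N) :
  cib H -> indep l H -> tnth k1 l != tnth k2 l -> fc H (tsub k1 k2) = 0.
Proof.
move=> iH dH kl; rewrite /fc.
have -> : Ec (fun z => H z * (ewave (tsub k1 k2) z)^*%C) = Ec (fun z => H z * ewave (tsub k2 k1) z).
  by apply: eq_Ec => z _; rewrite !ewave_sub conjcM conjcK [X in _ * X]mulrC.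
by apply: (Ec_indep iH dH); rewrite tnth_mktuple subr_eq0 eq_sym.
Qed.

(** The form of H splits over the keys. Inside a key the diagonal is the mean
    of H, and off the diagonal each Fourier coefficient of H occurs at most
    twice, so that Bessel's inequality bounds the form. *)
Lemma small_weight s X f (alpha : {set 'I_d.+1}) (H : Rn R N -> R) (h : R) :
  small_block alpha -> uniq X -> bdd H ->
  (forall l, l \notin alpha -> indep l (fun z => (H z)%:C%C)) ->
  0 < h -> vol N * E (fun z => H z ^+ 2) <= h ^+ 2 ->
  E (fun z => H z * sq (packet s X f z)) <= 3 * h * \sum_(n <- X) sq (f n).
Proof.
move=> sa uX bH dH h0 hh.
pose Hc z : R[i] := (H z)%:C%C.
have bHc : cbdd Hc by exact: cbddC.
have sqHc : E (fun z => sq (Hc z)) = E (fun z => H z ^+ 2) by apply: eqE_ => z _; rewrite sqC.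
have bes (t : seq (N.-tuple int)) : uniq t -> \sum_(k <- t) sq (fc Hc k) <= h ^+ 2.
  move=> ut; apply: (le_trans (bessel (cbdd_cib bHc) (bdd_ib (bdd_sq bHc)) ut)).
  by rewrite sqHc.
pose b n m := nr (fc Hc (tsub (lam s n) (lam s m))).
have -> : E (fun z => H z * sq (packet s X f z)) = Re (Ec (fun z => Hc z * (sq (packet s X f z))%:C%C)).
  by apply: eqE_ => z _; rewrite ReM !ReC !ImC mul0r subr0.
rewrite form_expand// Re_sum.
apply: (@le_trans _ _ (\sum_(n <- X) (h * sq (f n) + \sum_(m <- X | n != m) nr (f n) * nr (f m) * b n m))).
  rewrite big_seq [leRHS]big_seq; apply: ler_sum => n nX.
  rewrite Re_sum (bigD1_seq n)//=; apply: lerD.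
    have -> : (f n)^*%C * f n = (sq (f n))%:C%C by rewrite mulrC mulJE.
    rewrite ReM ReC ImC mul0r subr0 mulrC ler_wpM2r ?sq_ge0//.
    apply: (le_trans (ler_norm _)); apply: (le_trans (nr_Re _)).
    rewrite -(@ler_pXn2r _ 2)// ?nnegrE ?nr_ge0 ?(ltW h0)// -sqE.
    have := bes [:: tsub (lam s n) (lam s n)] isT; by rewrite big_seq1.
  rewrite [leRHS](eq_bigl (fun m => m != n)); last by move=> m; rewrite eq_sym.
  apply: ler_sum => m _; apply: (le_trans (ler_norm _)); apply: (le_trans (nr_Re _)).
  by rewrite !nrM nrJ.
rewrite big_split/= -mulr_sumr.
suff : \sum_(n <- X) \sum_(m <- X | n != m) nr (f n) * nr (f m) * b n m <= 2 * h * \sum_(n <- X) sq (f n) by lra.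
pose ky := key s alpha.
have bz n m : ky n != ky m -> b n m = 0.
  move=> knm; have [l [la nl]] : exists l, l \notin alpha /\ tnth (lam s n) l != tnth (lam s m) l.
    apply/not_existsP => hl; move/negP: knm; apply; apply/eqP/eq_from_tnth => l.
    rewrite !tnth_mktuple; case: ifPn => // la; apply/eqP/negPn/negP => nl.
    by apply: (hl l).
  by rewrite /b (fc_conj_sub (cbdd_cib bHc) (dH l la) nl) nr0.
rewrite (sum_keys X ky) [X in _ <= _ * X](sum_keys X ky) mulr_sumr.
apply: ler_sum => K _.
rewrite -!(big_filter X (fun n => ky n == K)); set Y := [seq n <- X | _].
have uY : uniq Y by rewrite filter_uniq.
have -> : \sum_(n <- Y) \sum_(m <- X | n != m) nr (f n) * nr (f m) * b n m =
    \sum_(n <- Y) \sum_(m <- Y | n != m) nr (f n) * nr (f m) * b n m.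
  apply: eq_big_seq => n; rewrite mem_filter => /andP[/eqP kn _].
  rewrite /Y big_filter_cond [LHS](bigID (fun m => ky m == K))/= [X in _ + X]big1 ?addr0; last first.
    by move=> m /andP[_ km]; rewrite bz ?mulr0// kn eq_sym.
  by apply: eq_bigl => m; rewrite andbC.
under [X in _ <= _ * X]eq_bigr do rewrite sqE.
apply: class_bound => //; first by move=> n; exact: nr_ge0.
pose P := [seq p <- [seq (n, m) | n <- Y, m <- Y] | p.1 != p.2].
have -> : \sum_(n <- Y) \sum_(m <- Y | n != m) b n m ^+ 2 = \sum_(p <- P) sq (fc Hc (tsub (lam s p.1) (lam s p.2))).
  rewrite /P [RHS]big_filter [RHS]big_mkcond [RHS]big_allpairs_dep/=; apply: eq_bigr => n _.
  by rewrite big_mkcond; apply: eq_bigr => m _; rewrite /b -sqE.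
have uP : uniq P by rewrite filter_uniq// allpairs_uniq// => -[? ?] [? ?] _ _ [-> ->].
apply: (le_trans (@sum_fibers R _ _ P (fun p => tsub (lam s p.1) (lam s p.2)) (fun k => sq (fc Hc k)) 2 _ _)).
- by move=> t; exact: sq_ge0.
- move=> t; apply: (@fiber_count _ s alpha P K t sa uP) => -[n m].
  rewrite mem_filter => /andP[/= nm /allpairsP[[n' m']/= [nY mY [e1 e2]]]].
  by move: nY mY; rewrite -e1 -e2 !mem_filter => /andP[/eqP kn _] /andP[/eqP km _].
- by rewrite ler_wpM2l// bes// undup_uniq.
Qed.

End small_weights.

(** * Trigonometric approximation of weights as quadratic forms *)

Section weights.
Context {R : realType} (d : nat).
Notation N := d.+1.
Notation T := (@torus R N).
Notation E := (@tint R N).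
Notation Ec := (@Ec R N).
Implicit Types (n m : d.-tuple int) (s : bool) (X : seq (d.-tuple int)) (f : d.-tuple int -> R[i]).
Implicit Types (W : Rn R N -> R[i]).

(** Closeness of weights has to be uniform over wave packets: in general the
    mean-square distance alone does not control the quadratic forms. *)
Definition form_close W (p : Rn R N -> R[i]) (e : R) := forall s X f, uniq X ->
  E (fun z => nr (W z - p z) * sq (packet s X f z)) <= e * \sum_(n <- X) sq (f n).

Definition trigapprox W := forall e : R, 0 < e -> exists2 p, trigpoly p & form_close W p e.

(** The partial Fourier sums of W depend on alpha only, as W does, so that
    small_weight applies to the error. *)
Lemma block_approx (alpha : {set 'I_d.+1}) W : small_block alpha -> cbdd W ->
  (forall l, l \notin alpha -> indep l W) -> trigapprox W.
Proof.
move=> sa bW dW e e0.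
have v0 := @vol_gt0 R N.
pose h := e / 3; have h0 : 0 < h by rewrite divr_gt0.
have k0 : 0 < h ^+ 2 / vol N by rewrite divr_gt0// exprn_gt0.
have [s0 us0 hs] := parseval (cbdd_l2 bW) k0.
have {}hs := hs s0 us0 (fun x hx => hx).
exists (trig s0 (hat W)); first by exists s0, (hat W).
have bp : cbdd (fun z => W z - trig s0 (hat W) z) by apply: cbddB => //; exact: cbdd_trig.
have dp l : l \notin alpha -> indep l (trig s0 (hat W)).
  move=> la t z ht Tz; rewrite /trig; apply: eq_bigr => k _; rewrite ewave_rot//.
  have [->|kl] := eqVneq (tnth k l) 0; first by rewrite mul0r expi0 mul1r.
  suff -> : hat W k = 0 by rewrite !mul0r.
  rewrite /hat; suff -> : fc W k = 0 by rewrite mul0r.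
  have := @fc_conj_sub R d W k (tzero (N := N)) l (cbdd_cib bW) (dW l la).
  rewrite tnth_mktuple => /(_ kl); rewrite /fc => <-; apply: eq_Ec => x _.
  by rewrite ewave_sub ewave0 conjc1 mulr1.
move=> s X f uX.
have -> : e = 3 * h by rewrite /h; lra.
apply: (@small_weight R d s X f alpha (fun z => nr (W z - trig s0 (hat W) z)) h) => //.
- exact: bdd_nr.
- by move=> l la t z ht Tz; rewrite (dp l la)// (dW l la).
- rewrite mulrC -ler_pdivlMr//; apply: le_trans hs; rewrite le_eqVlt; apply/orP; left.
  by apply/eqP/eqE_ => z _; rewrite sqE.
Qed.

Lemma ib_form W s X f : cbdd W -> ib (fun z => nr (W z) * sq (packet s X f z)).
Proof. by move=> bW; apply/bdd_ib/bddM; [exact: bdd_nr|exact/bdd_sq/cbdd_packet]. Qed.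

Lemma sumsq_ge0 X f : 0 <= \sum_(n <- X) sq (f n).
Proof. by apply: sumr_ge0 => n _; exact: sq_ge0. Qed.

Lemma nr_bound W : cbdd W -> exists2 M : R, 0 < M & forall z, T z -> nr (W z) <= M.
Proof.
move=> /bdd_nr[_ [M MF]]; exists (`|M| + 1); first by rewrite ltr_pwDr.
move=> x Tx; apply: (le_trans (ler_norm _)); apply: (le_trans (MF x Tx)).
by rewrite ler_wpDr// ler_norm.
Qed.

(** Each error is multiplied by a bounded function: the block factor is
    approximated after the sup norm of the first polynomial is known. *)
Lemma trigapproxM (alpha : {set 'I_d.+1}) W1 W2 : small_block alpha -> cbdd W1 ->
  (forall l, l \notin alpha -> indep l W1) -> cbdd W2 -> trigapprox W2 ->
  trigapprox (fun z => W1 z * W2 z).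
Proof.
move=> sa b1 d1 b2 a2 e e0.
have [M1 M10 h1] := nr_bound b1.
have [p2 t2 c2] := a2 (e / 2 / M1) (divr_gt0 (divr_gt0 e0 (ltr0Sn _ 1)) M10).
have [M2 M20 h2] := nr_bound (cbdd_trigpoly t2).
have [p1 t1 c1] := block_approx sa b1 d1 (divr_gt0 (divr_gt0 e0 (ltr0Sn _ 1)) M20).
exists (fun z => p1 z * p2 z); first exact: trigpolyM.
move=> s X f uX.
have bB1 : cbdd (fun z => W1 z - p1 z) by apply: cbddB => //; exact: cbdd_trigpoly.
have bB2 : cbdd (fun z => W2 z - p2 z) by apply: cbddB => //; exact: cbdd_trigpoly.
apply: (@le_trans _ _ (E (fun z => M1 * (nr (W2 z - p2 z) * sq (packet s X f z)) +
    M2 * (nr (W1 z - p1 z) * sq (packet s X f z))))).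
  apply: Ele.
  - apply: (@ib_form (fun z => W1 z * W2 z - p1 z * p2 z)); apply: cbddB; apply: cbddM => //; exact: cbdd_trigpoly.
  - by apply: ibD; apply: ibZ; exact: ib_form.
  move=> z Tz; rewrite !mulrA -mulrDl; apply: ler_wpM2r; first exact: sq_ge0.
  have -> : W1 z * W2 z - p1 z * p2 z = W1 z * (W2 z - p2 z) + p2 z * (W1 z - p1 z) by ring.
  apply: (le_trans (nr_triangle _ _)); rewrite !nrM.
  apply: lerD; apply: ler_wpM2r; rewrite ?nr_ge0//; [exact: h1|exact: h2].
rewrite ED ?EZ//; try exact: ib_form; try (apply: ibZ; exact: ib_form).
have := c1 s X f uX; have := c2 s X f uX.
set S := \sum_(n <- X) _; set E1 := E _; set E2 := E _ => g2 g1.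
have q2 : M1 * E1 <= e / 2 * S.
  apply: (le_trans (ler_wpM2l (ltW M10) g2)); rewrite le_eqVlt; apply/orP; left; apply/eqP.
  by field; rewrite gt_eqF.
have q1 : M2 * E2 <= e / 2 * S.
  apply: (le_trans (ler_wpM2l (ltW M20) g1)); rewrite le_eqVlt; apply/orP; left; apply/eqP.
  by field; rewrite gt_eqF.
by lra.
Qed.

Lemma trigapprox1 : trigapprox (fun=> 1).
Proof.
move=> e e0; exists (fun=> 1); first exact: trigpoly_cst.
move=> s X f uX; rewrite (@eqE_ _ _ _ (fun=> 0)); last by move=> z _; rewrite subrr nr0 mul0r.
by rewrite E0 mulr_ge0 ?sumsq_ge0// ltW.
Qed.

Lemma eq_trigapprox W W' : (forall z, T z -> W z = W' z) -> trigapprox W -> trigapprox W'.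
Proof.
move=> WW' aW e e0; have [p tp c] := aW e e0; exists p => // s X f uX.
apply: le_trans (c s X f uX); rewrite le_eqVlt; apply/orP; left.
by apply/eqP/eqE_ => z Tz; rewrite WW'.
Qed.

Lemma E_sq_packet s X f : uniq X -> E (fun z => sq (packet s X f z)) = vol N * \sum_(n <- X) sq (f n).
Proof.
move=> uX.
have [c cE] : exists c : N.-tuple int -> R[i], forall n, c (lam s n) = f n.
  exists (fun k => f [tuple tnth k (lift ord0 l) | l < d]) => n; congr f.
  by apply: eq_from_tnth => l; rewrite tnth_mktuple lamS.
have -> : E (fun z => sq (packet s X f z)) = E (fun z => sq (trig (map (lam s) X) c z)).
  apply: eqE_ => z _; congr sq; rewrite /packet /trig big_map.
  by apply: eq_bigr => n _; rewrite cE.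
rewrite E_sq_trig ?map_inj_uniq//; last exact: lam_inj.
by rewrite big_map; congr (_ * _); apply: eq_bigr => n _; rewrite cE.
Qed.

Lemma packet_rot s X f (l : 'I_d) h z : T z ->
  packet s X f (rot (lift ord0 l) h z) = packet s X (fun n => expi ((tnth n l)%:~R * h) * f n) z.
Proof.
move=> Tz; rewrite /packet; apply: eq_bigr => n _; rewrite ewave_rot// lamS; ring.
Qed.

Lemma sumsq_phase X f (a : d.-tuple int -> R) :
  \sum_(n <- X) sq (expi (a n) * f n) = \sum_(n <- X) sq (f n).
Proof. by apply: eq_bigr => n _; rewrite sqM sq_expi mul1r. Qed.

Lemma E_form_rot W s X f (l : 'I_d) h : cbdd W -> 0 <= h < 2 * pi ->
  E (fun z => nr (W (rot (lift ord0 l) h z)) * sq (packet s X f z)) =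
  E (fun z => nr (W z) * sq (packet s X (fun n => expi (- ((tnth n l)%:~R * h)) * f n) z)).
Proof.
move=> bW hh.
have iF : ib (fun z => nr (W z) * sq (packet s X (fun n => expi (- ((tnth n l)%:~R * h)) * f n) z)) by exact: ib_form.
have [_ <-] := E_rot (lift ord0 l) hh iF.
apply: eqE_ => z Tz; rewrite packet_rot//; congr (_ * sq _); apply: eq_bigr => n _.
by rewrite mulrA expiNK mul1r.
Qed.

Lemma expi_near1 (k : int) (e : R) : 0 < e ->
  exists2 t : R, 0 < t & forall h, 0 <= h <= t -> nr (expi (k%:~R * h) - 1) <= e.
Proof.
move=> e0; have e20 : 0 < e ^+ 2 / 2 by rewrite divr_gt0// exprn_gt0.
have := @continuous_cos R 0 => /cvgrPdist_le/(_ _ e20).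
rewrite near_nbhs => /nbhs_ballP[t /= t0 ht].
have k0 : 0 < `|k%:~R| + 1 :> R by rewrite ltr_wpDl.
exists (t / 2 / (`|k%:~R| + 1)); first by rewrite !divr_gt0.
move=> h /andP[h0 h1].
have : `|cos 0 - cos (k%:~R * h)| <= e ^+ 2 / 2 :> R.
  apply: ht; rewrite /ball/= sub0r normrN normrM (ger0_norm h0).
  move: h1; rewrite ler_pdivlMr// => h1.
  have : 0 <= `|k%:~R| :> R by []. 
  nra.
rewrite cos0 => hc.
have key : nr (expi (k%:~R * h) - 1) ^+ 2 <= e ^+ 2.
  rewrite -sqE -[X in _ - X]expi0 sq_expiB subr0.
  have := ler_norm (1 - cos (k%:~R * h)); lra.
move: key; rewrite ler_pXn2r// nnegrE; [exact: nr_ge0|exact: ltW].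
Qed.

Lemma trigpoly_rot_near (p : Rn R N -> R[i]) (l : 'I_N) (e : R) : trigpoly p -> 0 < e ->
  exists2 t : R, 0 < t & forall h z, 0 <= h <= t -> T z -> nr (p (rot l h z) - p z) <= e.
Proof.
move=> [s [c [_ ->]]]; elim: s e => [|k s IH] e e0.
  exists 1 => // h z _ _; by rewrite /trig !big_nil subrr nr0 ltW.
have [t1 t10 h1] := IH (e / 2) (divr_gt0 e0 (ltr0Sn _ 1)).
have c0 : 0 < nr (c k) + 1 by rewrite ltr_wpDl ?nr_ge0.
have [t2 t20 h2] := expi_near1 (tnth k l) (divr_gt0 (divr_gt0 e0 (ltr0Sn _ 1)) c0).
exists (Num.min t1 t2); first by rewrite lt_min t10.
move=> h z /andP[h0]; rewrite le_min => /andP[ht1 ht2] Tz.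
rewrite /trig !big_cons -/(trig s c (rot l h z)) -/(trig s c z) ewave_rot//.
have -> : c k * (expi ((tnth k l)%:~R * h) * ewave k z) + trig s c (rot l h z) - (c k * ewave k z + trig s c z) =
   c k * (expi ((tnth k l)%:~R * h) - 1) * ewave k z + (trig s c (rot l h z) - trig s c z) by ring.
apply: (le_trans (nr_triangle _ _)); rewrite !nrM nr_ewave mulr1.
have g1 := h1 h z; rewrite h0 ht1 in g1; have {}g1 := g1 isT Tz.
have g2 := h2 h; rewrite h0 ht2 in g2; have {}g2 := g2 isT.
have : nr (c k) * nr (expi ((tnth k l)%:~R * h) - 1) <= e / 2.
  move: g2; rewrite ler_pdivlMr// => g2; apply: le_trans g2.
  by rewrite mulrC ler_wpM2l ?nr_ge0// lerDl.
lra.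
Qed.

Lemma bdd_rot (F : Rn R N -> R) (l : 'I_N) h : 0 <= h < 2 * pi -> bdd F -> bdd (fun z => F (rot l h z)).
Proof.
move=> hh bF; have [i _] := E_rot l hh (bdd_ib bF); split; first exact: ib_meas i.
by have [_ [M MF]] := bF; exists M => z Tz; apply: MF; exact: rot_torus.
Qed.

Lemma cbdd_rot W (l : 'I_N) h : 0 <= h < 2 * pi -> cbdd W -> cbdd (fun z => W (rot l h z)).
Proof.
by move=> hh [b1 b2]; split; [exact: (bdd_rot l hh b1)|exact: (bdd_rot l hh b2)].
Qed.

(** A trigonometric polynomial close to W moves little in the sup norm; the
    translated error is the error tested on a packet with rotated
    coefficients, hence of equal energy. *)
Lemma rot_close W (l : 'I_d) (e : R) : cbdd W -> trigapprox W -> 0 < e ->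
  exists2 t : R, 0 < t < 2 * pi & forall h, 0 <= h <= t -> forall s X f, uniq X ->
  E (fun z => nr (W (rot (lift ord0 l) h z) - W z) * sq (packet s X f z)) <= e * \sum_(n <- X) sq (f n).
Proof.
move=> bW aW e0; have e40 := e4_gt0 e0.
have v0 := @vol_gt0 R N.
have [p tp cp] := aW _ e40; have bp := cbdd_trigpoly tp.
have [t t0 ht] := trigpoly_rot_near (lift ord0 l) tp (divr_gt0 e40 v0).
have pi0 := @pi_gt0 R.
exists (Num.min t pi); first by rewrite lt_min t0 pi0/= gt_min; apply/orP; right; lra.
move=> h /andP[h0]; rewrite le_min => /andP[h1 h2] s X f uX.
have hh : 0 <= h < 2 * pi by rewrite h0/=; lra.
have bB : cbdd (fun z => W z - p z) by exact: cbddB.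
have bWr : cbdd (fun z => W (rot (lift ord0 l) h z)) by exact: cbdd_rot.
have bpr : cbdd (fun z => p (rot (lift ord0 l) h z)) by exact: cbdd_rot.
apply: (@le_trans _ _ (E (fun z => nr (W (rot (lift ord0 l) h z) - p (rot (lift ord0 l) h z)) * sq (packet s X f z) +
    (e / 4 / vol N * sq (packet s X f z) + nr (W z - p z) * sq (packet s X f z))))).
  apply: Ele.
  - by apply: (@ib_form (fun z => W (rot (lift ord0 l) h z) - W z)); exact: cbddB.
  - apply: ibD; first by apply: (@ib_form (fun z => W (rot (lift ord0 l) h z) - p (rot (lift ord0 l) h z))); exact: cbddB.
    by apply: ibD; [apply/ibZ/bdd_ib/bdd_sq/cbdd_packet|exact: ib_form].
  move=> z Tz; rewrite -!mulrDl; apply: ler_wpM2r; first exact: sq_ge0.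
  have -> : W (rot (lift ord0 l) h z) - W z = (W (rot (lift ord0 l) h z) - p (rot (lift ord0 l) h z)) +
     ((p (rot (lift ord0 l) h z) - p z) + - (W z - p z)) by ring.
  apply: (le_trans (nr_triangle _ _)); rewrite lerD2l.
  apply: (le_trans (nr_triangle _ _)); rewrite nrN lerD2r.
  by apply: ht => //; rewrite h0.
have i1 : ib (fun z => nr (W (rot (lift ord0 l) h z) - p (rot (lift ord0 l) h z)) * sq (packet s X f z)).
  by apply: (@ib_form (fun z => W (rot (lift ord0 l) h z) - p (rot (lift ord0 l) h z))); exact: cbddB.
have i2 : ib (fun z => sq (packet s X f z)) by apply/bdd_ib/bdd_sq/cbdd_packet.
have i3 : ib (fun z => nr (W z - p z) * sq (packet s X f z)) by exact: ib_form.
rewrite ED//; last by apply: ibD => //; exact: ibZ.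
rewrite ED//; last exact: ibZ.
rewrite EZ// E_sq_packet//.
rewrite (@E_form_rot (fun z => W z - p z))//.
have g1 := cp s X (fun n => expi (- ((tnth n l)%:~R * h)) * f n) uX.
rewrite sumsq_phase in g1; have g2 := cp s X f uX.
have -> : e / 4 / vol N * (vol N * \sum_(n <- X) sq (f n)) = e / 4 * \sum_(n <- X) sq (f n).
  by field; rewrite gt_eqF.
have S0 : 0 <= e * \sum_(n <- X) sq (f n) by rewrite mulr_ge0 ?sumsq_ge0// ltW.
lra.
Qed.

End weights.

(** * Adding one frequency *)

Section averaging.
Context {R : realType}.

Lemma cos_lt1 (t : R) : 0 < t < 2 * pi -> cos t < 1.
Proof.
move=> /andP[t0 t2]; have s0 : 0 < sin (t / 2) by apply: sin_gt0_pi; apply/andP; split; lra.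
have -> : t = (t / 2) *+ 2 by rewrite -mulr_natl; lra.
rewrite cos_mulr2n cos2sin2; have := exprn_gt0 2 s0; rewrite mulr2n; lra.
Qed.

Lemma expi_pow (t : R) (k : nat) : expi t ^+ k = expi (k%:R * t).
Proof.
elim: k => [|k IH]; first by rewrite expr0 mul0r expi0.
by rewrite exprS IH -expiD -natr1 mulrDl mul1r addrC.
Qed.

(** Real part of the sum of the powers of a nontrivial root of unity. *)
Lemma sum_cos_roots (M : nat) (k : int) : k != 0 -> (absz k < M)%N ->
  \sum_(i < M) cos (k%:~R * (i%:R * (2 * pi / M%:R))) = 0 :> R.
Proof.
move=> k0 kM; have M0 : 0 < M%:R :> R by rewrite ltr0n (leq_ltn_trans _ kM).
pose w : R[i] := expi (k%:~R * (2 * pi / M%:R)).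
have wM : w ^+ M = 1.
  rewrite /w expi_pow.
  have -> : M%:R * (k%:~R * (2 * pi / M%:R)) = k%:~R * (2 * pi) :> R by field; rewrite gt_eqF.
  exact: expi_int2pi.
have w1 : w - 1 != 0.
  apply/eqP => /(congr1 (@complex.Re R)); rewrite ReD ReN /=.
  have pi0 := @pi_gt0 R.
  pose t : R := `|k|%:~R * (2 * pi / M%:R).
  have -> : cos (k%:~R * (2 * pi / M%:R)) = cos t.
    rewrite -[LHS]cos_norm normrM /t intr_norm; congr (cos (_ * _)).
    by rewrite ger0_norm// divr_ge0// mulr_ge0// ltW.
  have h1 : 1 <= `|k|%:~R :> R by rewrite -[1]/(1%:~R) ler_int; case: k k0 {kM w wM t} => [[|?]|?].
  have h2 : `|k|%:~R + 1 <= M%:R :> R by rewrite -natr_absz natr1 ler_nat.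
  have : cos t < 1.
    apply: cos_lt1; apply/andP; split; first by rewrite mulr_gt0 ?divr_gt0// ?mulr_gt0//; lra.
    rewrite /t mulrA ltr_pdivrMr//; nra.
  lra.
have : (w - 1) * \sum_(i < M) w ^+ i = 0 by rewrite -subrX1 wM subrr.
move/eqP; rewrite mulf_eq0 (negbTE w1)/= => /eqP/(congr1 (@complex.Re R)).
rewrite Re_sum [RHS]/= => h; rewrite -[RHS]h; apply: eq_bigr => i _; rewrite /w expi_pow /=; congr cos; ring.
Qed.

Lemma cos_double (t : R) : 1 - cos (2 * t) <= 4 * (1 - cos t).
Proof.
rewrite mulr_natl cos_mulr2n; have := cos_geN1 t; have := cos_le1 t; rewrite mulr2n; nra.
Qed.

(** Doubling h multiplies 1 - cos (k h) by at most 4, so a bound for small h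
    yields one for all h; and 1 - cos (k h) has mean 1 over the M-th fractions
    of a turn if 0 < |k| < M. *)
Lemma averaging (h0 : R) : 0 < h0 -> exists2 C : R, 0 < C &
  forall (S : eqType) (X : seq S) (k : S -> int) (A : S -> R) (B : R),
  (forall n, 0 <= A n) ->
  (forall h, 0 <= h <= h0 -> \sum_(n <- X) A n * (1 - cos ((k n)%:~R * h)) <= B) ->
  \sum_(n <- X | k n != 0) A n <= C * B.
Proof.
move=> h00; have pi0 := @pi_gt0 R.
have [j hj] : exists j : nat, 2 * pi <= 2 ^+ j * h0.
  exists (Num.truncn (2 * pi / h0)).+1; rewrite -ler_pdivrMr//.
  apply: (@le_trans _ _ ((Num.truncn (2 * pi / h0)).+1)%:R); first exact/ltW/truncnS_gt.
  by rewrite -natrX ler_nat ltnW// ltn_expl.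
exists (4 ^+ j); first by rewrite exprn_gt0.
move=> S X k A B A0 hB.
have big i h : 0 <= h <= 2 ^+ i * h0 -> \sum_(n <- X) A n * (1 - cos ((k n)%:~R * h)) <= 4 ^+ i * B.
  elim: i h => [|i IH] h; first by rewrite !expr0 !mul1r; exact: hB.
  rewrite !exprS -!mulrA => /andP[hh0 hh1].
  have := IH (h / 2) _; rewrite divr_ge0//= ler_pdivrMr// [_ * 2]mulrC => /(_ hh1) IH'.
  apply: (@le_trans _ _ (4 * \sum_(n <- X) A n * (1 - cos ((k n)%:~R * (h / 2))))); last by rewrite ler_wpM2l.
  rewrite mulr_sumr; apply: ler_sum => n _; rewrite mulrCA; apply: ler_wpM2l => //.
  have -> : (k n)%:~R * h = 2 * ((k n)%:~R * (h / 2)) :> R by field.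
  exact: cos_double.
(* more sampling points than any frequency in play *)
pose M := (\max_(n <- X) absz (k n)).+1.
have M0 : 0 < M%:R :> R by rewrite ltr0n.
have key : \sum_(i < M) \sum_(n <- X) A n * (1 - cos ((k n)%:~R * (i%:R * (2 * pi / M%:R)))) <=
    M%:R * (4 ^+ j * B).
  apply: (@le_trans _ _ (\sum_(i < M) (4 ^+ j * B))); last by rewrite sumr_const card_ord mulr_natl.
  apply: ler_sum => i _; apply: big.
  rewrite mulr_ge0 ?divr_ge0 ?mulr_ge0// ?(ltW pi0)//=; apply: le_trans hj.
  rewrite mulrA ler_pdivrMr// mulrC ler_wpM2l ?mulr_ge0 ?(ltW pi0)// ler_nat ltnW//.
move: key; rewrite exchange_big/=.
rewrite (bigID (fun n => k n != 0))/= [X in _ + X]big1 ?addr0; last first.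
  move=> n /negPn/eqP ->; rewrite big1// => i _.
  by rewrite mul0r cos0 subrr mulr0.
move=> key; rewrite -(ler_pM2l M0); apply: le_trans key; rewrite mulr_sumr.
rewrite [leLHS]big_seq_cond [leRHS]big_seq_cond; apply: ler_sum => n /andP[nX kn].
rewrite -mulr_sumr sumrB sum_cos_roots//; last by rewrite /M ltnS; exact: (@leq_bigmax_seq _ X xpredT (fun n => absz (k n)) n).
by rewrite subr0 sumr_const card_ord mulrC.
Qed.

End averaging.

Section adding_a_frequency.
Context {R : realType} (d : nat).
Notation N := d.+1.
Notation T := (@torus R N).
Notation E := (@tint R N).
Notation Ec := (@Ec R N).
Implicit Types (n m : d.-tuple int) (s : bool) (X : seq (d.-tuple int)) (a b f : d.-tuple int -> R[i]).
Implicit Types (P : d.-tuple int -> bool -> bool).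
Variables (c : R) (G : set (Rn R N)).
Hypotheses (mG : measurable G) (aG : trigapprox (ind G)).

Definition phase (z : Rn R N) : R[i] := expi (c * tnth z ord0).

(** Twice the real part of the flow has this form, the backward waves being
    the conjugates of the forward ones. *)
Definition waves X a b (z : Rn R N) : R[i] := phase z * packet true X a z + (phase z)^*%C * packet false X b z.

Definition energy X a b : R := \sum_(n <- X) (sq (a n) + sq (b n)).

Definition observed X a b : R := E (fun z => \1_G z * sq (waves X a b z)).

(** P n s tells whether the wave of frequency n and sign s may occur. *)
Definition supp P a b := forall n, (~~ P n true -> a n = 0) /\ (~~ P n false -> b n = 0).

Definition observable P (delta : R) := forall X a b, uniq X -> supp P a b -> delta * energy X a b <= observed X a b.

Lemma cbdd_phase : cbdd phase.
Proof.
apply: cbdd_expi; apply: measurable_funM; first exact: measurable_cst.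
exact: (@measurable_tnth _ (measurableTypeR R) N ord0).
Qed.

Lemma cbdd_waves X a b : cbdd (waves X a b).
Proof.
by apply: cbddD; apply: cbddM; try exact: cbdd_packet; [exact: cbdd_phase|exact/cbddJ/cbdd_phase].
Qed.

Lemma sq_phase z : sq (phase z) = 1. Proof. exact: sq_expi. Qed.

Lemma sq_waves_le X a b z : sq (waves X a b z) <= 2 * sq (packet true X a z) + 2 * sq (packet false X b z).
Proof. by apply: (le_trans (sqD_le _ _)); rewrite !sqM sqJ sq_phase !mul1r. Qed.

Lemma indR_01 (A : set (Rn R N)) z : 0 <= (\1_A z : R) <= 1.
Proof. by rewrite indicE; case: (_ \in _); rewrite /= ?lexx ?ler01. Qed.

Lemma ib_w (w : Rn R N -> R) X a b : bdd w -> ib (fun z => w z * sq (waves X a b z)).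
Proof. by move=> bw; apply/bdd_ib/bddM => //; exact/bdd_sq/cbdd_waves. Qed.

Lemma form_waves (w : Rn R N -> R) e X a b : bdd w -> (forall z, T z -> 0 <= w z) ->
  E (fun z => w z * sq (packet true X a z)) <= e * \sum_(n <- X) sq (a n) ->
  E (fun z => w z * sq (packet false X b z)) <= e * \sum_(n <- X) sq (b n) ->
  E (fun z => w z * sq (waves X a b z)) <= 2 * e * energy X a b.
Proof.
move=> bw w0 ha hb.
have i1 : ib (fun z => w z * sq (packet true X a z)) by apply/bdd_ib/bddM => //; exact/bdd_sq/cbdd_packet.
have i2 : ib (fun z => w z * sq (packet false X b z)) by apply/bdd_ib/bddM => //; exact/bdd_sq/cbdd_packet.
apply: (@le_trans _ _ (E (fun z => 2 * (w z * sq (packet true X a z)) + 2 * (w z * sq (packet false X b z))))).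
  apply: Ele; first exact: ib_w.
    by apply: ibD; exact: ibZ.
  move=> z Tz; rewrite !(mulrCA 2) -mulrDr; apply: ler_wpM2l; first exact: w0.
  exact: sq_waves_le.
rewrite ED ?EZ//; try exact: ibZ.
rewrite /energy big_split/=; lra.
Qed.

Lemma observed_le X a b : uniq X -> observed X a b <= 2 * vol N * energy X a b.
Proof.
move=> uX; apply: form_waves.
- exact: bdd_indic.
- by move=> z _; have /andP[] := indR_01 G z.
- rewrite -(E_sq_packet true)//; apply: Ele; [apply/bdd_ib/bddM; [exact: bdd_indic|exact/bdd_sq/cbdd_packet]|exact/bdd_ib/bdd_sq/cbdd_packet|].
  by move=> z _; rewrite ler_piMl ?sq_ge0//; have /andP[] := indR_01 G z.
- rewrite -(E_sq_packet false)//; apply: Ele; [apply/bdd_ib/bddM; [exact: bdd_indic|exact/bdd_sq/cbdd_packet]|exact/bdd_ib/bdd_sq/cbdd_packet|].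
  by move=> z _; rewrite ler_piMl ?sq_ge0//; have /andP[] := indR_01 G z.
Qed.

Lemma packetD s X a b z : packet s X (fun n => a n + b n) z = packet s X a z + packet s X b z.
Proof. by rewrite /packet -big_split/=; apply: eq_bigr => n _; rewrite mulrDl. Qed.

Lemma wavesD X a b a' b' z : waves X (fun n => a n + a' n) (fun n => b n + b' n) z = waves X a b z + waves X a' b' z.
Proof. by rewrite /waves !packetD; ring. Qed.

Lemma observedD X a b a' b' : observed X (fun n => a n + a' n) (fun n => b n + b' n) <= 2 * observed X a b + 2 * observed X a' b'.
Proof.
have bG : bdd (\1_G : _ -> R) by exact: bdd_indic.
rewrite /observed -!EZ; try exact: ib_w.
rewrite -ED; try (apply: ibZ; exact: ib_w).
apply: Ele; [exact: ib_w|by apply: ibD; apply: ibZ; exact: ib_w|].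
move=> z _; rewrite !(mulrCA 2) -mulrDr; apply: ler_wpM2l; first by have /andP[] := indR_01 G z.
by rewrite wavesD; exact: sqD_le.
Qed.

Lemma phase_rot (l : 'I_d) h z : phase (rot (lift ord0 l) h z) = phase z.
Proof. by rewrite /phase /rot tnth_mktuple. Qed.

Lemma waves_rot X a b (l : 'I_d) h z : T z ->
  waves X a b (rot (lift ord0 l) h z) =
  waves X (fun n => expi ((tnth n l)%:~R * h) * a n) (fun n => expi ((tnth n l)%:~R * h) * b n) z.
Proof. by move=> Tz; rewrite /waves phase_rot !packet_rot. Qed.

(** Subtracting exp (i h m_l) times the superposition from its translate by h
    annihilates frequency m. On the points of G that the translation keeps in
    G the observed energy grows at most fourfold, and the other points carry
    little. *)
Lemma translate_bound (delta : R) (l : 'I_d) h X a b m P :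
  0 < delta -> uniq X -> 0 <= h < 2 * pi ->
  (forall s X f, uniq X -> E (fun z => nr (ind G (rot (lift ord0 l) h z) - ind G z) * sq (packet s X f z)) <=
     delta / 4 * \sum_(n <- X) sq (f n)) ->
  observable (fun n s => P n s && (n != m)) delta -> supp P a b ->
  \sum_(n <- X) (sq (a n) + sq (b n)) * (1 - cos ((tnth n l - tnth m l)%:~R * h)) <= 4 / delta * observed X a b.
Proof.
move=> d0 uX hh cl hbb sP.
pose u n : R[i] := expi ((tnth n l)%:~R * h) - expi ((tnth m l)%:~R * h).
pose a' n := u n * a n; pose b' n := u n * b n.
have sP' : supp (fun n s => P n s && (n != m)) a' b'.
  move=> n; have [ha hb] := sP n; rewrite /a' /b' /u.
  by split; rewrite negb_and negbK => /orP[|/eqP ->]; rewrite ?subrr ?mul0r// => h1; rewrite ?ha ?hb ?mulr0.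
have NNE : energy X a' b' = 2 * \sum_(n <- X) (sq (a n) + sq (b n)) * (1 - cos ((tnth n l - tnth m l)%:~R * h)).
  rewrite /energy mulr_sumr; apply: eq_bigr => n _; rewrite /a' /b' !sqM /u sq_expiB -mulrBl -rmorphB/=.
  ring.
have bG : bdd (\1_G : _ -> R) by exact: bdd_indic.
pose r := @rot R N (lift ord0 l) h.
have bGr : bdd (fun z => \1_G (r z) : R) by exact: bdd_rot.
pose w z : R := nr (ind G (r z) - ind G z).
have bw : bdd w.
  apply: (@bdd_nr R N (fun z => ind G (r z) - ind G z)); apply: cbddB; last exact: cbdd_ind.
  exact: (cbdd_rot _ hh (cbdd_ind mG)).
have w0 z : T z -> 0 <= w z by move=> _; exact: nr_ge0.
have bp : bdd (fun z => \1_G z * \1_G (r z) : R) by exact: bddM.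
have h1 := hbb X a' b' uX sP'.
have h2 : E (fun z => w z * sq (waves X a' b' z)) <= 2 * (delta / 4) * energy X a' b'.
  by apply: form_waves => //; exact: cl.
have h3 : E (fun z => \1_G z * \1_G (r z) * sq (waves X a' b' z)) <= 4 * observed X a b.
  have ir : ib (fun z => \1_G z * sq (waves X a b z)) by exact: ib_w.
  have [ir1 ir2] := E_rot (lift ord0 l) hh ir.
  have -> : 4 * observed X a b = 2 * observed X a b + 2 * observed X a b by ring.
  rewrite {1}/observed -ir2 -!EZ// -ED; try exact: ibZ.
  apply: Ele; [exact: ib_w|by apply: ibD; exact: ibZ|].
  move=> z Tz.
  have -> : waves X a' b' z = waves X a b (r z) - expi ((tnth m l)%:~R * h) * waves X a b z.
    have uV s f : packet s X (fun n => u n * f n) z =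
        packet s X (fun n => expi ((tnth n l)%:~R * h) * f n) z - expi ((tnth m l)%:~R * h) * packet s X f z.
      by rewrite /packet mulr_sumr -sumrB; apply: eq_bigr => n _; rewrite /u; ring.
    by rewrite /r waves_rot// /waves !uV; ring.
  have := sqB_le (waves X a b (r z)) (expi ((tnth m l)%:~R * h) * waves X a b z).
  rewrite sqM sq_expi mul1r -/r => h3.
  have := sq_ge0 (waves X a b (r z)); have := sq_ge0 (waves X a b z).
  rewrite !indicE; case: (z \in G); case: (r z \in G); rewrite /= ?mul1r ?mul0r ?mulr0 ?mulr1; lra.
have h4 : observed X a' b' <= E (fun z => \1_G z * \1_G (r z) * sq (waves X a' b' z)) + E (fun z => w z * sq (waves X a' b' z)).
  rewrite -ED; try exact: ib_w.
  apply: Ele; [exact: ib_w|by apply: ibD; exact: ib_w|].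
  move=> z Tz; rewrite -mulrDl; apply: ler_wpM2r; first exact: sq_ge0.
  have -> : w z = `|\1_G (r z) - \1_G z| by rewrite /w /ind -nrC rmorphB.
  rewrite !indicE; case: (z \in G); case: (r z \in G) => /=;
    rewrite ?mul1r ?mul0r ?mulr0 ?mulr1 ?subrr ?sub0r ?subr0 ?normrN ?normr1 ?normr0; lra.
rewrite NNE in h1 h2.
rewrite mulrAC ler_pdivlMr//; lra.
Qed.

(** The waves off m are controlled by their translates, averaged over the
    length of the translation. What is left at m is observed up to an error
    that is already controlled. The new constant depends on delta and delta0
    only, which allows iteration. *)
Lemma add_frequency (delta delta0 : R) : 0 < delta -> 0 < delta0 -> exists2 delta' : R, 0 < delta' &
  forall P m, observable (fun n s => P n s && (n != m)) delta -> observable (fun n s => P n s && (n == m)) delta0 -> observable P delta'.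
Proof.
move=> d0 d00.
have d40 := e4_gt0 d0.
have hl l := rot_close l (cbdd_ind mG) aG d40.
have [t [t0 t2] ht] : exists2 t : R, 0 < t /\ t < 2 * pi & forall l, forall h, 0 <= h <= t -> forall s X f, uniq X ->
  E (fun z => nr (ind G (rot (lift ord0 l) h z) - ind G z) * sq (packet s X f z)) <= delta / 4 * \sum_(n <- X) sq (f n).
  have /boolp.choice[t0 ht0] : forall l : 'I_d, exists t : R, 0 < t < 2 * pi /\ forall h, 0 <= h <= t -> forall s X f, uniq X ->
     E (fun z => nr (ind G (rot (lift ord0 l) h z) - ind G z) * sq (packet s X f z)) <= delta / 4 * \sum_(n <- X) sq (f n).
    by move=> l; have [t ? ?] := hl l; exists t.
  exists (\big[Num.min/1]_l t0 l).
    split; first by elim/big_ind : _ => // [x y x0 y0|l _]; [rewrite lt_min x0|have [/andP[]] := ht0 l].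
    have pi2 := @pi_ge2 R.
    elim/big_ind : _ => // [|x y x0 y0|l _]; [lra|by rewrite gt_min x0|by have [/andP[]] := ht0 l].
  move=> l h /andP[h0 h1]; apply: (proj2 (ht0 l)); rewrite h0/=.
  by apply: (le_trans h1); rewrite (bigD1 l)//= ge_min lexx.
have [C C0 hC] := averaging t0.
have v0 := @vol_gt0 R N.
(* energy off m is at most K1 times, and energy at m at most K2 times, the observed one *)
pose K1 : R := d%:R * (C * (4 / delta)).
have K10 : 0 <= K1 by rewrite !mulr_ge0// ?invr_ge0 ltW.
pose K2 : R := (2 + 4 * vol N * K1) / delta0.
have vK : 0 <= 4 * vol N * K1 by apply: mulr_ge0 => //; apply: mulr_ge0 => //; exact: ltW.
have K20 : 0 < K2 by rewrite /K2 divr_gt0//; lra.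
exists (K1 + K2)^-1; first by rewrite invr_gt0 ltr_wpDl.
move=> P m h1 h2 X a b uX sP.
have K120 : 0 < K1 + K2 by rewrite ltr_wpDl.
rewrite ler_pdivrMl//.
have nm (k n : d.-tuple int) : k != n -> exists l, tnth k l - tnth n l != 0.
  move=> kn; apply/existsP; apply: contraNT kn; rewrite negb_exists => /forallP e.
  by apply/eqP/eq_from_tnth => l; have := e l; rewrite negbK subr_eq0 => /eqP.
have part1 : \sum_(n <- X | n != m) (sq (a n) + sq (b n)) <= K1 * observed X a b.
  apply: (@le_trans _ _ (\sum_(l < d) \sum_(n <- X | tnth n l - tnth m l != 0) (sq (a n) + sq (b n)))).
    under [leRHS]eq_bigr do rewrite big_mkcond.
    rewrite exchange_big/= big_mkcond/=; apply: ler_sum => n _; case: ifPn => nmn.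
      have [l hl'] := nm _ _ nmn; rewrite (bigD1 l)//= hl' lerDl; apply: sumr_ge0 => i _.
      by case: ifP => // _; rewrite addr_ge0 ?sq_ge0.
    by apply: sumr_ge0 => i _; case: ifP => // _; rewrite addr_ge0 ?sq_ge0.
  apply: (@le_trans _ _ (\sum_(l < d) (C * (4 / delta * observed X a b)))); last first.
    by rewrite sumr_const card_ord -[leLHS]mulr_natl /K1 !mulrA.
  apply: ler_sum => l _; apply: hC; first by move=> n; rewrite addr_ge0 ?sq_ge0.
  move=> h /andP[hh0 hh1]; apply: (translate_bound d0 uX _ _ h1 sP); first by rewrite hh0/=; lra.
  by apply: ht; rewrite hh0.
pose a0 n := if n == m then a n else 0; pose b0 n := if n == m then b n else 0.
pose a1 n := if n == m then 0 else - a n; pose b1 n := if n == m then 0 else - b n.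
have s0 : supp (fun n s => P n s && (n == m)) a0 b0.
  move=> n; rewrite /a0 /b0; case: eqP => //= _; rewrite andbT !andbT.
  by have [] := sP n.
have e0 : observed X a0 b0 <= 2 * observed X a b + 2 * observed X a1 b1.
  have <- : observed X (fun n => a n + a1 n) (fun n => b n + b1 n) = observed X a0 b0.
    have ea : (fun n => a n + a1 n) = a0 by apply/funext => n; rewrite /a1 /a0; case: eqP; rewrite ?addr0 ?subrr.
    have eb : (fun n => b n + b1 n) = b0 by apply/funext => n; rewrite /b1 /b0; case: eqP; rewrite ?addr0 ?subrr.
    by rewrite ea eb.
  exact: observedD.
have e1 : energy X a1 b1 = \sum_(n <- X | n != m) (sq (a n) + sq (b n)).
  rewrite /energy [RHS]big_mkcond; apply: eq_bigr => n _; rewrite /a1 /b1.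
  by case: eqP => //= _; rewrite ?sq0 ?addr0 ?sqN.
have e2 := observed_le a1 b1 uX; rewrite e1 in e2.
have e3 := h2 X a0 b0 uX s0.
have e4 : energy X a b = energy X a0 b0 + \sum_(n <- X | n != m) (sq (a n) + sq (b n)).
  rewrite /energy [X in _ + X]big_mkcond -big_split/=; apply: eq_bigr => n _; rewrite /a0 /b0.
  by case: eqP => //= _; rewrite ?sq0 ?addr0 ?add0r.
have e5 : energy X a0 b0 <= K2 * observed X a b.
  rewrite /K2 mulrAC ler_pdivlMr// mulrC; apply: (le_trans e3); apply: (le_trans e0).
  have : 2 * vol N * \sum_(n <- X | n != m) (sq (a n) + sq (b n)) <= 2 * vol N * (K1 * observed X a b).
    by rewrite ler_wpM2l// mulr_ge0// ltW.
  lra.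
rewrite e4; lra.
Qed.

End adding_a_frequency.

(** * Tilings and lattice geometry *)

Section tiling.
Implicit Types a b : int.

(** Raising a by 1 shifts the sum by one index, and the two ends differ by 1.
    *)
Lemma hermite_step (L : nat) a : (0 < L)%N ->
  \sum_(o < L) ((a + 1 + o%:Z) %/ L)%Z = 1 + \sum_(o < L) ((a + o%:Z) %/ L)%Z.
Proof.
move=> L0; case: L L0 => // L _.
rewrite big_ord_recr [in RHS]big_ord_recl /=.
have -> : a + 1 + L%:Z = 1 * L.+1%:Z + (a + 0%:Z) by lia.
rewrite divzMDl// (eq_bigr (fun i : 'I_L => ((a + (bump 0 i)%:Z) %/ L.+1)%Z)) => [|i _].
  ring.
by congr (_ %/ _)%Z; rewrite /= /bump /=; lia.
Qed.

Lemma hermite (L : nat) a (k : nat) : (0 < L)%N ->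
  \sum_(o < L) ((a + k%:Z + o%:Z) %/ L)%Z = k%:Z + \sum_(o < L) ((a + o%:Z) %/ L)%Z.
Proof.
move=> L0; elim: k => [|k IH]; first by rewrite addr0 add0r.
have -> : k.+1%:Z = 1 + k%:Z by lia.
under eq_bigr do rewrite [1 + _]addrC addrA.
by rewrite hermite_step// IH addrA.
Qed.

(** By Hermite's identity the floors of (b + o) / L exceed those of (a + o) /
    L by b - a in total. *)
Lemma separating_offsets (L : nat) a b : (0 < L)%N ->
  (\sum_(o < L) (((a + o%:Z) %/ L)%Z != ((b + o%:Z) %/ L)%Z) <= absz (a - b))%N.
Proof.
move=> L0; wlog ab : a b / a <= b.
  move=> h; case: (leP a b) => ab; first exact: h.
  rewrite distnC; apply: leq_trans (h b a (ltW ab)).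
  by apply: leq_sum => o _; rewrite eq_sym.
have [k kE] : exists k : nat, b = a + k%:Z by exists (absz (b - a)); lia.
have h := hermite a k L0; rewrite -kE in h.
have -> : absz (a - b) = k by lia.
rewrite -(ler_nat int) natr_sum.
have -> : k%:R = \sum_(o < L) (((b + o%:Z) %/ L)%Z - ((a + o%:Z) %/ L)%Z) :> int.
  by rewrite sumrB h addrK natz.
apply: ler_sum => o _.
have : ((a + o%:Z) %/ L)%Z <= ((b + o%:Z) %/ L)%Z by apply: lez_pdiv2r => //; lia.
by case: eqP => /= [->|]; lia.
Qed.

End tiling.

Section lattice.
Context {d : nat}.
Implicit Types (n m k : d.-tuple int).

Definition close (K : nat) n m :=
  [forall l, (absz (tnth n l - tnth m l) <= K)%N] && (absz (isqn n - isqn m) <= K)%N.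

Definition tile (L o : nat) n : d.-tuple int := [tuple ((tnth n l + o%:Z) %/ L)%Z | l < d].

Lemma tile_separating (L K : nat) n m : (0 < L)%N -> close K n m ->
  (\sum_(o < L) (tile L o n != tile L o m) <= d * K)%N.
Proof.
move=> L0 /andP[/forallP c _].
apply: (@leq_trans (\sum_(o < L) \sum_(l < d) (((tnth n l + o%:Z) %/ L)%Z != ((tnth m l + o%:Z) %/ L)%Z))).
  apply: leq_sum => o _; case: (eqVneq (tile L o n) (tile L o m)) => //= ne.
  have [l hl] : exists l, ((tnth n l + o%:Z) %/ L)%Z != ((tnth m l + o%:Z) %/ L)%Z.
    apply/existsP; apply: contraNT ne; rewrite negb_exists => /forallP e.
    by apply/eqP/eq_from_tnth => l; rewrite !tnth_mktuple; have := e l; rewrite negbK => /eqP.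
  by rewrite (bigD1 l)//= hl.
rewrite exchange_big/=; apply: (@leq_trans (\sum_(l < d) K)); last by rewrite sum_nat_const card_ord.
by apply: leq_sum => l _; apply: leq_trans (c l); exact: separating_offsets.
Qed.

Lemma tile_dist (L o : nat) n m : (0 < L)%N -> tile L o n = tile L o m ->
  forall l, (absz (tnth n l - tnth m l)%R < L)%N.
Proof.
move=> L0 h l; have := congr1 (fun t => tnth t l) h; rewrite !tnth_mktuple => e.
have hn := divz_eq (tnth n l + o%:Z) L; have hm := divz_eq (tnth m l + o%:Z) L.
have L0' : (L : int) != 0 by lia.
have n1 := modz_ge0 (tnth n l + o%:Z) L0'; have m1 := modz_ge0 (tnth m l + o%:Z) L0'.
have LL : 0 < (L : int) by lia.
have n2 := ltz_pmod (tnth n l + o%:Z) LL; have m2 := ltz_pmod (tnth m l + o%:Z) LL.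
rewrite e in hn; lia.
Qed.

Lemma size_inj_le (S : eqType) (F : finType) (Y : seq S) (g : S -> F) :
  uniq Y -> {in Y &, injective g} -> (size Y <= #|F|)%N.
Proof.
move=> uY gi; rewrite -(size_map g).
have ug : uniq (map g Y) by rewrite map_inj_in_uniq.
by rewrite -(card_uniqP ug); exact: max_card.
Qed.

Lemma size_close (K : nat) n (X : seq (d.-tuple int)) : uniq X ->
  (size [seq m <- X | close K n m] <= (2 * K).+1 ^ d)%N.
Proof.
move=> uX.
have -> : ((2 * K).+1 ^ d = #|{ffun 'I_d -> 'I_(2 * K).+1}|)%N by rewrite card_ffun !card_ord.
apply: (@size_inj_le _ _ _ (fun m => [ffun l => inord (absz (tnth n l - tnth m l + K%:Z))])).
  by rewrite filter_uniq.
move=> m m'; rewrite !mem_filter => /andP[/andP[/forallP c _] _] /andP[/andP[/forallP c' _] _] /ffunP h.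
apply: eq_from_tnth => l; have := h l; rewrite !ffunE => /(congr1 val).
have := c l; have := c' l => h1 h2; rewrite /= !inordK; lia.
Qed.

Definition vec n : 'rV[rat]_d := \row_l (tnth n l)%:~R.

Definition dot n k : int := \sum_(l < d) tnth n l * tnth k l.

Lemma dot_sub n m k : dot (tsub n m) k = dot n k - dot m k.
Proof. by rewrite /dot -sumrB; apply: eq_bigr => l _; rewrite tnth_mktuple mulrBl. Qed.

Lemma vec_sub n m : vec (tsub n m) = vec n - vec m.
Proof. by apply/rowP => l; rewrite !mxE tnth_mktuple rmorphB. Qed.

Lemma dot_isqn n m : dot n (tsub n m) + dot m (tsub n m) = isqn n - isqn m.
Proof.
rewrite /dot /isqn -big_split/= -sumrB; apply: eq_bigr => l _; rewrite tnth_mktuple; ring.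
Qed.

Definition rdot (u v : 'rV[rat]_d) : rat := \sum_(l < d) u 0 l * v 0 l.

Lemma rdot_vec n k : rdot (vec n) (vec k) = (dot n k)%:~R.
Proof. by rewrite /rdot /dot rmorph_sum; apply: eq_bigr => l _; rewrite !mxE rmorphM. Qed.

Lemma rdot0 u : rdot u u = 0 -> u = 0.
Proof.
move=> /eqP; rewrite psumr_eq0 => [/allP h|l _]; last by rewrite -expr2 sqr_ge0.
apply/rowP => l; rewrite mxE; have := h l (mem_index_enum l).
by rewrite /= mulf_eq0 orbb => /eqP.
Qed.

(** u is orthogonal to the span, hence to itself. *)
Lemma rdot_span (s : seq 'rV[rat]_d) u : u \in span s -> (forall v, v \in s -> rdot u v = 0) -> u = 0.
Proof.
move=> us h; apply: rdot0.
have rD v w : rdot u (v + w) = rdot u v + rdot u w.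
  by rewrite /rdot -big_split/=; apply: eq_bigr => l _; rewrite mxE mulrDr.
have rZ x v : rdot u (x *: v) = x * rdot u v.
  by rewrite /rdot mulr_sumr; apply: eq_bigr => l _; rewrite mxE mulrCA.
have r0 : rdot u 0 = 0 by rewrite /rdot big1// => l _; rewrite mxE mulr0.
rewrite [X in rdot _ X](@coord_span _ _ _ (in_tuple s) u us).
apply: (big_ind (fun v => rdot u v = 0)) => // [v w hv hw|i _]; first by rewrite rD hv hw addr0.
by rewrite rZ h ?mulr0//; exact: mem_nth.
Qed.

Definition diffs (X : seq (d.-tuple int)) := [seq vec n - vec m | n <- X, m <- X].
(** Rank of the affine hull of X. *)
Definition rk X := \dim (span (diffs X)).

Lemma rk_le X : (rk X <= d)%N.
Proof. by apply: leq_trans (dimvS (subvf _)) _; rewrite dimvf /dim/= mul1n. Qed.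

Lemma diffs_span X n m : n \in X -> m \in X -> vec n - vec m \in (span (diffs X)).
Proof. by move=> nX mX; apply: memv_span; apply/allpairsP; exists (n, m). Qed.

Lemma vec_inj : injective vec.
Proof.
move=> n m h; apply: eq_from_tnth => l; have := congr1 (fun u : 'rV[rat]_d => u 0 l) h.
by rewrite !mxE => /eqP; rewrite eqr_int => /eqP.
Qed.

Lemma rk_sub X (U : {vspace 'rV[rat]_d}) : (forall n m, n \in X -> m \in X -> vec n - vec m \in U) -> (span (diffs X) <= U)%VS.
Proof.
move=> h; apply/span_subvP => v /allpairsP[[n m]/= [nX mX ->]]; exact: h.
Qed.

End lattice.

(** * Banded forms and cheap tilings *)

Lemma sum_keys2 (R : realDomainType) (S K : eqType) (X : seq S) (key : S -> K) (g : S -> S -> R) :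
  (forall n m, n \in X -> m \in X -> key n != key m -> g n m = 0) ->
  \sum_(n <- X) \sum_(m <- X) g n m =
  \sum_(k <- undup (map key X)) \sum_(n <- [seq n <- X | key n == k]) \sum_(m <- [seq m <- X | key m == k]) g n m.
Proof.
move=> h; rewrite (sum_keys X key); apply: eq_bigr => k _.
rewrite -[LHS]big_filter; apply: eq_big_seq => n; rewrite mem_filter => /andP[/eqP kn nX].
rewrite [RHS]big_filter (bigID (fun m => key m == k))/= [X in _ + X]big_seq_cond [X in _ + X]big1 ?addr0// => m.
by move=> /andP[mX km]; rewrite h// kn eq_sym.
Qed.

Section clusters.
Context {R : realType} (d : nat).
Notation N := d.+1.
Notation T := (@torus R N).
Notation E := (@tint R N).
Notation Ec := (@Ec R N).
Implicit Types (n m : d.-tuple int) (s : bool) (X Y : seq (d.-tuple int)) (f : d.-tuple int -> R[i]).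
Variables (G : set (Rn R N)).
Hypotheses (mG : measurable G) (aG : trigapprox (ind G)) (posG : 0 < E (\1_G : _ -> R)).

Definition observed1 s X f : R := E (fun z => \1_G z * sq (packet s X f z)).

Definition observable1 s (Q : pred (d.-tuple int)) (delta : R) := forall X f, uniq X ->
  (forall n, ~~ Q n -> f n = 0) -> delta * \sum_(n <- X) sq (f n) <= observed1 s X f.

Lemma packet0 s X z : packet s X (fun=> 0) z = 0 :> R[i].
Proof. by rewrite /packet big1// => n _; rewrite mul0r. Qed.

Lemma observable1P s Q delta : observable1 s Q delta <-> observable 0 G (fun n s' => Q n && (s' == s)) delta.
Proof.
have nn X (a : d.-tuple int -> R[i]) : energy X a (fun=> 0) = \sum_(n <- X) sq (a n) /\ energy X (fun=> 0) a = \sum_(n <- X) sq (a n).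
  by rewrite /energy sq0; split; apply: eq_bigr => n _; rewrite ?addr0 ?add0r.
have ths X (a : d.-tuple int -> R[i]) : observed 0 G X a (fun=> 0) = observed1 true X a /\ observed 0 G X (fun=> 0) a = observed1 false X a.
  rewrite /observed /observed1; split; apply: eqE_ => z _; rewrite /waves packet0 mulr0 ?addr0 ?add0r sqM ?sqJ sq_phase mul1r//.
split=> [lo X a b uX sP|h X f uX hf].
  case: s lo sP => lo sP.
    have -> : b = (fun=> 0) by apply/funext => n; have [_ ->//] := sP n; rewrite andbF.
    rewrite (proj1 (nn X _)) (proj1 (ths X _)); apply: lo => // n nQ.
    by have [->//] := sP n; rewrite (negbTE nQ).
  have -> : a = (fun=> 0) by apply/funext => n; have [->//] := sP n; rewrite andbF.
  rewrite (proj2 (nn X _)) (proj2 (ths X _)); apply: lo => // n nQ.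
  by have [_ ->//] := sP n; rewrite (negbTE nQ).
case: s h => h.
  have := h X f (fun=> 0) uX; rewrite (proj1 (nn X _)) (proj1 (ths X _)); apply.
  by move=> n; split=> //; rewrite andbT; exact: hf.
have := h X (fun=> 0) f uX; rewrite (proj2 (nn X _)) (proj2 (ths X _)); apply.
by move=> n; split=> //; rewrite andbT; exact: hf.
Qed.

Lemma observed1_single s X f n : uniq X -> (forall m, m != n -> f m = 0) ->
  observed1 s X f = E (\1_G : _ -> R) * \sum_(m <- X) sq (f m).
Proof.
move=> uX hf; rewrite /observed1.
have [nX|nX] := boolP (n \in X); last first.
  have f0 m : m \in X -> f m = 0 by move=> mX; apply: hf; apply: contraNneq nX => <-.
  rewrite big_seq big1 ?mulr0; last by move=> m /f0 ->; rewrite sq0.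
  rewrite -[RHS](@E0 R N); apply: eqE_ => z _; rewrite /packet big_seq big1 ?sq0 ?mulr0// => m /f0 ->.
  by rewrite mul0r.
rewrite (bigD1_seq n)//= big1 ?addr0; last by move=> m /hf ->; rewrite sq0.
rewrite mulrC -EZ; last by apply/bdd_ib/bdd_indic.
apply: eqE_ => z _; rewrite /packet (bigD1_seq n)//= [X in _ + X]big1 ?addr0; last by move=> m /hf ->; rewrite mul0r.
by rewrite sqM sq_ewave mulr1 mulrC.
Qed.

Lemma add_frequency1 (delta : R) : 0 < delta -> exists2 delta' : R, 0 < delta' &
  forall s Q m, observable1 s (fun n => Q n && (n != m)) delta -> observable1 s Q delta'.
Proof.
move=> d0; have [delta' d'0 h] := add_frequency 0 mG aG d0 posG; exists delta' => // s Q m lo.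
apply/observable1P; apply: (h _ m).
  move/observable1P: lo => lo X a b uX sP; apply: lo => // n; have [ha hb] := sP n.
  by split=> h'; [apply: ha|apply: hb]; move: h'; rewrite andbAC.
have : observable1 s (fun n => Q n && (n == m)) (E (\1_G : _ -> R)).
  move=> X f uX hf; rewrite (@observed1_single s X f m uX)// => k km; apply: hf.
  by rewrite (negbTE km) andbF.
move/observable1P => lo' X a b uX sP; apply: lo' => // n; have [ha hb] := sP n.
by split=> h'; [apply: ha|apply: hb]; move: h'; rewrite andbAC.
Qed.

(** Only the number of the added frequencies enters the constant. *)
Lemma add_frequencies1 (k : nat) (delta : R) : 0 < delta -> exists2 delta' : R, 0 < delta' &
  forall s Q Z, (size Z <= k)%N -> observable1 s (fun n => Q n && (n \notin Z)) delta -> observable1 s Q delta'.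
Proof.
elim: k delta => [|k IH] delta d0.
  exists delta => // s Q [|//] _ lo X f uX hf; apply: lo => // n; rewrite andbT; exact: hf.
have [d1 d10 h1] := add_frequency1 d0; have [d2 d20 h2] := IH d1 d10.
exists (Num.min d1 d2); first by rewrite lt_min d10.
move=> s Q [|m Z] sZ lo.
  have lo' : observable1 s Q d1.
    apply: (h1 s Q (tzero (N := d))) => X f uX hf; apply: (@le_trans _ _ (delta * \sum_(n <- X) sq (f n))) => //.
    by apply: lo => // n; rewrite andbT => nQ; apply: hf; rewrite (negbTE nQ).
  move=> X f uX hf; apply: le_trans (lo' X f uX hf).
  by rewrite ler_wpM2r ?sumsq_ge0// ge_min lexx.
have lo' : observable1 s Q d2.
  apply: (h2 s Q Z) => //; apply: (h1 s _ m) => X f uX hf; apply: lo => // n.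
  rewrite inE negb_or => h; apply: hf; rewrite -andbA; apply: contra h => /and3P[-> -> ->].
  by [].
move=> X f uX hf; apply: le_trans (lo' X f uX hf).
by rewrite ler_wpM2r ?sumsq_ge0// ge_min lexx orbT.
Qed.

Definition form (M : d.-tuple int -> d.-tuple int -> R[i]) X f : R :=
  \sum_(n <- X) \sum_(m <- X) Re ((f n)^*%C * f m * M n m).

Lemma fc_trig_out (S : seq (N.-tuple int)) cc k : k \notin S -> fc (trig S cc : Rn R N -> R[i]) k = 0.
Proof.
move=> kS; rewrite /fc.
have -> : Ec (fun x => trig S cc x * (ewave k x)^*%C) =
    Ec (fun x => \sum_(m <- S) cc m * ewave (tsub m k) x).
  by apply: eq_Ec => x _; rewrite /trig mulr_suml; apply: eq_bigr => m _; rewrite ewave_sub mulrA.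
rewrite Ecsum; last by move=> m; apply: cibM; [exact: cbdd_cst|exact/cbdd_cib/cbdd_ewave].
rewrite big_seq big1// => m mS; rewrite EcZ; last exact/cbdd_cib/cbdd_ewave.
by rewrite Ec_ewave tsub_eq0; case: eqP mS kS => [-> ->|]; rewrite ?mulr0.
Qed.

(** The finite spectrum of a polynomial close to the indicator confines
    interactions to frequencies at bounded distance. *)
Lemma band_form (e : R) : 0 < e -> exists (K : nat) (B : R) (M : bool -> d.-tuple int -> d.-tuple int -> R[i]),
  [/\ 0 <= B, (forall s n m, nr (M s n m) <= B), (forall s n m, M s n m != 0 -> close K n m) &
   forall s X f, uniq X -> `|observed1 s X f - form (M s) X f| <= e * \sum_(n <- X) sq (f n)].
Proof.
move=> e0; have [_ [S [cc [uS ->]]] cl] := aG e0.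
have bp := @cbdd_trig R N S cc.
pose M s n m := fc (trig S cc : Rn R N -> R[i]) (tsub (lam s n) (lam s m)).
pose K := \max_(k <- S) \max_(l < N) absz (tnth k l).
exists K, (E (fun z => nr (trig S cc z))), M; split.
- by apply: Ege0 => z _; exact: nr_ge0.
- move=> s n m; rewrite /M /fc; apply: (le_trans (nr_Ec (cib_fc _ (cbdd_cib bp)))).
  rewrite le_eqVlt; apply/orP; left; apply/eqP/eqE_ => z _.
  by rewrite nrM nrJ nr_ewave mulr1.
- move=> s n m; rewrite /M => h.
  have kS : tsub (lam s n) (lam s m) \in S.
    by apply: contraNT h => kS; rewrite fc_trig_out.
  have kK l : (absz (tnth (tsub (lam s n) (lam s m)) l) <= K)%N.
    apply: leq_trans (@leq_bigmax_seq _ S xpredT (fun k => \max_(l < N) absz (tnth k l))%N _ kS isT).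
    exact: (@leq_bigmax _ (fun l : 'I_N => absz (tnth (tsub (lam s n) (lam s m)) l))).
  apply/andP; split.
    by apply/forallP => l; have := kK (lift ord0 l); rewrite tnth_mktuple !lamS.
  have := kK ord0; rewrite tnth_mktuple !lam0; case: (s) => //.
  by rewrite -opprD abszN.
- move=> s X f uX.
  have i1 : cib (fun z => ind G z * (sq (packet s X f z))%:C%C).
    by apply/cbdd_cib/cbddM; [exact: cbdd_ind|exact/cbddC/bdd_sq/cbdd_packet].
  have i2 : cib (fun z => trig S cc z * (sq (packet s X f z))%:C%C).
    by apply/cbdd_cib/cbddM => //; exact/cbddC/bdd_sq/cbdd_packet.
  have -> : observed1 s X f = Re (Ec (fun z => ind G z * (sq (packet s X f z))%:C%C)).
    by apply: eqE_ => z _; rewrite /ind -rmorphM.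
  have -> : form (M s) X f = Re (Ec (fun z => trig S cc z * (sq (packet s X f z))%:C%C)).
    rewrite form_expand// Re_sum; apply: eq_bigr => n _; by rewrite Re_sum.
  rewrite -ReN -ReD -EcN// -EcD//; last exact: cibN.
  apply: (le_trans (nr_Re _)); apply: le_trans (cl s X f uX).
  apply: (le_trans (nr_Ec _)); first by apply: cibD => //; exact: cibN.
  rewrite le_eqVlt; apply/orP; left; apply/eqP/eqE_ => z _.
  by rewrite -mulrBl nrM nrC ger0_norm ?sq_ge0.
Qed.

Section banded.
Variables (K : nat) (B : R) (M : d.-tuple int -> d.-tuple int -> R[i]).
Hypotheses (B0 : 0 <= B) (MB : forall n m, nr (M n m) <= B) (MK : forall n m, M n m != 0 -> close K n m).

Lemma close_sym n m : close K n m = close K m n.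
Proof.
rewrite /close; congr andb; last by rewrite distnC.
by apply: eq_forallb => l; rewrite distnC.
Qed.

(** Schur's test: a row of the band has at most (2K+1)^d entries. *)
Lemma schur X f : uniq X ->
  \sum_(n <- X) \sum_(m <- X) nr (f n) * nr (f m) * nr (M n m) <=
  B * ((2 * K).+1 ^ d)%:R * \sum_(n <- X) sq (f n).
Proof.
move=> uX; set D : R := ((2 * K).+1 ^ d)%:R.
pose ch n m : R := (close K n m)%:R.
have ch0 n m : 0 <= ch n m by exact: ler0n.
have cD n : \sum_(m <- X) ch n m <= D.
  have -> : \sum_(m <- X) ch n m = (size [seq m <- X | close K n m])%:R.
    by rewrite size_filter -sum1_count natr_sum [RHS]big_mkcond; apply: eq_bigr => m _; rewrite /ch; case: close.
  by rewrite ler_nat size_close.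
apply: (@le_trans _ _ (\sum_(n <- X) \sum_(m <- X) (B / 2 * (sq (f n) * ch n m) + B / 2 * (sq (f m) * ch n m)))).
  apply: ler_sum => n _; apply: ler_sum => m _; rewrite /ch.
  have [cl|cl] := boolP (close K n m).
    rewrite !mulr1 !sqE; have := MB n m; have := nr_ge0 (f n); have := nr_ge0 (f m); have := nr_ge0 (M n m).
    move: (nr (f n)) (nr (f m)) (nr (M n m)) => x y w w0 y0 x0 wB.
    have h1 : x * y * w <= x * y * B by rewrite ler_wpM2l// mulr_ge0.
    have h2 : 0 <= B * (x - y) ^+ 2 by rewrite mulr_ge0// sqr_ge0.
    nra.
  have -> : M n m = 0 by apply/eqP; apply: contraNT cl; exact: MK.
  by rewrite nr0 !mulr0 addr0.
under eq_bigr do rewrite big_split/=.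
rewrite big_split/= [X in _ + X]exchange_big/=.
have e1 : \sum_(n <- X) \sum_(m <- X) B / 2 * (sq (f n) * ch n m) <= B / 2 * D * \sum_(n <- X) sq (f n).
  rewrite mulr_sumr; apply: ler_sum => n _; rewrite -!mulr_sumr -[leRHS]mulrA; apply: ler_wpM2l; first exact: divr_ge0.
  by rewrite mulrC ler_wpM2r ?sq_ge0.
have e2 : \sum_(m <- X) \sum_(n <- X) B / 2 * (sq (f m) * ch n m) <= B / 2 * D * \sum_(n <- X) sq (f n).
  rewrite mulr_sumr; apply: ler_sum => m _; rewrite -!mulr_sumr -[leRHS]mulrA; apply: ler_wpM2l; first exact: divr_ge0.
  rewrite mulrC ler_wpM2r ?sq_ge0//; apply: le_trans (cD m).
  by rewrite le_eqVlt; apply/orP; left; apply/eqP/eq_bigr => n _; rewrite /ch close_sym.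
lra.
Qed.

(** A pair of close frequencies is separated by at most d K of the L offsets,
    so the energy cut is small on average over the offset. *)
Lemma good_offset (L : nat) X f : (0 < L)%N -> uniq X -> exists o : 'I_L,
  \sum_(t <- undup (map (tile L o) X)) form M [seq n <- X | tile L o n == t] f <=
  form M X f + (d * K)%:R / L%:R * (B * ((2 * K).+1 ^ d)%:R * \sum_(n <- X) sq (f n)).
Proof.
move=> L0 uX; set S := _ * \sum_(n <- X) sq (f n).
have L0r : 0 < L%:R :> R by rewrite ltr0n.
pose g n m := Re ((f n)^*%C * f m * M n m).
pose cut (o : 'I_L) n m : R := g n m * (tile L o n == tile L o m)%:R.
pose D o := \sum_(n <- X) \sum_(m <- X) cut o n m.
have DE o : D o = \sum_(t <- undup (map (tile L o) X)) form M [seq n <- X | tile L o n == t] f.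
  rewrite /D (sum_keys2 (key := tile L o)); last first.
    by move=> n m _ _ /negbTE ne; rewrite /cut ne mulr0.
  apply: eq_bigr => t _; apply: eq_big_seq => n; rewrite mem_filter => /andP[/eqP tn _].
  apply: eq_big_seq => m; rewrite mem_filter => /andP[/eqP tm _].
  by rewrite /cut tn tm eqxx mulr1.
have sumD : \sum_(o < L) D o <= L%:R * (form M X f + (d * K)%:R / L%:R * S).
  have -> : L%:R * (form M X f + (d * K)%:R / L%:R * S) = L%:R * form M X f + (d * K)%:R * S.
    by field; rewrite gt_eqF.
  rewrite -lerBlDl -(subr_ge0) /D.
  have -> : (d * K)%:R * S - (\sum_(o < L) \sum_(n <- X) \sum_(m <- X) cut o n m - L%:R * form M X f) =
     (d * K)%:R * S + \sum_(o < L) (\sum_(n <- X) \sum_(m <- X) (g n m - cut o n m)).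
    rewrite opprB; congr (_ + _); under [RHS]eq_bigr do under eq_bigr do rewrite sumrB.
    under [RHS]eq_bigr do rewrite sumrB.
    by rewrite [RHS]sumrB [in RHS]sumr_const card_ord mulr_natl.
  rewrite exchange_big/=; under [X in _ + X]eq_bigr do rewrite exchange_big/=.
  rewrite -lerBlDl sub0r.
  apply: (@le_trans _ _ (\sum_(n <- X) \sum_(m <- X) - ((d * K)%:R * (nr (f n) * nr (f m) * nr (M n m))))).
    under [leRHS]eq_bigr do rewrite sumrN -mulr_sumr.
    rewrite sumrN -mulr_sumr lerN2 ler_wpM2l//.
    exact: schur.
  apply: ler_sum => n _; apply: ler_sum => m _.
  have -> : \sum_(o < L) (g n m - cut o n m) = g n m * (\sum_(o < L) (tile L o n != tile L o m))%N%:R.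
    rewrite natr_sum mulr_sumr; apply: eq_bigr => o _; rewrite /cut.
    by case: (tile L o n == tile L o m); rewrite /= ?mulr1 ?mulr0 ?subrr ?subr0.
  have [M0|M0] := eqVneq (M n m) 0; first by rewrite /g M0 !mulr0 nr0 !mulr0 oppr0 mul0r.
  have cl := tile_separating L0 (MK M0).
  have h1 : `|g n m| <= nr (f n) * nr (f m) * nr (M n m).
    by apply: (le_trans (nr_Re _)); rewrite !nrM nrJ.
  rewrite -(ler_nat R) in cl; move: cl h1; move: ((\sum_(o < L) _)%N%:R) (ler0n R (\sum_(o < L) (tile L o n != tile L o m))%N) => k k0 kd h1.
  have h2 := ler_norm (- g n m); rewrite normrN in h2.
  have h3 : 0 <= nr (f n) * nr (f m) * nr (M n m) by rewrite !mulr_ge0 ?nr_ge0.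
  have h4 : - g n m <= nr (f n) * nr (f m) * nr (M n m) by lra.
  have h5 : k * - g n m <= k * (nr (f n) * nr (f m) * nr (M n m)) by rewrite ler_wpM2l.
  have h6 : k * (nr (f n) * nr (f m) * nr (M n m)) <= (d * K)%:R * (nr (f n) * nr (f m) * nr (M n m)) by rewrite ler_wpM2r.
  by rewrite lerNl; lra.
apply/not_existsP => hno.
have : L%:R * (form M X f + (d * K)%:R / L%:R * S) < \sum_(o < L) D o.
  have -> : L%:R * (form M X f + (d * K)%:R / L%:R * S) =
     \sum_(o < L) (form M X f + (d * K)%:R / L%:R * S) by rewrite sumr_const card_ord mulr_natl.
  apply: ltr_sum; first by apply/hasP; exists (Ordinal L0) => //; rewrite mem_index_enum.
  by move=> o _; rewrite ltNge; apply/negP => h; apply: (hno o); rewrite -DE.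
by rewrite ltNge sumD.
Qed.

End banded.
End clusters.

(** * Observability of one-way waves *)

Section close_differences.
Context {d : nat}.
Implicit Types (n m k : d.-tuple int).

(** Directions along which frequencies of Y interact. *)
Definition cdiffs K (Y : seq (d.-tuple int)) : seq 'rV[rat]_d :=
  [seq vec p.1 - vec p.2 | p <- [seq (n, m) | n <- Y, m <- Y] & close K p.1 p.2].

Lemma cdiffsP K Y n m : n \in Y -> m \in Y -> close K n m -> vec n - vec m \in span (cdiffs K Y).
Proof.
move=> nY mY c; apply: memv_span; apply/mapP; exists (n, m) => //.
by rewrite mem_filter c; apply/allpairsP; exists (n, m).
Qed.

Definition boxvec K (g : {ffun 'I_d -> 'I_(2 * K).+1}) : d.-tuple int := [tuple (g l)%:Z - K%:Z | l < d].

Lemma boxvecP K k : (forall l, (absz (tnth k l) <= K)%N) -> exists g : {ffun 'I_d -> 'I_(2 * K).+1}, k = boxvec g.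
Proof.
move=> h; exists [ffun l => inord (absz (tnth k l + K%:Z))].
apply: eq_from_tnth => l; rewrite tnth_mktuple ffunE inordK; have := h l; lia.
Qed.

Lemma dot_le n k (L K : nat) : (forall l, (absz (tnth n l) <= L)%N) -> (forall l, (absz (tnth k l) <= K)%N) ->
  (absz (dot n k) <= d * (L * K))%N.
Proof.
move=> hn hk; rewrite -lez_nat abszE /dot; apply: (le_trans (ler_norm_sum _ _ _)).
apply: (@le_trans _ _ (\sum_(l < d) (L * K)%N%:Z)); last first.
  by rewrite sumr_const card_ord -mulr_natr natz -PoszM mulnC.
by apply: ler_sum => l _; rewrite normrM -!abszE -PoszM lez_nat leq_mul.
Qed.

(** g codes a short vector of V that is almost orthogonal to n. *)
Definition flat K (L : nat) (V : {vspace 'rV[rat]_d}) n (g : {ffun 'I_d -> 'I_(2 * K).+1}) :=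
  (vec (boxvec g) \in V) && (absz (dot n (boxvec g)) <= L)%N.

Definition bad K L V n := (V <= span [seq vec (boxvec g) | g <- enum (@flat K L V n)])%VS.

(** A bad frequency is determined by its scalar products with short vectors
    that span V, and these products are bounded integers. *)
Lemma size_bad K L X : uniq X ->
  (size [seq n <- X | bad K L (span (diffs X)) n] <= #|{ffun {ffun 'I_d -> 'I_(2 * K).+1} -> option 'I_(2 * L).+1}|)%N.
Proof.
move=> uX; set V := span _.
apply: (@size_inj_le _ _ _ (fun n => [ffun g => if @flat K L V n g then Some (inord (absz (dot n (boxvec g) + L%:Z))) else None])).
  by rewrite filter_uniq.
move=> n m; rewrite !mem_filter => /andP[bn nX] /andP[_ mX] /ffunP h.
apply: vec_inj; apply/eqP; rewrite -subr_eq0; apply/eqP.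
apply: (@rdot_span _ [seq vec (boxvec g) | g <- enum (@flat K L V n)]).
  by apply: (subvP bn); exact: diffs_span.
move=> v /mapP[g]; rewrite mem_enum => fg ->.
have := h g; rewrite !ffunE (_ : @flat K L V n g = true)//; case: ifP => // fm [].
rewrite -vec_sub rdot_vec dot_sub => /(congr1 val) /=.
have {}fg : @flat K L V n g by [].
case/andP: fg => _ fg; case/andP: fm => _ fm.
rewrite !inordK; [|lia|lia] => e.
by have -> : dot n (boxvec g) - dot m (boxvec g) = 0 by lia.
Qed.

(** An interaction k = n' - m' inside the tile of n satisfies 2 n.k = |n'|^2 -
    |m'|^2 + (2n - n' - m').k, which is bounded. Hence n would be bad if the
    interactions of its tile spanned all differences. *)
Lemma good_tile_dim K (L o : nat) X Y n r : (0 < L)%N -> (rk X <= r.+1)%N -> n \in Y ->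
  {subset Y <= X} -> (forall m, m \in Y -> tile L o m = tile L o n) ->
  ~~ bad K (K + d * (2 * L * K)) (span (diffs X)) n -> (\dim (span (cdiffs K Y)) <= r)%N.
Proof.
move=> L0 rX nY YX tY; apply: contraR; rewrite -ltnNge => rF; set V := span _.
have FV : (span (cdiffs K Y) <= V)%VS.
  apply/span_subvP => v /mapP[[n' m']]; rewrite mem_filter => /andP[_ /allpairsP[[a b]/= [aY bY [-> ->]]]] ->.
  by apply: diffs_span; exact: YX.
have FE : span (cdiffs K Y) = V by apply/eqP; rewrite eqEdim FV; exact: leq_trans rX rF.
rewrite /bad -[X in (X <= _)%VS]FE; apply/span_subvP => v /mapP[[n' m']] /=.
rewrite mem_filter => /andP[/= cl /allpairsP[[a b]/= [aY bY [ea eb]]]] ->; subst n' m'.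
have [/forallP c1 c2] := andP cl.
have [g gE] := @boxvecP K (tsub a b) (fun l => eq_ind_r (fun x => (absz x <= K)%N) (c1 l) (tnth_mktuple _ l)).
rewrite -vec_sub gE; apply: memv_span; apply/mapP; exists g => //; rewrite mem_enum.
apply/andP; split; first by rewrite -gE vec_sub; apply: diffs_span; exact: YX.
rewrite -gE.
have h1 l : (absz (tnth (tsub n a) l) <= L)%N.
  by rewrite tnth_mktuple ltnW// (@tile_dist _ L o)// tY.
have h2 l : (absz (tnth (tsub n b) l) <= L)%N.
  by rewrite tnth_mktuple ltnW// (@tile_dist _ L o)// tY.
have h3 l : (absz (tnth (tsub a b) l) <= K)%N by rewrite tnth_mktuple.
have := dot_le h1 h3; have := dot_le h2 h3; rewrite !dot_sub; have := dot_isqn a b.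
move: c2; have -> : (d * (2 * L * K) = 2 * (d * (L * K)))%N by ring.
move: (dot a _) (dot b _) (dot n _) (d * (L * K))%N => x y z w; lia.
Qed.

End close_differences.

Section cluster_induction.
Context {R : realType} (d : nat).
Notation N := d.+1.
Notation E := (@tint R N).
Variables (G : set (Rn R N)).
Hypotheses (mG : measurable G) (aG : trigapprox (ind G)) (posG : 0 < E (\1_G : _ -> R)).
Notation observed1 := (observed1 G).

Lemma observed1_ge0 s X f : 0 <= observed1 s X f.
Proof. by apply: Ege0 => z _; rewrite mulr_ge0 ?sq_ge0//; have /andP[] := indR_01 G z. Qed.

Lemma eq_observed1 s X f f' : {in X, f =1 f'} -> observed1 s X f = observed1 s X f'.
Proof. by move=> h; rewrite /observed1 /packet; apply: eqE_ => z _; congr (_ * sq _); apply: eq_big_seq => n /h ->. Qed.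

Lemma observed1_filter s X f (Q : pred (d.-tuple int)) : (forall n, ~~ Q n -> f n = 0) ->
  observed1 s X f = observed1 s [seq n <- X | Q n] f.
Proof.
move=> h; apply: eqE_ => z _; congr (_ * sq _); rewrite /packet big_filter [RHS]big_mkcond.
by apply: eq_bigr => n _; case: ifP => // /negbT /h ->; rewrite mul0r.
Qed.

Definition observable_rk r (delta : R) := forall s X f, uniq X -> (rk X <= r)%N -> delta * \sum_(n <- X) sq (f n) <= observed1 s X f.

Lemma observable_rk0 : observable_rk 0 (E (\1_G : _ -> R)).
Proof.
move=> s X f uX; rewrite leqn0 dimv_eq0 => /eqP packet0.
have eqX n m : n \in X -> m \in X -> n = m.
  move=> nX mX; apply: vec_inj; apply/eqP; rewrite -subr_eq0 -memv0 -packet0; exact: diffs_span.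
case: X uX eqX {packet0} => [_ _|n X uX eqX]; first by rewrite big_nil mulr0 observed1_ge0.
have Xn : X = [::].
  case: X uX eqX => // m X /= /andP[nX _] eqX; move: nX; rewrite (eqX n m) ?mem_head//.
  by rewrite inE mem_head orbT.
rewrite Xn; pose f' m := if m == n then f n else 0.
have ff : {in [:: n], f =1 f'} by move=> m; rewrite inE /f' => /eqP ->; rewrite eqxx.
rewrite (eq_observed1 s ff) (@observed1_single _ _ _ mG s [:: n] f' n)//; last by move=> m; rewrite /f' => /negbTE ->.
by rewrite !big_seq1 (ff n) ?mem_head// lexx.
Qed.

(** Frequencies in different cosets of the span do not interact, so the form
    splits into forms of families of rank at most r. *)
Lemma decoupled_form K s (M : d.-tuple int -> d.-tuple int -> R[i]) (Y : seq (d.-tuple int)) (f : d.-tuple int -> R[i]) r delta (e : R) : uniq Y -> (\dim (span (cdiffs K Y)) <= r)%N ->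
  observable_rk r delta -> (forall n m, M n m != 0 -> close K n m) ->
  (forall X f, uniq X -> `|observed1 s X f - form M X f| <= e * \sum_(n <- X) sq (f n)) ->
  (delta - e) * \sum_(n <- Y) sq (f n) <= form M Y f.
Proof.
move=> uY dF lo MK cl; set F := span _ in dF.
(* the component off F labels the coset of n *)
pose key n := vec n - projv F (vec n).
have keyE n m : key n - key m = (vec n - vec m) - projv F (vec n - vec m).
  by rewrite /key [projv F (_ - _)]linearB !opprD !opprK addrACA.
rewrite /form (sum_keys2 (key := key)); last first.
  move=> n m nY mY /eqP ne; have [->|/MK c] := eqVneq (M n m) 0; first by rewrite mulr0.
  case: ne; apply/eqP; rewrite -subr_eq0 keyE projv_id ?subrr//; exact: cdiffsP.
rewrite (sum_keys Y key) mulr_sumr; apply: ler_sum => k _; rewrite -[X in _ * X <= _]big_filter.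
set Z := [seq _ <- _ | _].
have uZ : uniq Z by rewrite filter_uniq.
have rZ : (rk Z <= r)%N.
  apply: leq_trans dF; apply: dimvS; apply: rk_sub => n m.
  rewrite !mem_filter => /andP[/eqP kn _] /andP[/eqP km _].
  have /eqP := keyE n m; rewrite kn km subrr eq_sym subr_eq0 => /eqP ->; exact: memv_proj.
have := lo s Z f uZ rZ; have := cl Z f uZ; rewrite ler_norml /form => /andP[_].
rewrite mulrBl; lra.
Qed.

(** A tiling cuts the family at little cost. Away from the bad frequencies,
    whose number is bounded, each tile decouples into families of rank at most
    r; the bad ones are added afterwards. *)
Lemma observable_rkS r delta : 0 < delta -> observable_rk r delta -> exists2 delta' : R, 0 < delta' & observable_rk r.+1 delta'.
Proof.
move=> d0 lo; pose e := delta / 8; have e0 : 0 < e by rewrite divr_gt0.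
have [K [B [M [B0 MB MK cl]]]] := band_form mG aG e0.
pose D : R := B * ((2 * K).+1 ^ d)%:R.
have D0 : 0 <= D by rewrite mulr_ge0.
have [L L0 hL] : exists2 L : nat, (0 < L)%N & (d * K)%:R / L%:R * D <= e.
  exists (Num.truncn ((d * K)%:R * D / e)).+1 => //.
  rewrite mulrAC ler_pdivrMr ?ltr0n// [leRHS]mulrC -ler_pdivrMr//.
  exact/ltW/truncnS_gt.
(* the bound on 2 n.k inside a tile *)
pose L' := (K + d * (2 * L * K))%N.
have d20 : 0 < delta / 2 by rewrite divr_gt0.
have [d' d'0 add] := add_frequencies1 mG aG posG #|{ffun {ffun 'I_d -> 'I_(2 * K).+1} -> option 'I_(2 * L').+1}| d20.
exists d' => // s X f uX rX.
pose f' n := if n \in X then f n else 0.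
have ff : {in X, f =1 f'} by move=> n nX; rewrite /f' nX.
rewrite (eq_observed1 s ff) (eq_big_seq (fun n => sq (f' n))); last by move=> n nX; rewrite ff.
set V := span (diffs X).
apply: (add s (mem X) [seq n <- X | bad K L' V n] (size_bad K L' uX)) => //; last first.
  by move=> n; rewrite /f' => /negbTE; rewrite topredE => ->.
move=> {f f' ff} Y f uY hf.
pose Q n := (n \in X) && (n \notin [seq n <- X | bad K L' V n]).
rewrite (@observed1_filter s Y f Q)//.
have -> : \sum_(n <- Y) sq (f n) = \sum_(n <- [seq n <- Y | Q n]) sq (f n).
  rewrite big_filter [RHS]big_mkcond; apply: eq_bigr => n _.
  by case: ifP => // /negbT /hf ->; rewrite sq0.
set Z := [seq _ <- _ | _]; have uZ : uniq Z by rewrite filter_uniq.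
have ZQ n : n \in Z -> n \in X /\ ~~ bad K L' V n.
  by rewrite mem_filter /Q mem_filter => /andP[/andP[-> +] _] /=; rewrite andbT.
case: (good_offset B0 (MB s) (MK s) f L0 uZ) => o ho.
have tiles : (delta - e) * \sum_(n <- Z) sq (f n) <=
    \sum_(t <- undup (map (tile L o) Z)) form (M s) [seq n <- Z | tile L o n == t] f.
  rewrite (sum_keys Z (tile L o)) mulr_sumr big_seq [leRHS]big_seq; apply: ler_sum => t.
  rewrite mem_undup => /mapP[n nZ tn].
  rewrite -[\sum_(j <- Z | _) _]big_filter; apply: (@decoupled_form K s (M s) _ _ r) => //; [by rewrite filter_uniq| |by move=> n' m'; exact: MK|by move=> *; exact: cl].
  apply: (@good_tile_dim _ K L o X _ n) => //.
  - by rewrite mem_filter tn eqxx.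
  - by move=> m; rewrite mem_filter => /andP[_ /ZQ[]].
  - by move=> m; rewrite mem_filter -tn => /andP[/eqP].
  - by have [] := ZQ n nZ.
have := cl s Z f uZ; rewrite ler_norml => /andP[h1 _].
have S0 := sumsq_ge0 Z f; have := mulr_ge0 (ltW d0) S0.
have : (d * K)%:R / L%:R * (B * ((2 * K).+1 ^ d)%:R * \sum_(n <- Z) sq (f n)) <= e * \sum_(n <- Z) sq (f n).
  by rewrite [leLHS]mulrA ler_wpM2r.
move: tiles h1 ho; rewrite mulrBl /e; move: (\sum_(n <- Z) _) => S; lra.
Qed.

Lemma one_sided : exists2 delta : R, 0 < delta & forall s X f, uniq X -> delta * \sum_(n <- X) sq (f n) <= observed1 s X f.
Proof.
have [delta d0 lo] : exists2 delta : R, 0 < delta & observable_rk d delta.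
  have all r : exists2 delta : R, 0 < delta & observable_rk r delta.
    elim: r => [|r [delta d0 /(observable_rkS d0)]//]; exists (E (\1_G : _ -> R)) => //; exact: observable_rk0.
  exact: all.
by exists delta => // s X f uX; apply: lo => //; exact: rk_le.
Qed.

End cluster_induction.

(** * Oscillation in time *)

Section oscillation.
Context {R : realType} (N0 : nat).
Notation N := N0.+1.
Notation mu := (@lebesgueRn R N).
Notation T := (@torus R N).
Notation E := (@tint R N).
Notation Ec := (@Ec R N).

Lemma E_eq0 (F : Rn R N -> R) : ib F -> (forall z, T z -> 0 <= F z) -> E F = 0 ->
  mu.-negligible (T `&` [set z | F z != 0]).
Proof.
move=> iF F0 EF.
have mT := @measurable_torus R N.
have mF : measurable_fun T (EFin \o F) by have /integrableP[] := iF.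
have h : (\int[mu]_(z in T) `|(EFin \o F) z| = 0)%E.
  rewrite (eq_integral (EFin \o F)); last first.
    by move=> z /[!inE] Tz; rewrite /= ger0_norm// F0.
  have fin := integrable_fin_num mT iF.
  by rewrite -(fineK fin); congr (_%:E).
have [B [mB B0 sB]] := (ae_eq_integral_abs mu mT mF).1 h.
exists B; split=> // z [Tz /eqP Fz]; apply: sB => /= hz.
by have := hz Tz => -[].
Qed.

Lemma null_hyperplane (D : set R) : countable D -> measurable (D : set (measurableTypeR R)) ->
  mu (T `&` [set z | D (tnth z ord0)]) = 0.
Proof.
move=> cD mD.
have -> : T `&` [set z | D (tnth z ord0)] = box (fun l : 'I_N => circle `&` (if l == ord0 then D else setT)).
  rewrite torusE; apply/seteqP; split => z /=.
    by move=> [Tz Dz] l; split; [exact: Tz|case: eqVneq => [->|]].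
  by move=> h; split=> [l|]; [have [] := h l|have [_ ] := h ord0; rewrite ?eqxx].
have mc : measurable (circle : set (measurableTypeR R)) by exact: measurable_itv.
rewrite lebesgueRn_box; last first.
  by move=> l; apply: measurableI => //; case: ifP => // _; exact: measurableT.
rewrite (bigD1 ord0)//= (@countable_lebesgue_measure0 R (circle `&` D)) ?mul0e//.
by apply: sub_countable cD; apply: subset_card_le => x [].
Qed.

Lemma cos_eq1 (x : R) : cos x = 1 -> exists k : int, x = k%:~R * (2 * pi).
Proof.
move=> cx; have p0 : 0 < 2 * pi :> R by rewrite mulr_gt0// pi_gt0.
pose k := Num.floor (x / (2 * pi)); exists k.
have /andP[k1 k2] : k%:~R <= x / (2 * pi) < (k + 1)%:~R by rewrite floor_itv.
pose y := x - k%:~R * (2 * pi).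
have cy : cos y = 1.
  have := congr1 (@complex.Re R) (expiD y (k%:~R * (2 * pi))).
  by rewrite expi_int2pi mulr1 /= => <-; rewrite /y subrK.
have y0 : 0 <= y by rewrite subr_ge0 -ler_pdivlMr.
have y2 : y < 2 * pi.
  by rewrite ltrBlDl -[ltRHS]/(_ + _) -{2}[2 * pi]mul1r -mulrDl -ltr_pdivrMr// (lt_le_trans k2)// rmorphD.
have : y = 0.
  apply/eqP; apply: contraTT isT => yn0.
  have := @cos_lt1 R y; rewrite lt_neqAle eq_sym yn0 y0 y2 cy ltxx; exact.
by rewrite /y => /eqP; rewrite subr_eq0 => /eqP.
Qed.

Lemma countable_phase (th : R) (w : R[i]) : th != 0 -> countable [set t | expi (th * t) = w].
Proof.
move=> th0; have [->|] := eqVneq [set t | expi (th * t) = w] set0; first exact: countable0.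
move=> /set0P[t0 /= ht0].
apply: (@sub_countable _ _ _ (range (fun k : int => t0 + k%:~R * (2 * pi) / th))); last first.
  exact: (sub_countable (card_image_le _ _) (countableP _)).
apply: subset_card_le => t /= ht.
have : cos (th * (t - t0)) = 1.
  have := congr1 (@complex.Re R) (expiD (th * t) (- (th * t0))).
  rewrite -mulrBr ht -ht0 expiNK/= => ->; exact.
move=> /cos_eq1[k hk]; exists k => //; rewrite -hk mulrAC divff// mul1r; ring.
Qed.

(** Equality in the triangle inequality would force exp (i th t) to be
    constant almost everywhere on G, and t to lie in a countable set. *)
Lemma oscillation (G : set (Rn R N)) (th : R) : measurable G -> 0 < E (\1_G : _ -> R) -> th != 0 ->
  nr (Ec (fun z => ind G z * expi (th * tnth z ord0))) < E (\1_G : _ -> R).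
Proof.
move=> mG posG th0; set I := Ec _; set g := E _.
have be : cbdd (fun z : Rn R N => expi (th * tnth z ord0) : R[i]).
  apply: cbdd_expi; apply: measurable_funM; first exact: measurable_cst.
  exact: (@measurable_tnth _ (measurableTypeR R) N ord0).
have bF : cbdd (fun z => ind G z * expi (th * tnth z ord0)) by apply: cbddM => //; exact: cbdd_ind.
have le : nr I <= g.
  apply: (le_trans (nr_Ec (cbdd_cib bF))); rewrite le_eqVlt; apply/orP; left; apply/eqP/eqE_ => z _.
  by rewrite nrM nr_expi mulr1 nrC ger0_norm//; have /andP[] := indR_01 G z.
rewrite lt_neqAle le andbT; apply/eqP => eq.
(* the constant value that exp (i th t) would have on G *)
pose w := I * (g^-1)%:C%C.
have sw : sq w = 1.
  rewrite sqM sqC sqE eq -exprMn divff ?expr1n// gt_eqF//.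
have Ig : I = w * g%:C%C by rewrite /w -mulrA -rmorphM mulVf ?gt_eqF// mulr1.
pose D := [set t : R | expi (th * t) = w].
have mexp : measurable (D : set (measurableTypeR R)).
  exact: countable_measurable (countable_phase w th0).
pose F z := \1_G z * (1 - Re (w^*%C * expi (th * tnth z ord0))).
have bw : cbdd (fun z : Rn R N => w^*%C * expi (th * tnth z ord0)) by apply: cbddM => //; exact: cbdd_cst.
have bre : bdd (fun z : Rn R N => Re (w^*%C * expi (th * tnth z ord0))) by case: bw.
have iF : ib F.
  by apply/bdd_ib/bddM; [exact: bdd_indic|apply: bddB => //; exact: bdd_cst].
have nw (z : Rn R N) : sq (w^*%C * expi (th * tnth z ord0)) = 1 by rewrite sqM sqJ sw sq_expi mulr1.
have F0 z : T z -> 0 <= F z.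
  move=> _; apply: mulr_ge0; first by have /andP[] := indR_01 G z.
  by rewrite subr_ge0; apply: (le_trans (ler_norm _)); apply: (le_trans (nr_Re _)); rewrite nrE nw sqrtr1.
have EF : E F = 0.
  have -> : E F = g - E (fun z => Re (w^*%C * (ind G z * expi (th * tnth z ord0)))).
    rewrite -EB; [|exact/bdd_ib/bdd_indic|].
      apply: eqE_ => z _; rewrite /F mulrBr mulr1; congr (_ - _).
      by rewrite [_^*%C * (_ * _)]mulrCA /ind [RHS]ReM/= mul0r subr0.
    have : cbdd (fun z : Rn R N => w^*%C * (ind G z * expi (th * tnth z ord0))) by apply: cbddM => //; exact: cbdd_cst.
    by case=> /bdd_ib.
  have -> : E (fun z => Re (w^*%C * (ind G z * expi (th * tnth z ord0)))) = Re (w^*%C * I).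
    by rewrite -EcZ//; exact: cbdd_cib.
  by rewrite Ig mulrA [_^*%C * w]mulrC mulJE sw -rmorphM ReC mul1r subrr.
have [B [mB B0 sB]] := E_eq0 iF F0 EF.
have GB : T `&` G `<=` B `|` (T `&` [set z | D (tnth z ord0)]).
  move=> z [Tz Gz]; have [Fz|Fz] := eqVneq (F z) 0; last by left; apply: sB.
  right; split=> //=; move: Fz; rewrite /F indicE mem_set// mul1r => /eqP; rewrite subr_eq0 => /eqP r1.
  have /eqP : Im (w^*%C * expi (th * tnth z ord0)) ^+ 2 = 0 by have := nw z; rewrite /sq -r1 expr1n; lra.
  rewrite sqrf_eq0 => /eqP i1.
  have e1 : w^*%C * expi (th * tnth z ord0) = 1 by apply: ceq.
  have : w * (w^*%C * expi (th * tnth z ord0)) = w by rewrite e1 mulr1.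
  by rewrite mulrA mulJE sw mul1r.
have mz := measurable_torus (R := R) (N := N).
have mGT : measurable (T `&` G) by exact: measurableI.
have mD : measurable (T `&` [set z | D (tnth z ord0)] : set (Rn R N)).
  apply: measurableI => //; rewrite -[X in measurable X]setTI.
  exact: (@measurable_tnth _ (measurableTypeR R) N ord0).
have : (mu (T `&` G) <= 0)%E.
  rewrite -[leRHS]adde0 -[X in (_ <= X + _)%E]B0 -(null_hyperplane (countable_phase w th0) mexp).
  apply: le_trans (measureU2 _ _ _) => //; apply: le_measure; rewrite ?inE//; exact: measurableU.
have -> : mu (T `&` G) = g%:E.
  have fin := integrable_fin_num mz (bdd_ib (bdd_indic mG)).
  rewrite /g /tint /Rintegral fineK//.
  by rewrite integral_indic// setIC.
by rewrite lee_fin leNgt posG.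
Qed.

End oscillation.

(** * Observability of two-way waves *)

Lemma sphere_coord d (K : nat) (n : d.-tuple int) : (isqn n <= K%:Z) -> forall l, (absz (tnth n l) <= K)%N.
Proof.
move=> h l; have : tnth n l ^+ 2 <= isqn n.
  by rewrite /isqn (bigD1 l)//= lerDl sumr_ge0// => i _; exact: sqr_ge0.
move: (tnth n l) (isqn n) h => x y h1 h2; have {h1}h2 : x * x <= K%:Z by exact: le_trans h2 h1.
by case: x h2 => x /=; lia || nia.
Qed.

Section two_sided.
Context {R : realType} (d : nat).
Notation N := d.+1.
Notation T := (@torus R N).
Notation E := (@tint R N).
Notation Ec := (@Ec R N).
Implicit Types (n m : d.-tuple int) (s : bool) (X : seq (d.-tuple int)) (a b f : d.-tuple int -> R[i]).
Implicit Types (P : d.-tuple int -> bool -> bool).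
Variables (c : R) (G : set (Rn R N)).
Hypotheses (mG : measurable G) (aG : trigapprox (ind G)) (posG : 0 < E (\1_G : _ -> R)).
Notation W := (fun z => ind G z * phase c z ^+ 2).
Hypothesis aW : trigapprox W.
Notation observed := (observed c G).
Notation observable := (observable c G).

Lemma sq_waves X a b z : sq (waves c X a b z) =
  sq (packet true X a z) + sq (packet false X b z) + 2 * Re (phase c z ^+ 2 * (packet true X a z * (packet false X b z)^*%C)).
Proof.
rewrite /waves sqDE !sqM sqJ sq_phase !mul1r; congr (_ + 2 * Re _).
by rewrite conjcM conjcK; ring.
Qed.

Lemma cbdd_W : cbdd W.
Proof. by apply: cbddM; [exact: cbdd_ind|apply: cbddM; exact: cbdd_phase]. Qed.

Definition cross X a b (w : Rn R N -> R[i]) := Ec (fun z => w z * (packet true X a z * (packet false X b z)^*%C)).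

Lemma cbdd_packet2 X a b : cbdd (fun z => packet true X a z * (packet false X b z)^*%C : R[i]).
Proof. by apply: cbddM; [exact: cbdd_packet|exact/cbddJ/cbdd_packet]. Qed.

Lemma observed_cross X a b : observed X a b = observed1 G true X a + observed1 G false X b + 2 * Re (cross X a b W).
Proof.
have b1 : bdd (fun z => \1_G z * sq (packet true X a z)) by apply: bddM; [exact: bdd_indic|exact/bdd_sq/cbdd_packet].
have b2 : bdd (fun z => \1_G z * sq (packet false X b z)) by apply: bddM; [exact: bdd_indic|exact/bdd_sq/cbdd_packet].
have [b3 _] : cbdd (fun z => W z * (packet true X a z * (packet false X b z)^*%C)) by apply: cbddM; [exact: cbdd_W|exact: cbdd_packet2].
rewrite /observed1 /cross /= -ED; [|exact: bdd_ib|exact: bdd_ib].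
rewrite -EZ; last exact: bdd_ib.
rewrite -ED; [|by apply: ibD; exact: bdd_ib|by apply: ibZ; exact: bdd_ib].
apply: eqE_ => z _; rewrite sq_waves !mulrDr -[X in _ = _ + 2 * Re X]mulrA [in RHS]ReM ReC ImC mul0r subr0; ring.
Qed.

(** The time frequency |n|^2 + |m|^2 of the interaction exceeds those of the
    polynomial. *)
Lemma cross_trig X a b (S : seq (N.-tuple int)) cc (K : nat) :
  (forall k, k \in S -> (absz (tnth k ord0) <= K)%N) ->
  (forall n, (isqn n <= K%:Z) -> a n = 0) -> (forall n, (isqn n <= K%:Z) -> b n = 0) ->
  cross X a b (trig S cc) = 0.
Proof.
move=> SK ha hb; rewrite /cross.
have bp := @cbdd_trig R N S cc.
have -> : Ec (fun z => trig S cc z * (packet true X a z * (packet false X b z)^*%C)) =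
    Ec (fun z => \sum_(n <- X) \sum_(m <- X) a n * (b m)^*%C * (trig S cc z * (ewave (tsub (lam false m) (lam true n)) z)^*%C)).
  apply: eq_Ec => z _; rewrite /packet conjc_sum mulr_suml mulr_sumr; apply: eq_bigr => n _.
  rewrite !mulr_sumr; apply: eq_bigr => m _; rewrite ewave_sub !conjcM conjcK; ring.
have i1 n m : cib (fun z => trig S cc z * (ewave (tsub (lam false m) (lam true n)) z)^*%C).
  exact/cib_fc/cbdd_cib.
have i2 n m : cib (fun z => a n * (b m)^*%C * (trig S cc z * (ewave (tsub (lam false m) (lam true n)) z)^*%C)).
  by apply: cibM => //; exact: cbdd_cst.
rewrite Ecsum => [|n]; last by apply: cib_sum.
rewrite big1// => n _; rewrite Ecsum// big1// => m _; rewrite EcZ//.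
have [aK|aK] := lerP (isqn n) K%:Z; first by rewrite ha// !mul0r.
have [bK|bK] := lerP (isqn m) K%:Z; first by rewrite hb// conjc0 mulr0 mul0r.
have kS : tsub (lam false m) (lam true n) \notin S.
  apply/negP => /SK; rewrite tnth_mktuple !lam0; lia.
by have := fc_trig_out (R := R) cc kS; rewrite /fc => ->; rewrite mulr0.
Qed.

(** For a polynomial weight the interaction of the two directions vanishes at
    high frequencies, and each direction is observable by itself. *)
Lemma high_frequency : exists (delta : R) (K : nat), 0 < delta /\ observable (fun n _ => K%:Z < isqn n) delta.
Proof.
have [d1 d10 one] := one_sided mG aG posG.
have [_ [S [cc [uS ->]]] cl] := aW (divr_gt0 d10 (ltr0Sn R 1)).
exists (d1 / 2), (\max_(k <- S) absz (tnth k ord0)); split; first by rewrite divr_gt0.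
set K := (\max_(k <- S) _)%N => X a b uX sP.
have bp := @cbdd_trig R N S cc.
have c0 : cross X a b (trig S cc) = 0.
  apply: (@cross_trig _ _ _ _ _ K).
  - by move=> k kS; rewrite /K; exact: (@leq_bigmax_seq _ S xpredT (fun k => absz (tnth k ord0)) _ kS isT).
  - by move=> n nK; apply: (sP n).1; rewrite -leNgt.
  - by move=> n nK; apply: (sP n).2; rewrite -leNgt.
have i1 w : cbdd w -> cbdd (fun z => w z * (packet true X a z * (packet false X b z)^*%C)).
  by move=> bw; apply: cbddM => //; exact: cbdd_packet2.
have bD : cbdd (fun z => W z - trig S cc z) by apply: cbddB => //; exact: cbdd_W.
have cB : cross X a b W = cross X a b (fun z => W z - trig S cc z).
  rewrite -[LHS]subr0 -c0 /cross -EcN; last exact/cbdd_cib/i1.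
  rewrite -EcD; [|exact/cbdd_cib/i1/cbdd_W|exact/cibN/cbdd_cib/i1].
  by apply: eq_Ec => z _; ring.
have bn := bdd_nr bD.
have hc : 2 * nr (cross X a b W) <= d1 / 2 * energy X a b.
  rewrite cB; apply: (@le_trans _ _ (2 * E (fun z => nr (W z - trig S cc z) * (nr (packet true X a z) * nr (packet false X b z))))).
    apply: ler_wpM2l => //; apply: (le_trans (nr_Ec (cbdd_cib (i1 _ bD)))).
    by rewrite le_eqVlt; apply/orP; left; apply/eqP/eqE_ => z _; rewrite !nrM nrJ.
  have b1 := bddM bn (bdd_sq (cbdd_packet true X a)); have b2 := bddM bn (bdd_sq (cbdd_packet false X b)).
  rewrite -EZ; last by apply/bdd_ib/bddM => //; apply: bddM; apply/bdd_nr/cbdd_packet.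
  apply: (@le_trans _ _ (E (fun z => nr (W z - trig S cc z) * sq (packet true X a z) + nr (W z - trig S cc z) * sq (packet false X b z)))).
    apply: Ele ; last move=> z _.
    - by apply/ibZ/bdd_ib/bddM => //; apply: bddM; apply/bdd_nr/cbdd_packet.
    - by apply: ibD; exact: bdd_ib.
    - rewrite !sqE mulrCA -mulrDr; apply: ler_wpM2l; first exact: nr_ge0.
      have := sqr_ge0 (nr (packet true X a z) - nr (packet false X b z)); nra.
  rewrite ED; [|exact: bdd_ib|exact: bdd_ib].
  by rewrite /energy big_split/= mulrDr; apply: lerD; exact: cl.
have := one true X a uX; have := one false X b uX.
rewrite observed_cross; move: (cross X a b W) hc => x; have := nr_Re x; rewrite ler_norml => /andP[+ _].
rewrite /energy big_split/=; lra.
Qed.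

(** On the resonant sphere only the forward wave is allowed. Off it, the
    interaction of the two waves is the oscillating integral of exp (2 i (c -
    |n|^2) t) over G. *)
Lemma single_frequency n : exists2 delta : R, 0 < delta &
  observable (fun m s => (s || ((isqn n)%:~R != c)) && (m == n)) delta.
Proof.
have g0 := posG; set g := E (\1_G : _ -> R) in g0 *.
pose th := 2 * (c - (isqn n)%:~R).
pose I := Ec (fun z => ind G z * expi (th * tnth z ord0)).
pose delta := if (isqn n)%:~R == c then g else g - nr I.
have dE : 0 < delta.
  rewrite /delta; case: eqP => // /eqP ne; rewrite subr_gt0; apply: oscillation => //.
  by rewrite /th mulf_neq0 ?pnatr_eq0// subr_eq0 eq_sym.
exists delta => // X a b uX sP.
have a0 m : m != n -> a m = 0 by move=> mn; apply: (sP m).1; rewrite (negbTE mn) andbF.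
have b0 m : m != n -> b m = 0 by move=> mn; apply: (sP m).2; rewrite (negbTE mn) andbF.
have [nX|nX] := boolP (n \in X); last first.
  rewrite /energy big_seq big1 ?mulr0.
    by apply: Ege0 => z _; rewrite mulr_ge0 ?sq_ge0//; have /andP[] := indR_01 G z.
  by move=> m mX; rewrite a0 ?b0 ?sq0 ?addr0//; apply: contraNneq nX => <-.
have only (f : d.-tuple int -> R) : (forall m, m != n -> f m = 0) -> \sum_(m <- X) f m = f n.
  by move=> f0; rewrite (bigD1_seq n)//= big1 ?addr0.
have NE : energy X a b = sq (a n) + sq (b n).
  by rewrite /energy only// => m mn; rewrite a0// b0// sq0 addr0.
rewrite observed_cross (@observed1_single _ _ _ mG _ _ _ n uX a0) (@observed1_single _ _ _ mG _ _ _ n uX b0) -/g NE.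
rewrite !only; [|by move=> m /b0 ->; rewrite sq0|by move=> m /a0 ->; rewrite sq0].
rewrite /delta; case: eqP => [nc|_].
  have bn : b n = 0 by apply: (sP n).2; rewrite /= nc eqxx.
  have -> : cross X a b W = 0.
    rewrite /cross -[RHS](@Ec0 R N); apply: eq_Ec => z _.
    rewrite /packet [X in X^*%C]big1_seq ?conjc0 ?mulr0// => m _.
    by have [->|/b0 ->] := eqVneq m n; rewrite ?bn mul0r.
  by rewrite bn sq0 !(mulr0, addr0).
have Vn s f z : (forall m, m != n -> f m = 0) -> packet s X f z = f n * ewave (lam s n) z.
  by move=> f0; rewrite /packet (bigD1_seq n)//= big1 ?addr0// => m /f0 ->; rewrite mul0r.
have -> : cross X a b W = a n * (b n)^*%C * I.
  rewrite /cross /I -EcZ; last first.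
    apply: cbdd_cib; apply: cbddM; first exact: cbdd_ind.
    apply: cbdd_expi; apply: measurable_funM; first exact: measurable_cst.
    exact: (@measurable_tnth _ (measurableTypeR R) N ord0).
  apply: eq_Ec => z _; rewrite !Vn// conjcM.
  have -> : expi (th * tnth z ord0) = phase c z ^+ 2 * (ewave (lam true n) z * (ewave (lam false n) z)^*%C).
    rewrite -ewave_sub /phase expi_pow /ewave -expiD; congr expi.
    rewrite /dotp big_ord_recl big1; last by move=> l _; rewrite tnth_mktuple !lamS subrr mul0r.
    rewrite addr0 tnth_mktuple !lam0 /th rmorphB/= rmorphN/=; ring.
  ring.
have h : - nr (a n * (b n)^*%C * I) <= Re (a n * (b n)^*%C * I).
  by have := nr_Re (a n * (b n)^*%C * I); rewrite ler_norml => /andP[].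
move: h; rewrite !nrM nrJ !sqE; move: (Re _) => x; have := nr_ge0 I.
move: (nr (a n)) (nr (b n)) (nr I) => p q i i0 h.
have := mulr_ge0 i0 (sqr_ge0 (p - q)); nra.
Qed.

Lemma observable_sub P P' delta : (forall n s, P' n s -> P n s) -> observable P delta -> observable P' delta.
Proof.
move=> h b X a b' uX sP; apply: b => // n; have [h1 h2] := sP n.
by split=> hP; [apply: h1|apply: h2]; apply: contra hP; exact: h.
Qed.

Definition nonresonant n s := s || ((isqn n)%:~R != c).

Lemma add_list (Z : seq (d.-tuple int)) delta : 0 < delta ->
  observable (fun n s => nonresonant n s && (n \notin Z)) delta -> exists2 delta' : R, 0 < delta' & observable nonresonant delta'.
Proof.
elim: Z delta => [|m Z IH] delta d0 h.
  by exists delta => //; apply: observable_sub h => n s; rewrite andbT.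
have [d1 d10 h1] := single_frequency m.
have [d2 d20 h2] := add_frequency c mG aG d0 d10.
apply: (IH d2 d20); apply: (h2 _ m).
  by apply: observable_sub h => n s; rewrite inE negb_or => /andP[/andP[-> ->] ->].
by apply: observable_sub h1 => n s /andP[/andP[hn _] /eqP nm]; rewrite nm eqxx andbT -nm.
Qed.

Lemma finite_observability : exists2 delta : R, 0 < delta & observable nonresonant delta.
Proof.
have [delta [K [d0 h]]] := high_frequency.
pose Z := [seq @boxvec d K g | g <- enum {ffun 'I_d -> 'I_(2 * K).+1}].
apply: (@add_list Z delta d0); apply: observable_sub h => n s /andP[_ nZ].
rewrite ltNge; apply: contra nZ => nK; have [g ->] := boxvecP (sphere_coord nK).
by apply: map_f; rewrite mem_enum.
Qed.

End two_sided.

(** * Borel cores and cylinders *)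

Section borel_core.
Context {R : realType}.

(** The part of the torus outside A has a Borel cover of measure less than
    that of the torus; what the cover misses lies in A. *)
Lemma borel_core k (A : set (Rn R k)) : A `<=` torus k -> lebesgue_measurable A ->
  (0 < completed_lebesgueRn k A)%E ->
  exists B, [/\ measurable B, B `<=` A & (0 < lebesgueRn k B)%E].
Proof.
move=> AT mA A0; have mT := @measurable_torus R k.
set mu := lebesgueRn k in mA A0 *.
have extT : mu_ext mu (torus k) = mu (torus k) by exact: measurable_mu_extE.
have split : mu_ext mu (torus k) = (mu_ext mu A + mu_ext mu (torus k `\` A))%E.
  by rewrite (mA (torus k)) setIidr// setDE.
have Tfin : (mu (torus k) < +oo)%E by exact: lebesgueRn_torus_fin.
have lt : (mu_ext mu (torus k `\` A) < mu (torus k))%E.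
  have Afin : (mu_ext mu (torus k `\` A) < +oo)%E.
    by rewrite (le_lt_trans _ Tfin)// -extT; apply: le_mu_ext => x [].
  rewrite -extT split -[ltLHS]add0e lteD2rE// ge0_fin_numE//; exact: mu_ext_ge0.
have [_ [F [mF cF] <-] sF] := ereal_inf_lt lt.
have mU : measurable (\bigcup_k F k) by exact: bigcup_measurable.
exists (torus k `\` \bigcup_k F k); split.
- exact: measurableD.
- move=> x [Tx nFx]; apply: contrapT => nA; apply: nFx; exact: cF.
- have hU : (mu (\bigcup_k F k) < mu (torus k))%E.
    apply: le_lt_trans sF; exact: measure_sigma_subadditive.
  rewrite lt_neqAle measure_ge0 andbT eq_sym; apply/eqP => h0.
  have : (mu (torus k) <= mu (\bigcup_k F k))%E.
    rewrite -[leRHS]add0e -h0; apply: le_trans (measureU2 _ _ _) => //; last exact: measurableD.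
    apply: le_measure; rewrite ?inE//; first by apply: measurableU => //; exact: measurableD.
    move=> x Tx; have [Fx|nFx] := pselect ((\bigcup_k F k) x); [by right|by left].
  by rewrite leNgt hU.
Qed.

End borel_core.

Section cylinders.
Context {R : realType} (d : nat).
Notation N := d.+1.
Notation T := (@torus R N).
Notation mu := (@lebesgueRn R N).
Notation E := (@tint R N).
Notation Ec := (@Ec R N).
Implicit Types (alpha : {set 'I_d.+1}).

Lemma tnth_subcoord alpha (z : Rn R N) (k : 'I_#|alpha|) : tnth (subcoord alpha z) k = tnth z (enum_val k).
Proof. by rewrite tnth_mktuple. Qed.

Lemma measurable_subcoord alpha : measurable_fun setT (subcoord alpha : Rn R N -> Rn R #|alpha|).
Proof.
apply/measurable_fun_tnthP => k.
rewrite (_ : _ \o _ = fun z : Rn R N => tnth z (enum_val k)).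
  exact: (@measurable_tnth _ (measurableTypeR R) N (enum_val k)).
by apply/funext => z /=; rewrite tnth_subcoord.
Qed.

Definition cyl alpha (B : set (Rn R #|alpha|)) : set (Rn R N) := [set z | B (subcoord alpha z)].

Lemma measurable_cyl alpha B : measurable B -> measurable (@cyl alpha B).
Proof. by move=> mB; rewrite -[X in measurable X]setTI; exact: measurable_subcoord. Qed.

Lemma cyl_indep alpha B l : l \notin alpha -> indep l (ind (@cyl alpha B) : _ -> R[i]).
Proof.
move=> la h z hh Tz; rewrite /ind !indicE.
have e : subcoord alpha (rot l h z) = subcoord alpha z.
  apply: eq_from_tnth => k; rewrite !tnth_subcoord /rot tnth_mktuple.
  by case: eqP => // e; move: la; rewrite -e enum_valP.
by have -> : (rot l h z \in cyl B) = (z \in cyl B) by apply/idP/idP; rewrite !inE /cyl /= e.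
Qed.

(** Both sides are finite measures in B that agree on boxes. *)
Lemma cyl_measure alpha B : measurable B ->
  mu (@cyl alpha B `&` T) = (((2 * pi) ^+ (N - #|alpha|))%:E * lebesgueRn #|alpha| (B `&` torus #|alpha|))%E.
Proof.
move=> mB; have mT := @measurable_torus R N; have mTa := @measurable_torus R #|alpha|.
have K0 : 0 <= (2 * pi) ^+ (N - #|alpha|) :> R by rewrite exprn_ge0// mulr_ge0// pi_ge0.
apply: (@box_measure_unique _ _ (pushforward (mrestr mu mT) (subcoord alpha))
  (mscale (NngNum K0) (mrestr (lebesgueRn #|alpha|) mTa))) mB.
- exact: measurable_subcoord.
- move=> mS A mA.
  change (mu (subcoord alpha @^-1` box A `&` T) = (((2 * pi) ^+ (N - #|alpha|))%:E * lebesgueRn #|alpha| (box A `&` torus #|alpha|))%E).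
  have mc : measurable (circle : set (measurableTypeR R)) by exact: measurable_itv.
  pose A' (l : 'I_N) : set R := circle `&` (if insub (index l (enum alpha)) is Some k then (if l \in alpha then A k else setT) else setT).
  have A'E (k : 'I_#|alpha|) : A' (enum_val k) = A k `&` circle.
    rewrite /A' enum_valP setIC; congr (_ `&` _).
    have -> : index (enum_val k) (enum alpha) = k.
      by rewrite (enum_val_nth (enum_default k)) index_uniq ?enum_uniq// -cardE.
    by rewrite valK.
  have A'N l : l \notin alpha -> A' l = circle.
    by move=> la; rewrite /A' (negbTE la); case: insub => [_|]; rewrite setIT.
  have -> : subcoord alpha @^-1` box A `&` T = box A'.
    rewrite torusE; apply/seteqP; split => z /=.
      move=> [hA hT] l; have [la|la] := boolP (l \in alpha); last by rewrite A'N.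
      rewrite -(enum_rankK_in la la) A'E; split; last exact: hT.
      by rewrite -tnth_subcoord; exact: hA.
    move=> h; split=> [k|l].
      by rewrite tnth_subcoord; have := h (enum_val k); rewrite A'E => -[].
    have [la|la] := boolP (l \in alpha); last by have := h l; rewrite A'N.
    by have := h l; rewrite -(enum_rankK_in la la) A'E => -[].
  have -> : box A `&` torus #|alpha| = box (fun k => A k `&` circle).
    rewrite torusE; apply/seteqP; split => z /=; first by move=> [h1 h2] k.
    by move=> h; split=> k; have [] := h k.
  rewrite !lebesgueRn_box; [|by move=> k; exact: measurableI|].
    rewrite (bigID (mem alpha))/= muleC; congr (_ * _)%E.
      rewrite (eq_bigr (fun=> (2 * pi)%:E)); last first.
        by move=> l la; rewrite A'N// lebesgue_measure_itv/= lte_fin twopi_gt0 -EFinB subr0.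
      have cC : (#|alpha| + #|[predC alpha]| = N)%N by rewrite cardC card_ord.
      have -> : (N - #|alpha| = #|[predC alpha]|)%N by move: cC; move: #|alpha| #|[predC alpha]| => x y; lia.
      by rewrite prodEFin prodr_const; congr (_ ^+ _)%:E; apply: eq_card.
    by rewrite big_enum_val; apply: eq_bigr => k _; rewrite A'E.
  move=> l; have [la|la] := boolP (l \in alpha); last by rewrite A'N.
  by rewrite -(enum_rankK_in la la) A'E; exact: measurableI.
- move=> mS a; rewrite /= /pushforward /mrestr; apply: le_lt_trans (@lebesgueRn_torus_fin R N).
  apply: le_measure; rewrite ?inE//; apply: measurableI => //.
  by apply: measurable_cyl; apply: measurable_box => i; exact: measurable_itv.
Qed.

Lemma E_ind_meas (A : set (Rn R N)) : measurable A -> (E (\1_A : _ -> R))%:E = mu (A `&` T).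
Proof.
move=> mA; have mT := @measurable_torus R N.
have fin := integrable_fin_num mT (bdd_ib (bdd_indic mA)).
by rewrite /tint /Rintegral fineK// integral_indic.
Qed.

Lemma cyl_pos alpha B : measurable B -> B `<=` torus #|alpha| -> (0 < lebesgueRn #|alpha| B)%E ->
  0 < E (\1_(@cyl alpha B) : _ -> R).
Proof.
move=> mB BT B0; rewrite -lte_fin E_ind_meas; last exact: measurable_cyl.
rewrite cyl_measure// (setIidl BT) mule_gt0// lte_fin exprn_gt0//; exact: twopi_gt0.
Qed.

(** The spectra of W and F meet in the zero frequency only. *)
Lemma uncorrelated (A : {set 'I_N}) (W F : Rn R N -> R[i]) : cbdd W -> cbdd F ->
  (forall l, l \in A -> indep l F) -> (forall l, l \notin A -> indep l W) ->
  Ec (fun z => W z * (F z)^*%C) = Ec W * (hat F tzero)^*%C.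
Proof.
move=> bW bF dF dW; have v0 := @vol_gt0 R N.
have fcW (H : Rn R N -> R[i]) l n : cbdd H -> indep l H -> tnth n l != 0 -> fc H n = 0.
  move=> bH iH nl; rewrite -(@Ec_indep _ _ l H (tsub tzero n)) //; last first.
  - by rewrite !tnth_mktuple sub0r oppr_eq0.
  - exact: cbdd_cib.
  - by apply: eq_Ec => z _; rewrite ewave_sub ewave0 mul1r.
have fc0 H : fc H tzero = Ec H.
  by apply: eq_Ec => z _; rewrite ewave0 conjc1 mulr1.
set D := RHS.
suff h (eta : R) : 0 < eta -> nr (Ec (fun z => W z * (F z)^*%C) - D) <= eta.
  apply/eqP; rewrite -subr_eq0 -[_ == 0]negbK; apply/negP => ne.
  have n0 : 0 < nr (Ec (fun z => W z * (F z)^*%C) - D).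
    by rewrite lt_neqAle nr_ge0 andbT eq_sym; apply: contra ne => /eqP n0; apply/eqP/sq_eq0; rewrite sqE n0 expr0n.
  have := h _ (divr_gt0 n0 (ltr0Sn R 1)); lra.
move=> eta0; have [M M0 hM] := nr_bound bW.
pose q := eta / (M * (1 + vol N)).
have q0 : 0 < q by rewrite divr_gt0// mulr_gt0// addr_gt0.
have [s0 us0 hs] := parseval (cbdd_l2 bF) (exprn_gt0 2 q0).
pose s := undup (tzero :: s0); have us : uniq s by exact: undup_uniq.
have ts : tzero \in s by rewrite mem_undup mem_head.
have ss : {subset s0 <= s} by move=> n ns; rewrite mem_undup inE ns orbT.
have {}hs := hs s us ss.
set t := trig s (hat F) in hs.
have bt : cbdd t by exact: cbdd_trig.
have DE : Ec (fun z => W z * (t z)^*%C) = D.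
  have out n : n != tzero -> (hat F n)^*%C * fc W n = 0.
    move=> n0; have [l nl] : exists l, tnth n l != 0.
      apply/existsP; apply: contraNT n0; rewrite negb_exists => /forallP h.
      by apply/eqP/eq_from_tnth => l; have := h l; rewrite negbK tnth_mktuple => /eqP.
    have [lA|lA] := boolP (l \in A).
      by rewrite /hat (fcW F l)// ?mul0r ?conjc0 ?mul0r//; exact: dF.
    by rewrite (fcW W l)// ?mulr0//; exact: dW.
  rewrite trig_dot; last exact: cbdd_cib.
  rewrite (bigD1_seq tzero ts us) big1; last by move=> n /out.
  by rewrite [LHS]addr0 fc0 /D mulrC.
have bWt : cbdd (fun z => W z * (F z - t z)^*%C) by apply: cbddM => //; apply/cbddJ/cbddB.
have -> : Ec (fun z => W z * (F z)^*%C) - D = Ec (fun z => W z * (F z - t z)^*%C).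
  rewrite -DE -EcN; last by apply/cbdd_cib/cbddM => //; exact: cbddJ.
  rewrite -EcD; [|by apply/cbdd_cib/cbddM => //; exact: cbddJ|by apply/cibN/cbdd_cib/cbddM => //; exact: cbddJ].
  by apply: eq_Ec => z _; rewrite conjcD conjcN; ring.
have bFt : cbdd (fun z => F z - t z) by exact: cbddB.
have bs : ib (fun z => sq (F z - t z)) by exact/bdd_ib/bdd_sq.
apply: (le_trans (nr_Ec (cbdd_cib bWt))).
apply: (@le_trans _ _ (E (fun z => M / q * sq (F z - t z) + M * q))).
  apply: Ele => [||z Tz]; first exact/bdd_ib/bdd_nr.
    by apply: ibD; [exact: ibZ|exact/bdd_ib/bdd_cst].
  rewrite nrM nrJ sqE; have := hM z Tz; have := nr_ge0 (W z).
  move: (nr (W z)) (nr (F z - t z)) (nr_ge0 (F z - t z)) => w x x0 w0 wM.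
  apply: (@le_trans _ _ (M * x)); first by rewrite ler_wpM2r.
  have -> : M / q * x ^+ 2 + M * q = M * (x ^+ 2 / q + q) by ring.
  apply: ler_wpM2l; first exact: ltW.
  rewrite -(ler_pM2l q0) mulrDr [q * (_ / q)]mulrC divfK ?gt_eqF//.
  by have := sqr_ge0 (x - q); have := sqr_ge0 (x + q); nra.
rewrite ED; [|exact: ibZ|exact/bdd_ib/bdd_cst].
rewrite EZ// Ecst; apply: (@le_trans _ _ (M / q * q ^+ 2 + M * q * vol N)).
  rewrite lerD//; first by rewrite ler_wpM2l// divr_ge0// ltW.
rewrite le_eqVlt; apply/orP; left; apply/eqP; rewrite /q; field.
by rewrite !gt_eqF// addr_gt0.
Qed.

Lemma pos_inter (alpha : {set 'I_N}) (A B : set (Rn R N)) : measurable A -> measurable B ->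
  (forall l, l \notin alpha -> indep l (ind A : _ -> R[i])) ->
  (forall l, l \in alpha -> indep l (ind B : _ -> R[i])) ->
  0 < E (\1_A : _ -> R) -> 0 < E (\1_B : _ -> R) -> 0 < E (\1_(A `&` B) : _ -> R).
Proof.
move=> mA mB dA dB pA pB.
have EI (S : set (Rn R N)) : Ec (ind S) = (E (\1_S : _ -> R))%:C%C.
  by apply: ceq => //=; exact: E0.
have := uncorrelated (cbdd_ind mA) (cbdd_ind mB) dB dA.
have -> : Ec (fun z => ind A z * (ind B z)^*%C) = (E (\1_(A `&` B) : _ -> R))%:C%C.
  rewrite -EI; apply: eq_Ec => z _; rewrite /ind conjc_real -rmorphM.
  by rewrite indicI.
have -> : hat (ind B) tzero = (E (\1_B : _ -> R) / vol N)%:C%C.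
  rewrite /hat rmorphM/= -EI; congr (_ * _); apply: eq_Ec => z _; by rewrite ewave0 conjc1 mulr1.
rewrite conjc_real EI -rmorphM => /(congr1 (@complex.Re R))/= ->.
by rewrite mulr_gt0// divr_gt0// vol_gt0.
Qed.

End cylinders.

(** * The core of an admissible set *)

Section admissible_core.
Context {R : realType} (d : nat).
Notation N := d.+1.
Notation T := (@torus R N).
Notation E := (@tint R N).
Implicit Types (alpha : {set 'I_N}).

Lemma indIE (A B : set (Rn R N)) z : ind (A `&` B) z = ind A z * ind B z :> R[i].
Proof. by rewrite /ind indicI -rmorphM. Qed.

Section blocks.
Variables (d_gt0 : (0 < d)%N) (B : forall alpha : {set 'I_N}, set (Rn R #|alpha|)).

Definition cyls (L : seq {set 'I_N}) : set (Rn R N) := [set z | forall alpha, alpha \in L -> cyl (@B alpha) z].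

Lemma cyls_cons alpha L : cyls (alpha :: L) = cyl (@B alpha) `&` cyls L.
Proof.
apply/seteqP; split => z /=.
  by move=> h; split=> [|beta bL]; apply: h; rewrite inE ?eqxx// bL orbT.
by move=> [h1 h2] beta; rewrite inE => /orP[/eqP->|]; [exact: h1|exact: h2].
Qed.

Lemma cylsP (L : seq {set 'I_N}) : uniq L ->
  (forall alpha beta, alpha \in L -> beta \in L -> alpha != beta -> forall l, l \in alpha -> l \notin beta) ->
  (forall alpha, alpha \in L -> [/\ (#|alpha| <= 2)%N, measurable (@B alpha),
     @B alpha `<=` torus #|alpha| & (0 < lebesgueRn #|alpha| (@B alpha))%E]) ->
  [/\ measurable (cyls L), trigapprox (ind (cyls L) : _ -> R[i]), 0 < E (\1_(cyls L) : _ -> R) &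
    forall l, (forall alpha, alpha \in L -> l \notin alpha) -> indep l (ind (cyls L) : _ -> R[i])].
Proof.
elim: L => [|alpha L IH].
  move=> _ _ _; have -> : cyls [::] = setT by apply/seteqP; split => z //= _ alpha.
  split.
  - exact: measurableT.
  - by apply: eq_trigapprox (@trigapprox1 R d) => z _; rewrite /ind indicT.
  - by rewrite indicT Ecst mul1r vol_gt0.
  - by move=> l _ h z _ _; rewrite /ind indicT.
move=> /= /andP[aL uL] dis hB; rewrite cyls_cons.
have [] := IH uL.
- by move=> a b aL' bL'; apply: dis; rewrite inE ?aL' ?bL' orbT.
- by move=> a aL'; apply: hB; rewrite inE aL' orbT.
move=> mS tS pS iS; have [a2 mB BT B0] := hB alpha (mem_head _ _).
have mC := measurable_cyl mB.
split.
- exact: measurableI.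
- have h := trigapproxM (card_small_block d_gt0 a2) (cbdd_ind mC) (fun l la => @cyl_indep R d alpha (@B alpha) l la) (cbdd_ind mS) tS.
  by apply: eq_trigapprox h => z _; rewrite indIE.
- apply: (@pos_inter _ _ alpha) => //; [by move=> l la; exact: cyl_indep| |exact: cyl_pos].
  move=> l la; apply: iS => beta bL.
  have ab : alpha != beta by apply: contraNneq aL => ->.
  by apply: (dis alpha) => //; rewrite ?mem_head// inE bL orbT.
- move=> l hl h z hh Tz; rewrite !indIE (@cyl_indep R d alpha (@B alpha) l (hl alpha (mem_head _ _)) h z hh Tz).
  by rewrite iS// => beta bL; apply: hl; rewrite inE bL orbT.
Qed.

End blocks.

(** Each factor of the product is replaced by a Borel core, so that the
    indicator becomes a product of functions of small blocks. *)
Lemma admissible_core (d_gt0 : (0 < d)%N) (G : set (Rn R N)) (c : R) : admissible G ->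
  exists G' : set (Rn R N), [/\ measurable G', G' `<=` G, 0 < E (\1_G' : _ -> R),
    trigapprox (ind G' : _ -> R[i]) & trigapprox (fun z => ind G' z * phase c z ^+ 2)].
Proof.
move=> [P [Gs [/and3P[/eqP cP tP _] hG ->]]].
have core alpha : exists B : set (Rn R #|alpha|), alpha \in P ->
    [/\ measurable B, B `<=` Gs alpha & (0 < lebesgueRn #|alpha| B)%E].
  have [aP|] := boolP (alpha \in P); last by exists set0.
  have [_ sG mG G0] := hG alpha aP.
  have [|B hB] := borel_core _ mG G0; last by exists B.
  move=> w /sG hw k; have := hw k; rewrite /coord_domain; case: eqP => // _.
  by rewrite /= !in_itv/= => /andP[/ltW -> ->].
pose B alpha := sval (cid (core alpha)).
have hB alpha : alpha \in P -> [/\ measurable (B alpha), B alpha `<=` Gs alpha & (0 < lebesgueRn #|alpha| (B alpha))%E].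
  by move=> aP; exact: (svalP (cid (core alpha))).
have sub alpha : alpha \in P -> B alpha `<=` torus #|alpha|.
  move=> aP w Bw k; have [_ sG _ _] := hG alpha aP; have [_ BG _] := hB alpha aP.
  have := sG w (BG w Bw) k; rewrite /coord_domain; case: eqP => // _.
  by rewrite /= !in_itv/= => /andP[/ltW -> ->].
have [] := @cylsP d_gt0 B (enum P).
- exact: enum_uniq.
- move=> a b; rewrite !mem_enum => aP bP ab l la; have /pred0P/(_ l)/= := finset.trivIsetP tP a b aP bP ab.
  by rewrite la /= => ->.
- move=> a; rewrite mem_enum => aP; have [/andP[_ a2] _ _ _] := hG a aP.
  by have [h1 h2 h3] := hB a aP; split=> //; exact: sub.
move=> mS tS pS _; exists (cyls B (enum P)); split=> //.
- move=> z hz; have hz' alpha : alpha \in P -> Gs alpha (subcoord alpha z).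
    by move=> aP; have [_ BG _] := hB alpha aP; apply: BG; apply: hz; rewrite mem_enum.
  split=> // l; have : l \in finset.cover P by rewrite cP finset.inE.
  move=> /finset.bigcupP[alpha aP la]; have [_ sG _ _] := hG alpha aP.
  have := sG _ (hz' alpha aP) (enum_rank_in la l); by rewrite tnth_subcoord enum_rankK_in.
- have sb : small_block [set ord0 : 'I_N]%SET.
    by left; exists (Ordinal d_gt0) => l; rewrite finset.inE.
  have b2 : cbdd (fun z : Rn R N => phase c z ^+ 2) by apply: cbddM; exact: cbdd_phase.
  have i2 l : l \notin [set ord0 : 'I_N]%SET -> indep l (fun z : Rn R N => phase c z ^+ 2).
    rewrite finset.inE => l0 h z hh Tz; rewrite /phase /rot tnth_mktuple.
    by rewrite eq_sym (negbTE l0).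
  have := trigapproxM sb b2 i2 (cbdd_ind mS) tS.
  by apply: eq_trigapprox => z _; rewrite mulrC.
Qed.

End admissible_core.

(** * Square-integrable functions on the torus *)

Section square_integrable.
Context {R : realType} (d : nat).
Notation T := (@torus R d).
Notation mu := (@lebesgueRn R d).
Notation E := (@tint R d).
Notation Ec := (@Ec R d).
Implicit Types (f g : Rn R d -> R[i]) (n : d.-tuple int).

Lemma fourier_coefE f n : fourier_coef f n = hat f n.
Proof.
rewrite /fourier_coef /hat mulrC; congr (_ * _).
by apply: eq_Ec => x _; rewrite expiN.
Qed.

Lemma sqnormE n : sqnorm n = (isqn n)%:~R :> R.
Proof. by rewrite /sqnorm /isqn rmorph_sum; apply: eq_bigr => l _; rewrite rmorphXn. Qed.

Lemma sqL2normE (D : set (Rn R d)) (m : {measure set (Rn R d) -> \bar R}) f :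
  sqL2norm m D f = (\int[m]_(x in D) (sq (f x))%:E)%E.
Proof. by apply: eq_integral => x _; rewrite sqE. Qed.

Lemma ib_integral (F : Rn R d -> R) : ib F -> (\int[mu]_(x in T) (F x)%:E)%E = (E F)%:E.
Proof. by move=> iF; rewrite /tint /Rintegral fineK// (integrable_fin_num _ iF)//; exact: measurable_torus. Qed.

Lemma cmeas_sq (D : set (Rn R d)) f : cmeasurable_fun D f -> measurable_fun D (fun x => sq (f x)).
Proof. by move=> [mR mI]; apply: measurable_funD; apply: measurable_funX. Qed.

Lemma L2torus_l2 f : L2torus f -> l2 f.
Proof.
move=> [cf]; rewrite sqL2normE => fin; have [mR mI] := cf; apply: l2P => //.
apply/integrableP; split; first by apply/measurable_EFinP; exact: cmeas_sq.
apply: le_lt_trans fin; rewrite le_eqVlt; apply/orP; left; apply/eqP.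
by apply: eq_integral => x _ /=; rewrite ger0_norm// sq_ge0.
Qed.

(** Energy of f outside the modes of s. *)
Definition tail f s : R := E (fun x => sq (f x)) - vol d * \sum_(n <- s) sq (hat f n).

Lemma tail_ge0 f s : l2 f -> uniq s -> 0 <= tail f s.
Proof. by move=> lf us; rewrite /tail -parseval_sum//; apply: Ege0 => x _; exact: sq_ge0. Qed.

Lemma tail_small f (e : R) : l2 f -> 0 < e -> exists2 s0 : seq (d.-tuple int), uniq s0 &
  forall s, uniq s -> {subset s0 <= s} -> tail f s <= e.
Proof.
move=> lf e0; have [s0 us0 h] := parseval lf e0; exists s0 => // s us ss.
by rewrite /tail -parseval_sum//; exact: h.
Qed.

(** Parseval's identity for g and Bessel's inequality for f. *)
Lemma mass_le f g : l2 f -> l2 g -> (forall n, sq (hat g n) = sq (hat f n)) ->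
  E (fun x => sq (g x)) <= E (fun x => sq (f x)).
Proof.
move=> lf lg h; apply/ler_addgt0Pl => e e0.
have [s us hs] := tail_small lg e0.
have := hs s us (fun n ns => ns); have := tail_ge0 lf us; rewrite /tail.
under [X in _ -> _ - _ * X <= _ -> _]eq_bigr do rewrite h.
lra.
Qed.

Lemma tail_eq f g s : l2 f -> l2 g -> (forall n, sq (hat g n) = sq (hat f n)) -> tail g s = tail f s.
Proof.
move=> lf lg h; rewrite /tail; congr (_ - _ * _); last by apply: eq_bigr => n _; rewrite h.
by apply/eqP; rewrite eq_le !mass_le.
Qed.

End square_integrable.

(** * Space-time integrals *)

Section spacetime_integral.
Context {R : realType} (d : nat).
Notation N := d.+1.
Local Open Scope ereal_scope.

Definition times : set R := `]0%R, (2 * pi)%R[%classic.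

Lemma spacetimeP (t : R) (x : Rn R d) : spacetime d (Rcons (t, x)) <-> times t /\ torus d x.
Proof.
split=> [h|[ht hx] l].
  split; first by have := h ord0; rewrite /coord_domain eqxx.
  by move=> l; have := h (lift ord0 l); rewrite /coord_domain /= tnthS.
rewrite /coord_domain; case: (unliftP ord0 l) => [k ->|->]; last by rewrite eqxx.
by rewrite /= tnthS; exact: hx.
Qed.

Lemma measurable_spacetime : measurable (spacetime d : set (Rn R N)).
Proof.
rewrite (_ : spacetime d = box (@coord_domain R d))//; apply: measurable_box => l.
by rewrite /coord_domain; case: ifP => _; exact: measurable_itv.
Qed.

Lemma spacetime_torus : (spacetime d : set (Rn R N)) `<=` torus N.
Proof.
move=> z hz l; have := hz l; rewrite /coord_domain; case: eqP => // _.
by rewrite /= !in_itv/= => /andP[/ltW -> ->].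
Qed.

(** Tonelli's theorem for the iterated product that defines the measure. *)
Lemma spacetime_le (F : Rn R N -> \bar R) (k : R) : (0 <= k)%R -> measurable_fun (spacetime d) F ->
  (forall z, 0 <= F z) ->
  (forall t, times t -> \int[lebesgueRn d]_(x in torus d) F (Rcons (t, x)) <= k%:E) ->
  \int[lebesgueRn N]_(z in spacetime d) F z <= (2 * pi * k)%:E.
Proof.
move=> k0 mF F0 hk; have mS := measurable_spacetime.
rewrite integral_mkcond; set H := F \_ (spacetime d).
have mH : measurable_fun setT H by apply/(measurable_restrictT F mS).
have H0 z : 0 <= H z by rewrite /H /patch; case: ifP.
have mR := @measurable_Rcons R d.
have mHR : measurable_fun setT (H \o @Rcons R d) by exact: measurableT_comp.
have -> : \int[lebesgueRn N]_z H z = \int[pushforward (lebesgue_measure \x lebesgueRn d) (@Rcons R d)]_z H z.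
  by apply: eq_measure_integral.
rewrite ge0_integral_pushforward//=.
rewrite preimage_setT fubini_tonelli1//.
apply: (@le_trans _ _ (\int[lebesgue_measure]_(t in times) k%:E)).
  rewrite [leRHS]integral_mkcond; apply: ge0_le_integral => //.
  - by move=> t _; apply: integral_ge0 => x _; exact: H0.
  - by apply: measurable_fun_fubini_tonelli_F => // z; exact: H0.
  - have mt : measurable (times : set (measurableTypeR R)) by exact: measurable_itv.
    by apply/(measurable_restrictT (cst k%:E : measurableTypeR R -> \bar R) mt); exact: measurable_cst.
  move=> t _; rewrite /fubini_F /patch; case: ifPn => [/set_mem tt|/negP tt].
    apply: le_trans (hk t tt); rewrite [leRHS]integral_mkcond.
    rewrite le_eqVlt; apply/orP; left; apply/eqP/eq_integral => x _.
    rewrite /H /patch /=; have [xT|xT] := boolP (x \in torus d).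
      by rewrite mem_set//; apply/spacetimeP; split=> //; exact: set_mem.
    by rewrite memNset// => /spacetimeP[_ /mem_set]; exact/negP.
  rewrite integral0_eq// => x _; rewrite /H /patch /= memNset// => /spacetimeP[/mem_set].
  by [].
rewrite integral_cst; last exact: measurable_itv.
change (k%:E * lebesgue_measure times <= (2 * pi * k)%:E).
have -> : lebesgue_measure times = (2 * pi)%:E.
  by rewrite /times lebesgue_measure_itv/= lte_fin twopi_gt0 -EFinB subr0.
by rewrite -EFinM mulrC.
Qed.

(** The supremum over simple functions that defines the integral is monotone
    in the domain, and the two measures agree on Borel sets. *)
Lemma completed_ge n (A B : set (Rn R n)) (f : Rn R n -> \bar R) : measurable A -> A `<=` B ->
  measurable_fun A f -> (forall z, 0 <= f z) ->
  \int[lebesgueRn n]_(z in A) f z <= \int[completed_lebesgueRn n]_(z in B) f z.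
Proof.
move=> mA AB mf f0.
apply: (@le_trans _ _ (\int[completed_lebesgueRn n]_(z in A) f z)); last first.
  rewrite !ge0_integralE//; apply: ereal_sup_le => _ [h /= hf <-]; exists h => //= z.
  apply: (le_trans (hf z)); rewrite /patch; case: ifPn => [/set_mem/AB/mem_set -> //|_].
  by case: ifP.
(* the identity, read as a Borel map from the completed measurable space *)
pose j : caratheodory_type (mu_ext (lebesgueRn n)) -> Rn R n := idfun.
have mj : measurable_fun setT j.
  by move=> _ C mC; rewrite setTI; exact: caratheodory_measurable_mu_ext.
have := @ge0_integral_pushforward _ _ _ _ R _ mj (completed_lebesgueRn n) A f mA mf (fun z _ => f0 z).
have -> : \int[pushforward (completed_lebesgueRn n) j]_(z in A) f z = \int[lebesgueRn n]_(z in A) f z.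
  by apply: eq_measure_integral => C mC _; exact: measurable_mu_extE.
by move=> ->.
Qed.

End spacetime_integral.

(** * From the real part to two-way waves *)

Section passage.
Context {R : realType} (d : nat).
Notation N := d.+1.
Implicit Types (n m : d.-tuple int) (s : seq (d.-tuple int)).

Definition neg n : d.-tuple int := tsub tzero n.

Lemma tnth_neg n l : tnth (neg n) l = - tnth n l.
Proof. by rewrite !tnth_mktuple sub0r. Qed.

Lemma negK : involutive neg.
Proof. by move=> n; apply: eq_from_tnth => l; rewrite !tnth_neg opprK. Qed.

Lemma isqn_neg n : isqn (neg n) = isqn n.
Proof. by apply: eq_bigr => l _; rewrite tnth_neg sqrrN. Qed.

Definition symmetric s := forall n, n \in s -> neg n \in s.

Lemma sum_neg (V : nmodType) s (F : d.-tuple int -> V) : uniq s -> symmetric s ->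
  \sum_(n <- s) F (neg n) = \sum_(n <- s) F n.
Proof.
move=> us sy; rewrite -(big_map neg xpredT F); apply: perm_big; apply: uniq_perm => //.
  by rewrite map_inj_uniq//; exact: (can_inj negK).
move=> n; apply/mapP/idP => [[m ms ->]|ns]; first exact: sy.
by exists (neg n); [exact: sy|rewrite negK].
Qed.

Lemma ewave_neg n (x : Rn R d) : (ewave n x)^*%C = ewave (neg n) x :> R[i].
Proof. by rewrite ewave_sub ewave0 mul1r. Qed.

Lemma lam_neg n : tsub tzero (lam true n) = lam false (neg n).
Proof.
apply: eq_from_tnth => l; rewrite !tnth_mktuple sub0r.
case: (unliftP ord0 l) => [k ->|->]; first by rewrite !lamS tnth_neg.
by rewrite !lam0 opprK isqn_neg.
Qed.

Lemma dotp_lam (sg : bool) n (z : Rn R N) : dotp (lam sg n) z =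
  (if sg then - (isqn n)%:~R else (isqn n)%:~R) * tnth z ord0 + \sum_(l < d) (tnth n l)%:~R * tnth z (lift ord0 l).
Proof.
rewrite /dotp big_ord_recl lam0; congr (_ * _ + _); first by case: sg; rewrite ?rmorphN.
by apply: eq_bigr => l _; rewrite lamS.
Qed.

Section coefficients.
Variables (c : R) (a : d.-tuple int -> R[i]).

(** Coefficients of the complex conjugate. *)
Definition reflected n : R[i] := (a (neg n))^*%C.

Definition resonant n := (isqn n)%:~R == c.
(** The forward and backward waves of a resonant frequency coincide; their
    coefficients are merged in the forward one. *)
Definition fwd n := if resonant n then a n + reflected n else a n.
Definition bwd n := if resonant n then 0 else reflected n.

Lemma waves_Re s z : uniq s -> symmetric s ->
  waves c s a reflected z = (2 * Re (phase c z * packet true s a z))%:C%C.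
Proof.
move=> us sy; rewrite /waves.
have -> : packet false s reflected z = (packet true s a z)^*%C.
  rewrite /packet conjc_sum -(sum_neg _ us sy); apply: eq_bigr => n _.
  rewrite conjcM /reflected negK; congr (_ * _).
  by rewrite -lam_neg ewave_sub ewave0 mul1r.
rewrite -conjcM; move: (_ * _) => w; apply: ceq; rewrite ?ReD ?ImD ?ReJ ?ImJ /=; ring.
Qed.

Lemma resonant_wave n (z : Rn R N) : resonant n ->
  phase c z * ewave (lam true n) z = (phase c z)^*%C * ewave (lam false n) z :> R[i].
Proof.
by move=> /eqP nc; rewrite /phase -expiN /ewave -!expiD !dotp_lam nc; congr expi; ring.
Qed.

Lemma waves_resonant s z : waves c s a reflected z = waves c s fwd bwd z.
Proof.
rewrite /waves /packet !mulr_sumr -!big_split; apply: eq_bigr => n _ /=.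
rewrite /fwd /bwd; case: ifP => // rn.
by rewrite mul0r mulr0 addr0 mulrDl mulrDr; congr (_ + _); rewrite ![_ * (reflected n * _)]mulrCA resonant_wave.
Qed.

Lemma supp_resonant : supp (nonresonant c) fwd bwd.
Proof.
move=> n; split=> //; rewrite /nonresonant /bwd /resonant /= negbK => ->.
by [].
Qed.

Lemma sq_parallelogram (x y : R[i]) : sq (x + y) + sq (x - y) = 2 * (sq x + sq y).
Proof. rewrite sqDE sqBE; ring. Qed.

(** Resonant frequencies keep the energy of a + reflected a only; the
    parallelogram identity recovers the rest from a - reflected a, and the
    symmetry of s shares the energy between a and reflected a. *)
Lemma energy_lower s : uniq s -> symmetric s ->
  \sum_(n <- s) sq (a n) <= energy s fwd bwd + 4^-1 * \sum_(n <- s | resonant n) sq (a n - reflected n).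
Proof.
move=> us sy.
have e : \sum_(n <- s) sq (reflected n) = \sum_(n <- s) sq (a n).
  by rewrite -(sum_neg (fun n => sq (a n)) us sy); apply: eq_bigr => n _; rewrite /reflected sqJ.
have -> : \sum_(n <- s) sq (a n) = \sum_(n <- s) (2^-1 * (sq (a n) + sq (reflected n))).
  have h : \sum_(n <- s) (sq (a n) + sq (reflected n)) = \sum_(n <- s) sq (a n) + \sum_(n <- s) sq (reflected n).
    exact: big_split.
  by rewrite -mulr_sumr h e; lra.
rewrite [X in _ <= _ + _ * X]big_mkcond mulr_sumr /energy -big_split/=; apply: ler_sum => n _.
rewrite /fwd /bwd; have := sq_ge0 (a n); have := sq_ge0 (reflected n).
case: ifP => _; last by lra.
have := sq_parallelogram (a n) (reflected n); have := sq_ge0 (a n + reflected n); rewrite sq0; lra.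
Qed.

End coefficients.

Lemma resonant_list (c : R) : exists Z : seq (d.-tuple int), forall n, resonant c n -> n \in Z.
Proof.
have [[n0 /eqP h0]|h] := pselect (exists n0, resonant c n0); last first.
  by exists [::] => n rn; exfalso; apply: h; exists n.
exists [seq @boxvec d (absz (isqn n0)) g | g <- enum {ffun 'I_d -> 'I_(2 * absz (isqn n0)).+1}] => n /eqP hn.
have e : isqn n = isqn n0 by apply/eqP; rewrite -(eqr_int R) hn h0.
have le : isqn n <= (absz (isqn n0))%:Z by rewrite e abszE ler_norm.
have [g ->] := boxvecP (sphere_coord le).
by apply: map_f; rewrite mem_enum.
Qed.

(** 2 i times the imaginary part of the resonant sum has the coefficients a -
    reflected a. *)
Lemma proj_Im_mass (c : R) (phi : Rn R d -> R[i]) s : uniq s -> symmetric s -> (forall n, resonant c n -> n \in s) ->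
  sqL2norm (lebesgueRn d) (torus d) (proj_Im c phi) =
  (vol d / 4 * \sum_(n <- s | resonant c n) sq (hat phi n - reflected (hat phi) n))%:E.
Proof.
move=> us sy hs; pose S := [seq n <- s | resonant c n]; have uS : uniq S by rewrite filter_uniq.
have sS : symmetric S.
  by move=> n; rewrite !mem_filter /resonant isqn_neg => /andP[-> /sy ->].
have pE x : fourier_proj c phi x = trig S (hat phi) x.
  rewrite /fourier_proj (_ : frequencies c = [set` S]); last first.
    apply/seteqP; split => n /=; rewrite /frequencies/= sqnormE mem_filter.
      by move=> /eqP rn; rewrite [resonant c n]rn hs.
    by move=> /andP[/eqP].
  by rewrite -fsbig_seq//; apply: eq_bigr => n _; rewrite fourier_coefE.
pose k n := (hat phi n - reflected (hat phi) n) * (2^-1)%:C%C.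
have qE x : sq (proj_Im c phi x) = sq (trig S k x).
  have -> : trig S k x = (trig S (hat phi) x - (trig S (hat phi) x)^*%C) * (2^-1)%:C%C.
    rewrite /trig conjc_sum -(sum_neg (fun n => (hat phi n * ewave n x)^*%C) uS sS) -sumrB mulr_suml.
    apply: eq_bigr => n _; rewrite conjcM ewave_neg negK /k /reflected; ring.
  rewrite sqM sqC /proj_Im pE; move: (trig _ _ _) => w.
  by rewrite /sq ReD ImD ReN ImN ReJ ImJ /=; field.
rewrite sqL2normE.
under eq_integral do rewrite qE.
rewrite ib_integral; last by apply/bdd_ib/bdd_sq; exact: cbdd_trig.
rewrite E_sq_trig// -mulrA; congr (_ * _)%:E.
rewrite big_filter mulr_sumr; apply: eq_bigr => n _; by rewrite /k sqM sqC mulrC; congr (_ * _); field.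
Qed.

End passage.

(** * Observability of the flow *)

Section observation.
Context {R : realType} (d : nat).
Notation N := d.+1.
Variables (c : R) (phi : Rn R d -> R[i]) (u : Rn R N -> R[i]).
Hypotheses (Lphi : L2torus phi) (fu : schrodinger_flow c phi u).
Notation a := (hat phi).

Definition flow_sum s (z : Rn R N) : R[i] := phase c z * packet true s a z.

Lemma flow_sum_trig s t (x : Rn R d) :
  flow_sum s (Rcons (t, x)) = trig s (fun n => expi (t * (c - (isqn n)%:~R)) * a n) x.
Proof.
rewrite /flow_sum /packet /trig mulr_sumr; apply: eq_bigr => n _.
have -> : expi (t * (c - (isqn n)%:~R)) * a n * ewave n x = a n * (expi (t * (c - (isqn n)%:~R)) * ewave n x) by ring.
rewrite mulrCA; congr (_ * _); rewrite /phase /ewave -!expiD dotp_lam; congr expi.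
have -> : tnth (Rcons (t, x)) ord0 = t by [].
have -> : \sum_(l < d) (tnth n l)%:~R * tnth (Rcons (t, x)) (lift ord0 l) = dotp n x.
  by apply: eq_bigr => l _; rewrite tnthS.
ring.
Qed.

(** The coefficients of a time slice have the moduli of those of phi, and so
    the defect is the same at all times. *)
Lemma slice_defect s t : times t -> uniq s ->
  (\int[lebesgueRn d]_(x in torus d) (sq (u (Rcons (t, x)) - flow_sum s (Rcons (t, x))))%:E = (tail phi s)%:E)%E.
Proof.
move=> tt us; have [cu hu] := fu.
have [Lg hg] : schrodinger c t phi (fun x => u (Rcons (t, x))) by apply: hu; exact: tt.
have lg := L2torus_l2 Lg; have lphi := L2torus_l2 Lphi.
set g := (fun x => u _) in hg Lg lg.
have hatg n : hat g n = expi (t * (c - (isqn n)%:~R)) * a n by rewrite -!fourier_coefE hg sqnormE.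
have sqg n : sq (hat g n) = sq (a n) by rewrite hatg sqM sq_expi mul1r.
rewrite -(tail_eq s lphi lg sqg) /tail -parseval_sum//.
have lt : l2 (fun x => g x - trig s (hat g) x) by apply: l2B => //; exact/cbdd_l2/cbdd_trig.
rewrite -ib_integral; last by case: lt.
apply: eq_integral => x _; rewrite flow_sum_trig; congr (sq (_ - _))%:E.
by apply: eq_bigr => n _; rewrite hatg.
Qed.

Lemma cmeas_flow_sum s (D : set (Rn R N)) : measurable D -> D `<=` torus N -> cmeasurable_fun D (flow_sum s).
Proof.
move=> mD DT; have [[mR _] [mI _]] : cbdd (flow_sum s) by apply: cbddM; [exact: cbdd_phase|exact: cbdd_packet].
by split; apply: (measurable_funS _ DT) => //; exact: measurable_torus.
Qed.

Lemma defect_le s : uniq s ->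
  (\int[lebesgueRn N]_(z in spacetime d) (sq (u z - flow_sum s z))%:E <= (2 * pi * tail phi s)%:E)%E.
Proof.
move=> us; have [cu _] := fu; have [mR mI] := cu.
have mS := @measurable_spacetime R d.
have [fR fI] := cmeas_flow_sum s mS (@spacetime_torus R d).
apply: spacetime_le.
- exact/tail_ge0/us/L2torus_l2.
- apply/measurable_EFinP; apply: cmeas_sq; split.
    by under eq_fun do rewrite ReD ReN; exact: measurable_funB.
  by under eq_fun do rewrite ImD ImN; exact: measurable_funB.
- by move=> z; rewrite lee_fin sq_ge0.
- by move=> t tt; rewrite slice_defect.
Qed.

(** The partial sums form a two-way wave, equal to twice the real part, and
    |x|^2 <= 2 |y|^2 + 2 |x - y|^2 compares it with the flow. *)
Lemma observed_energy (G' : set (Rn R N)) s (A : R) : measurable G' -> G' `<=` spacetime d ->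
  uniq s -> symmetric s ->
  (\int[lebesgueRn N]_(z in G') (Re (u z) ^+ 2)%:E <= A%:E)%E ->
  observed c G' s (fwd c a) (bwd c a) <= 8 * A + 16 * pi * tail phi s.
Proof.
move=> mG GS us sy hA; have [cu _] := fu; have [mR mI] := cu.
have mS := @measurable_spacetime R d.
have GT : G' `<=` torus N by move=> z /GS /spacetime_torus.
have [fR fI] := cmeas_flow_sum s mG GT.
have mRu : measurable_fun G' (fun z => Re (u z)) by exact: (measurable_funS mS GS).
have mIu : measurable_fun G' (fun z => Im (u z)) by exact: (measurable_funS mS GS).
have md : measurable_fun G' (fun z => sq (u z - flow_sum s z)).
  apply: cmeas_sq; split.
    by under eq_fun do rewrite ReD ReN; exact: measurable_funB.
  by under eq_fun do rewrite ImD ImN; exact: measurable_funB.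
have iW := ib_w c s (fwd c a) (bwd c a) (bdd_indic mG).
rewrite -lee_fin /observed -ib_integral//.
have -> : (\int[lebesgueRn N]_(z in torus N) (\1_G' z * sq (waves c s (fwd c a) (bwd c a) z))%:E =
    \int[lebesgueRn N]_(z in G') (4 * Re (flow_sum s z) ^+ 2)%:E)%E.
  rewrite [RHS](_ : _ = \int[lebesgueRn N]_(z in torus N `&` G') (4 * Re (flow_sum s z) ^+ 2)%:E)%E; last first.
    by rewrite setIidr.
  rewrite integral_mkcondr; apply: eq_integral => z _; rewrite /patch indicE.
  case: ifP => _; rewrite ?mul0r// mul1r -waves_resonant waves_Re// sqC exprMn; congr (_ * _)%:E; ring.
apply: (@le_trans _ _ (\int[lebesgueRn N]_(z in G') (8%:E * (Re (u z) ^+ 2)%:E + 8%:E * (sq (u z - flow_sum s z))%:E))%E).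
  apply: ge0_le_integral => //.
  - by move=> z _; rewrite lee_fin mulr_ge0// sqr_ge0.
  - by apply/measurable_EFinP/measurable_funM => //; exact: measurable_funX.
  - by apply: emeasurable_funD; apply/measurable_EFinP/measurable_funM => //; exact: measurable_funX.
  - move=> z _; rewrite -!EFinM -EFinD lee_fin /sq ReD ReN ImD ImN.
    move: (Re (u z)) (Re (flow_sum s z)) (Im (u z) - _) => x y w.
    have := sqr_ge0 w; have := sqr_ge0 (2 * x - y); nra.
have m1 : measurable_fun G' (fun z => (Re (u z) ^+ 2)%:E) by apply/measurable_EFinP; exact: measurable_funX.
have m2 : measurable_fun G' (fun z => (sq (u z - flow_sum s z))%:E) by exact/measurable_EFinP.
have p1 z : G' z -> (0 <= (Re (u z) ^+ 2)%:E)%E by rewrite lee_fin sqr_ge0.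
have p2 z : G' z -> (0 <= (sq (u z - flow_sum s z))%:E)%E by rewrite lee_fin sq_ge0.
rewrite ge0_integralD//; [|by move=> z Gz; rewrite mule_ge0// p1|exact: measurable_funeM|by move=> z Gz; rewrite mule_ge0// p2|exact: measurable_funeM].
rewrite !ge0_integralZl//.
have -> : 8 * A + 16 * pi * tail phi s = 8 * A + 8 * (2 * pi * tail phi s) by ring.
have -> : (8 * A + 8 * (2 * pi * tail phi s))%:E = (8%:E * A%:E + 8%:E * (2 * pi * tail phi s)%:E)%E by [].
apply: leeD; apply: lee_wpmul2l => //.
apply: le_trans (defect_le us); apply: ge0_subset_integral => //.
- have [gR gI] := cmeas_flow_sum s mS (@spacetime_torus R d).
  apply/measurable_EFinP; apply: cmeas_sq; split.
    by under eq_fun do rewrite ReD ReN; exact: measurable_funB.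
  by under eq_fun do rewrite ImD ImN; exact: measurable_funB.
- by move=> z _; rewrite lee_fin sq_ge0.
Qed.

End observation.

Lemma collect_terms (R : realFieldType) (v i p S Q A e t nn : R) :
  t * (1 + v * i * (16 * p)) <= e -> v * S <= v * (nn + 4^-1 * Q) ->
  v * nn <= v * (i * (8 * A + 16 * p * t)) ->
  t + v * S <= e + (8 * v * i * A + v / 4 * Q).
Proof. lra. Qed.

Theorem theorem4p1 (R : realType) (d : nat) (d_gt0 : (0 < d)%N)
    (G : set (Rn R d.+1)) (G_admissible : admissible G) (c : R) :
  exists2 C : R, 0 < C &
    forall (phi : Rn R d -> R[i]) (u : Rn R d.+1 -> R[i]),
      L2torus phi -> schrodinger_flow c phi u ->
      (sqL2norm (lebesgueRn d) (torus d) phi <=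
        C%:E * sqL2norm (completed_lebesgueRn d.+1) G
                 (fun z => (complex.Re (u z))%:C%C) +
        sqL2norm (lebesgueRn d) (torus d) (proj_Im c phi))%E.
Proof.
have [G' [mG G'G posG aG aW]] := admissible_core d_gt0 c G_admissible.
have [delta d0 obs] := finite_observability mG aG posG aW.
have GS : G' `<=` spacetime d.
  by move=> z /G'G; case: G_admissible => P [Gs [_ _ ->]] [].
have v0 := @vol_gt0 R d.
exists (8 * vol d / delta); first by rewrite divr_gt0// mulr_gt0.
move=> phi u Lphi fu; set O := sqL2norm (completed_lebesgueRn _) _ _.
have lphi := L2torus_l2 Lphi.
have O0 : (0 <= O)%E by apply: integral_ge0 => z _; rewrite lee_fin sqr_ge0.
have P0 : (0 <= sqL2norm (lebesgueRn d) (torus d) (proj_Im c phi))%E.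
  by apply: integral_ge0 => z _; rewrite lee_fin sqr_ge0.
have C0 : 0 < 8 * vol d / delta by rewrite divr_gt0// mulr_gt0.
have hO : (\int[lebesgueRn d.+1]_(z in G') (Re (u z) ^+ 2)%:E <= O)%E.
  have [[mR _] _] := fu.
  have -> : O = (\int[completed_lebesgueRn d.+1]_(z in G) (Re (u z) ^+ 2)%:E)%E.
    by apply: eq_integral => z _; rewrite -(sqC (Re (u z))) sqE.
  apply: completed_ge => //.
    apply/measurable_EFinP/measurable_funX.
    exact: (measurable_funS (@measurable_spacetime R d) GS).
  by move=> z; rewrite lee_fin sqr_ge0.
case: O O0 hO => [A| |//] O0 hO; last first.
  by rewrite gt0_muley// addye ?leey// gt_eqF// (lt_le_trans _ P0).
have [Z hZ] := @resonant_list R d c.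
pose K := 1 + vol d / delta * (16 * pi).
have K0 : 0 < K by rewrite addr_gt0// mulr_gt0 ?divr_gt0// mulr_gt0// pi_gt0.
(* symmetry of s pairs the waves with their conjugates; the resonant sphere is included
   because the projection term involves all of it *)
have main (e : R) : 0 < e -> exists s : seq (d.-tuple int), [/\ uniq s, symmetric s,
    (forall n, resonant c n -> n \in s) & tail phi s <= e].
  move=> e0; have [s0 us0 hs0] := tail_small lphi e0.
  exists (undup (s0 ++ Z ++ map (@neg d) (s0 ++ Z))); split.
  - exact: undup_uniq.
  - move=> n; rewrite !mem_undup !mem_cat => /or3P[h|h|/mapP[m]].
    + by rewrite (map_f (@neg d)) ?mem_cat ?h// !orbT.
    + by rewrite (map_f (@neg d)) ?mem_cat ?h ?orbT// !orbT.
    + by rewrite mem_cat => h ->; rewrite negK; case/orP: h => ->; rewrite ?orbT.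
  - by move=> n /hZ nZ; rewrite mem_undup !mem_cat nZ !orbT.
  - by apply: hs0; [exact: undup_uniq|move=> n ns; rewrite mem_undup mem_cat ns].
have [s1 [us1 sy1 hs1 _]] := main 1 ltr01.
rewrite sqL2normE ib_integral; last by case: lphi.
rewrite (proj_Im_mass phi us1 sy1 hs1) -EFinM -EFinD lee_fin.
apply/ler_addgt0Pl => e e0.
have [s [us sy hs ts]] := main (e / K) (divr_gt0 e0 K0).
have hP : \sum_(n <- s1 | resonant c n) sq (hat phi n - reflected (hat phi) n) =
    \sum_(n <- s | resonant c n) sq (hat phi n - reflected (hat phi) n).
  rewrite -[LHS]big_filter -[RHS]big_filter; apply: perm_big; apply: uniq_perm; rewrite ?filter_uniq// => n.
  rewrite !mem_filter.
  by case rn: (resonant c n) => //=; rewrite hs1// hs.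
have := observed_energy Lphi fu mG GS us sy hO.
have := obs s (fwd c (hat phi)) (bwd c (hat phi)) us (supp_resonant c (hat phi)).
have := energy_lower c (hat phi) us sy.
rewrite hP; move: (energy _ _ _) (observed _ _ _ _ _) => nn th h1 h2 h3.
have h4 : nn <= delta^-1 * (8 * A + 16 * pi * tail phi s).
  by rewrite mulrC ler_pdivlMr// mulrC (le_trans h2).
have h5 : tail phi s * K <= e by rewrite -ler_pdivlMr.
have h6 := ler_wpM2l (ltW v0) h1; have h7 := ler_wpM2l (ltW v0) h4.
rewrite [leLHS](_ : _ = tail phi s + vol d * \sum_(n <- s) sq (hat phi n)); last by rewrite /tail subrK.
exact: (collect_terms h5 h6 h7).
Qed.
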